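(* In the setting described in the context with $d=2$, suppose that $\boldsymbol\alpha=(2,2)$ and $\mu_1=\mu_2=0$ (so $\mathbf b_n\equiv\mathbf 0$), and assume that $\sum_{n=1}^{+\infty}(a_n^{(1)}a_n^{(2)})^{-1}<+\infty$. Let $G(\mathbf x):=\sum_{n=1}^\infty\mathbf P(\mathbf S_n=\mathbf x)$, and for $\mathbf x=(x_1,x_2)\in\mathbb Z^2$ let $n_i=n_i(\mathbf x)$, $i=1,2$, be defined by $a^{(i)}_{n_i}=|x_i|$. If $\|\mathbf x\|\to+\infty$ in such a way that $|x_2|/a^{(2)}_{n_1}$ (equivalently $n_1/n_2$) stays bounded away from $0$ and $+\infty$, then $$G(\mathbf x)\sim g_{\boldsymbol\alpha}(0,0)\sum_{n\ge n_1}\frac1{a_n^{(1)}a_n^{(2)}}.$$ Moreover, $n_1\mapsto\sum_{n\ge n_1}(a_n^{(1)}a_n^{(2)})^{-1}$ is a slowly varying function that vanishes at infinity.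
   Context: Setting. Let $d=2$, let $(\mathbf X_j)_{j\ge1}$ be i.i.d. $\mathbb Z^2$-valued random vectors, $\mathbf X_j=(X_j^{(1)},X_j^{(2)})$, $\mathbf S_0=\mathbf 0$ and $\mathbf S_n=\sum_{j=1}^n\mathbf X_j$. The walk is aperiodic: the support of $\mathbf X_1$ is not contained in a translate of a proper subgroup of $\mathbb Z^2$. It is in the domain of attraction of a normal law with index $\boldsymbol\alpha=(2,2)$: for $i=1,2$ the function $\sigma_i(x):=\mathbf E[(X_1^{(i)})^2\mathbf 1_{\{|X_1^{(i)}|\le x\}}]$ is slowly varying, the scaling sequence $a_n^{(i)}>0$ satisfies $\sigma_i(a_n^{(i)})(a_n^{(i)})^{-2}\sim1/n$, $\mu_i=\mathbf E[X_1^{(i)}]$, $b_n^{(i)}=n\mu_i$, and $$\Big(\frac{S_n^{(1)}-b_n^{(1)}}{a_n^{(1)}},\frac{S_n^{(2)}-b_n^{(2)}}{a_n^{(2)}}\Big)\Rightarrow\mathbf Z\quad\text{in distribution},$$ where $\mathbf Z$ is a (normal) law with non-degenerate density $g_{\boldsymbol\alpha}$ on $\mathbb R^2$. Standing tail domination assumption: there are slowly varying functions $\varphi_i$ and exponents $\gamma_i\ge2$ with $\mathbf P(X_1^{(i)}\le -x)+\mathbf P(X_1^{(i)}>x)\le\varphi_i(x)x^{-\gamma_i}$ for all $x\in\mathbb N$, $i=1,2$, chosen so that: if $\mathbf E[(X_1^{(i)})^2]=+\infty$ then $\gamma_i=2$ and $\varphi_i=O(\sigma_i)$; if $\mathbf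 E[(X_1^{(i)})^2]<+\infty$ then $\sum_{n\ge1}\varphi_i(n)n^{1-\gamma_i}<+\infty$. Conventions. All regularly varying quantities are regarded as functions of positive real numbers (and may be taken infinitely differentiable), so $n_i$ need not be an integer; $a^{(i)}_{n_i}=|x_i|$ defines $n_i$ up to asymptotic equivalence, and any choice is allowed. Coordinates are ordered so that $a_n^{(1)}\le a_n^{(2)}$, and the limit of $a_n^{(1)}/a_n^{(2)}$ is assumed to exist and belong to $\{0,1\}$. $\|\cdot\|$ is the $L^1$ norm. *)

(* Defs.v *)
From HB Require Import structures.
From mathcomp Require Import all_boot all_order all_algebra finmap.
From mathcomp Require Import all_classical all_reals all_analysis.

Set Implicit Arguments.
Unset Strict Implicit.
Unset Printing Implicit Defensive.
Import Order.TTheory GRing.Theory Num.Theory.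
Import numFieldNormedType.Exports.

Local Open Scope classical_set_scope.
Local Open Scope ring_scope.

Section SlowVariation.
Context {R : realType}.

Definition asymp_equiv {T : Type} (F : set_system T) (f g : T -> R) : Prop :=
  f x / g x @[x --> F] --> (1 : R).

Definition slowly_varying (L : R -> R) : Prop :=
  (exists M : R, measurable_fun `[M, +oo[ L /\ forall x, M <= x -> 0 < L x) /\
  forall lam : R, 0 < lam -> L (lam * x) / L x @[x --> +oo] --> (1 : R).

(* [n k] solves a_(n k) = k up to asymptotic equivalence; [n 0] is irrelevant. *)
Definition scale_index (a : R -> R) (n : nat -> R) : Prop :=
  [/\ forall k : nat, (0 < k)%N -> 0 < n k,
      n k @[k --> \oo] --> +oo
    & asymp_equiv \oo (fun k => a (n k)) (fun k : nat => k%:R)].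

Definition bounded_away_0oo (r : nat -> R) : Prop :=
  exists c C : R, 0 < c /\ \forall k \near \oo, c <= r k <= C.

Definition tail_sum (a1 a2 : R -> R) (t : R) : R :=
  fine (\sum_(1 <= n <oo | (t <= n%:R)%R) ((a1 n%:R * a2 n%:R)^-1)%:E)%E.

(* Density of the normal law on R^2 with mean m and covariance matrix
   [[s11, s12], [s12, s22]]. *)
Definition normal_pdf2 (m : R * R) (s11 s12 s22 : R) (z : R * R) : R :=
  let D := s11 * s22 - s12 ^+ 2 in
  let u := z.1 - m.1 in
  let v := z.2 - m.2 in
  expR (- (s22 * u ^+ 2 - 2 * s12 * u * v + s11 * v ^+ 2) / (2 * D))
  / (2 * pi * Num.sqrt D).

Definition nondegenerate_normal_density (g : R * R -> R) : Prop :=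
  exists (m : R * R) (s11 s12 s22 : R),
    [/\ 0 < s11, 0 < s11 * s22 - s12 ^+ 2 & g = normal_pdf2 m s11 s12 s22].

End SlowVariation.

Section Walk.
Context {R : realType} {d : measure_display} {Omega : measurableType d}.
Variable P : probability Omega R.

Definition cvg_in_law_to_density (Y : nat -> Omega -> R * R)
    (g : R * R -> R) : Prop :=
  forall f : R * R -> R, continuous f -> (exists M : R, forall z, `|f z| <= M) ->
    (\int[P]_w (f (Y n w))%:E @[n --> \oo] -->
     \int[lebesgue_measure \x lebesgue_measure]_z (f z * g z)%:E)%E.

(* The step written X_(j+1) in the usual indexing is [X j]. *)
Definition iid_steps (X : nat -> Omega -> int * int) : Prop :=
  [/\ forall j x, measurable (X j @^-1` [set x]),
      forall (J : {fset nat}) (A : nat -> set (int * int)),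
        P (\bigcap_(j in [set` J]) X j @^-1` A j) =
        (\prod_(j <- J) P (X j @^-1` A j))%E
    & forall j A, P (X j @^-1` A) = P (X 0%N @^-1` A)].

Definition aperiodic (X : nat -> Omega -> int * int) : Prop :=
  forall (H : {pred int * int}) (v : int * int), zmod_closed H ->
    (forall x, P (X 0%N @^-1` [set x]) != 0%E -> x - v \in H) ->
    forall x, x \in H.

Definition walk (X : nat -> Omega -> int * int) (n : nat) (w : Omega) :
  int * int := \sum_(j < n) X j w.

Definition coord1 (X : nat -> Omega -> int * int) (j : nat) (w : Omega) : R :=
  (X j w).1%:~R.
Definition coord2 (X : nat -> Omega -> int * int) (j : nat) (w : Omega) : R :=
  (X j w).2%:~R.

Definition rescaled_walk (X : nat -> Omega -> int * int) (mu1 mu2 : R)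
    (a1 a2 : R -> R) (n : nat) (w : Omega) : R * R :=
  ((coord1 (walk X) n w - n%:R * mu1) / a1 n%:R,
   (coord2 (walk X) n w - n%:R * mu2) / a2 n%:R).

Definition green (X : nat -> Omega -> int * int) (x : int * int) : \bar R :=
  (\sum_(1 <= n <oo) P (walk X n @^-1` [set x]))%E.

Definition truncated_second_moment (Y : Omega -> R) (x : R) : R :=
  \int[P]_(w in [set w | `|Y w| <= x]) (Y w ^+ 2).

Definition scaling_function (Y : Omega -> R) (a : R -> R) : Prop :=
  [/\ slowly_varying (truncated_second_moment Y),
      forall t, 0 < t -> 0 < a t
    & asymp_equiv (pinfty_nbhs R)
        (fun t => truncated_second_moment Y (a t) / a t ^+ 2) (fun t => t^-1)].

Definition tail_domination (Y : Omega -> R) (phi : R -> R) (gamma : R) : Prop :=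
  [/\ slowly_varying phi, 2 <= gamma,
      forall k : nat, (0 < k)%N ->
        (P [set w | (Y w <= - k%:R)%R] + P [set w | (k%:R < Y w)%R] <=
         (phi k%:R * k%:R `^ (- gamma))%:E)%E,
      ('E_P[fun w => (Y w ^+ 2)%R] = +oo)%E ->
        gamma = 2 /\ exists C : R, \forall x \near +oo,
          `|phi x| <= C * `|truncated_second_moment Y x|
    & ('E_P[fun w => (Y w ^+ 2)%R] < +oo)%E ->
        (\sum_(1 <= n <oo) (phi n%:R * n%:R `^ (1 - gamma))%:E < +oo)%E].

End Walk.

Definition norm1 (x : int * int) : nat := (`|x.1| + `|x.2|)%N.

(* Main.v *)
(* Write [c n = 1 / (a1 n * a2 n)] and [S] for its tail sums.  Fourier analysis
   gives [P (S_n = x) = O(c n)] and a Lipschitz bound in [x]: the weak limit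
   makes the characteristic function contract on the dyadic shells around [0],
   aperiodicity handles the rest of the torus.  Averaging the Lipschitz bound
   over a small box and comparing with the weak limit yields
   [P (S_n = x) ~ g (0, 0) * c n] as soon as [x] is small on the scale [a n].
   For [n] up to a multiple of [N = n1 (|x1|)] one of the two halves of the path
   must move by [|x1| / 2], which has probability [O(n / N)], so that
   [P (S_n = x) = O(c n * n / N)].  These terms add up to [O(N * c N)], and
   [N * c N = o(S N)] because every dyadic block beyond [N] contributes about
   [N * c N] to [S N].  The same estimate shows that [S] varies slowly. *)
Require Import Defs.
From mathcomp Require Import all_boot all_order all_algebra finmap.
From mathcomp Require Import all_classical all_reals all_analysis.
From mathcomp Require Import measurable_realfun ring lra zify.
Set Implicit Arguments.
Unset Strict Implicit.
Unset Printing Implicit Defensive.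
Import Order.TTheory GRing.Theory Num.Theory.
Import numFieldNormedType.Exports.
Local Open Scope classical_set_scope.
Local Open Scope ring_scope.

(** * Discrete random variables and the law of the walk *)

Section Discrete.
Context {R : realType} {d : measure_display} {Omega : measurableType d}.
Variable P : probability Omega R.

(** The first obstacle is met by multiplicativity: the modulus at time [n] is the [n]-th power of
    the modulus at time 1, so one contraction at time [2 ^ j] on the [j]-th shell, valid because the
    weak limit charges two separate boxes, becomes [rho ^+ (2 ^ (J - j))] at time [2 ^ J] and beats
    the growth of the shells. The second is met by replacing the square with a bounded smooth
    function. Moduli suffice because the constant [g (0, 0)] comes from the weak limit itself, not
    from Fourier inversion. A local limit theorem at the origin is enough: past a large multiple of
    [N] the point [x] is small on both scales, since [|x1|] is comparable with [a1 N] and [|x2|] is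
    at most a multiple of [a2 N]. The short times are controlled by the first coordinate alone. *)

Definition discrete_rv (T : Type) (V : Omega -> T) :=
  forall A : set T, measurable (V @^-1` A).

Lemma discrete_rv_countable (T : countType) (V : Omega -> T) :
  (forall x, measurable (V @^-1` [set x])) -> discrete_rv V.
Proof.
move=> mV A; rewrite (_ : V @^-1` A = \bigcup_(x in A) V @^-1` [set x]).
  rewrite bigcup_mkcond; apply: countable_bigcupT_measurable => // x.
  by case: ifP.
by apply/seteqP; split => [w Aw|w [x Ax Vx]]; [exists (V w)|rewrite /= Vx].
Qed.

Lemma discrete_rv_comp (T U : Type) (V : Omega -> T) (f : T -> U) :
  discrete_rv V -> discrete_rv (f \o V).
Proof. by move=> mV A; rewrite comp_preimage; exact: mV. Qed.

Lemma discrete_rv_pair (T U : countType) (V : Omega -> T) (W : Omega -> U) :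
  discrete_rv V -> discrete_rv W -> discrete_rv (fun w => (V w, W w)).
Proof.
move=> mV mW; apply: discrete_rv_countable => -[x y].
rewrite (_ : _ @^-1` _ = V @^-1` [set x] `&` W @^-1` [set y]).
  exact: measurableI.
by apply/seteqP; split => w /= [-> ->].
Qed.

(** The sigma-algebra on the target is in effect its whole power set, so no regularity is asked of
    [f]. *)
Lemma discrete_rv_emeasurable (T : Type) (V : Omega -> T) (f : T -> \bar R) :
  discrete_rv V -> measurable_fun setT (fun w => f (V w)).
Proof. by move=> mV _ B _; rewrite setTI; exact: (discrete_rv_comp f mV). Qed.

Lemma discrete_rv_measurable (T : Type) (V : Omega -> T) (f : T -> R) :
  discrete_rv V -> measurable_fun setT (fun w => f (V w)).
Proof. by move=> mV _ B _; rewrite setTI; exact: (discrete_rv_comp f mV). Qed.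

(** The codes [pickle (V w)] cut [Omega] into countably many disjoint slices on which [F (V w)] is
    constant; numbers that code nothing give empty slices. *)
Lemma integral_discrete_rv (T : countType) (V : Omega -> T) (F : T -> \bar R) :
  discrete_rv V -> (forall x, 0 <= F x)%E ->
  (\int[P]_w F (V w) = \esum_(x in [set: T]) (F x * P (V @^-1` [set x])))%E.
Proof.
move=> mV F0.
pose A n := (choice.pickle \o V) @^-1` [set n].
have UA : \bigcup_n A n = setT.
  by apply/seteqP; split => // w _; exists (choice.pickle (V w)).
rewrite -UA ge0_integral_bigcup => //; first last.
- apply/trivIsetP => i j _ _ ij; apply/seteqP; split => // w /= [wi wj].
  by move: ij; rewrite -wi -wj eqxx.
- by rewrite UA; exact: discrete_rv_emeasurable.
- by move=> n; exact: discrete_rv_comp.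
rewrite nneseries_esumT; last by move=> n; exact: integral_ge0.
rewrite (esumID [set` range (@choice.pickle T)]); first last.
  by move=> n _; exact: integral_ge0.
rewrite [X in (_ + X)%E]esum1 ?adde0; last first.
  move=> n [_ /= nr]; rewrite (_ : A n = set0) ?integral_set0//.
  apply/seteqP; split => // w /= eq; apply: nr; rewrite inE.
  by exists (V w).
rewrite (_ : _ `&` _ = range (@choice.pickle T)); last first.
  by apply/seteqP; split => [n [_]|n nr] /=; rewrite ?inE//; split => //; rewrite inE.
rewrite esum_image; last first.
  by move=> x y _ _; exact: (pcan_inj choice.pickleK).
apply: eq_esum => x _.
have -> : A (choice.pickle x) = V @^-1` [set x].
  by apply/seteqP; split => [w /(pcan_inj choice.pickleK)|w Vw]; rewrite // /A /= Vw.
rewrite -integral_cst//.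
by apply: eq_integral => w; rewrite inE /= => ->.
Qed.

Definition indep_rv (T U : Type) (V : Omega -> T) (W : Omega -> U) :=
  forall x y, P (V @^-1` [set x] `&` W @^-1` [set y]) =
    (P (V @^-1` [set x]) * P (W @^-1` [set y]))%E.

(** Tonelli's theorem read on atoms, so that no product measure on [T * U] appears. An [H] that is
    not a product occurs in [sum_indep_atom], where it tests the value of a sum [V w + W w]. *)
Lemma ge0_integral_freeze (T U : countType) (V : Omega -> T) (W : Omega -> U)
    (H : T -> U -> \bar R) :
  discrete_rv V -> discrete_rv W -> indep_rv V W ->
  (forall x y, 0 <= H x y)%E ->
  (\int[P]_w H (V w) (W w) = \int[P]_w \int[P]_w' H (V w) (W w'))%E.
Proof.
move=> mV mW VW H0.
rewrite (integral_discrete_rv (V := fun w => (V w, W w))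
  (F := fun z => H z.1 z.2)); last 2 first.
- exact: discrete_rv_pair.
- by move=> z; exact: H0.
rewrite (_ : [set: T * U] = setT `*`` (fun _ => setT)); last first.
  by apply/seteqP; split.
under eq_esum => z _.
  rewrite (_ : _ @^-1` _ = V @^-1` [set z.1] `&` W @^-1` [set z.2]); last first.
    by apply/seteqP; case: z => x y; split => w /= [-> ->].
  rewrite VW; over.
rewrite -(esum_esum (a := fun x y => (H x y *
    (P (V @^-1` [set x]) * P (W @^-1` [set y])))%E)); last first.
  by move=> x y _ _; do ?apply: mule_ge0.
rewrite (integral_discrete_rv (F := fun x => (\int[P]_w' H x (W w'))%E))//; last first.
  by move=> x; exact: integral_ge0.
apply: eq_esum => x _.
rewrite muleC -ge0_integralZl //; last exact: discrete_rv_emeasurable.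
rewrite (integral_discrete_rv (F := fun y => (P (V @^-1` [set x]) * H x y)%E))//;
  last by move=> y; exact: mule_ge0.
by apply: eq_esum => y _; rewrite muleA; congr (_ * _)%E; rewrite muleC.
Qed.

Lemma ge0_integral_indep (T U : countType) (V : Omega -> T) (W : Omega -> U)
    (F : T -> \bar R) (G : U -> \bar R) :
  discrete_rv V -> discrete_rv W -> indep_rv V W ->
  (forall x, 0 <= F x)%E -> (forall y, 0 <= G y)%E ->
  (\int[P]_w (F (V w) * G (W w)) = \int[P]_w F (V w) * \int[P]_w G (W w))%E.
Proof.
move=> mV mW VW F0 G0.
rewrite (ge0_integral_freeze (H := fun x y => (F x * G y)%E))//; last first.
  by move=> x y; exact: mule_ge0.
rewrite -ge0_integralZr//; last 2 first.
- exact: discrete_rv_emeasurable.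
- exact: integral_ge0.
apply: eq_integral => w _; rewrite -ge0_integralZl//.
exact: discrete_rv_emeasurable.
Qed.

Definition bounded_by (T : Type) (f : T -> R) (M : R) := forall x, `|f x| <= M.

Lemma integrable_discrete_rv (T : Type) (V : Omega -> T) (f : T -> R) (M : R) :
  discrete_rv V -> bounded_by f M -> P.-integrable setT (EFin \o (fun w => f (V w))).
Proof.
move=> mV fM; apply: (@le_integrable _ _ _ _ _ measurableT _ (cst M%:E)).
- exact/measurable_EFinP/discrete_rv_measurable.
- move=> w _ /=; rewrite lee_fin; apply: (le_trans (fM _)); exact: ler_norm.
- exact: finite_measure_integrable_cst.
Qed.


Lemma integrable_indep (T U : countType) (V : Omega -> T) (W : Omega -> U)
    (F : T -> R) (G : U -> R) :
  discrete_rv V -> discrete_rv W -> indep_rv V W ->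
  P.-integrable setT (EFin \o (fun w => F (V w))) ->
  P.-integrable setT (EFin \o (fun w => G (W w))) ->
  P.-integrable setT (EFin \o (fun w => F (V w) * G (W w))).
Proof.
move=> mV mW VW /integrableP[_ iF] /integrableP[_ iG]; apply/integrableP; split.
  apply/measurable_EFinP/measurable_funM; exact: discrete_rv_measurable.
under eq_integral do rewrite /= normrM EFinM.
rewrite (ge0_integral_indep (F := fun x => `|F x|%:E) (G := fun y => `|G y|%:E))//.
by apply: lte_mul_pinfty => //; rewrite ?ge0_fin_numE ?integral_ge0.
Qed.

(** Each factor in turn is split into its positive and negative parts, which reduces the claim to
    the nonnegative case. *)
Lemma Rintegral_indep (T U : countType) (V : Omega -> T) (W : Omega -> U)
    (F : T -> R) (G : U -> R) :
  discrete_rv V -> discrete_rv W -> indep_rv V W ->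
  P.-integrable setT (EFin \o (fun w => F (V w))) ->
  P.-integrable setT (EFin \o (fun w => G (W w))) ->
  \int[P]_w (F (V w) * G (W w)) = (\int[P]_w F (V w)) * (\int[P]_w G (W w)).
Proof.
move=> mV mW VW.
have pos_part (S : countType) (Z : Omega -> S) (H : S -> R) : discrete_rv Z ->
    P.-integrable setT (EFin \o (fun w => H (Z w))) ->
    P.-integrable setT (EFin \o (fun w => Num.max (H (Z w)) 0)).
  move=> mZ iH; apply: le_integrable iH => //.
    by apply/measurable_EFinP; apply: (discrete_rv_measurable (fun z => Num.max (H z) 0)).
  move=> w _ /=; rewrite lee_fin ger0_norm ?le_max ?lexx ?orbT//.
  by rewrite ge_max ler_norm/=.
have maxB (a : R) : a = Num.max a 0 - Num.max (- a) 0.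
  by have [h|h] := lerP 0 a; have [h'|h'] := lerP (- a) 0; lra.
have opp_int (S : countType) (Z : Omega -> S) (H : S -> R) :
    P.-integrable setT (EFin \o (fun w => H (Z w))) ->
    P.-integrable setT (EFin \o (fun w => - H (Z w))).
  by move=> /integrableN.
have nonneg F' G' : (forall x, 0 <= F' x) -> (forall y, 0 <= G' y) ->
    P.-integrable setT (EFin \o (fun w => F' (V w))) ->
    P.-integrable setT (EFin \o (fun w => G' (W w))) ->
    \int[P]_w (F' (V w) * G' (W w)) = (\int[P]_w F' (V w)) * (\int[P]_w G' (W w)).
  move=> F0 G0 iF iG.
  rewrite /Rintegral; under eq_integral do rewrite EFinM.
  rewrite (ge0_integral_indep (F := EFin \o F') (G := EFin \o G'))//.
  by rewrite fineM//; exact: integrable_fin_num.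
have step F' G' : (forall y, 0 <= G' y) ->
    P.-integrable setT (EFin \o (fun w => F' (V w))) ->
    P.-integrable setT (EFin \o (fun w => G' (W w))) ->
    \int[P]_w (F' (V w) * G' (W w)) = (\int[P]_w F' (V w)) * (\int[P]_w G' (W w)).
  move=> G0 iF iG.
  have i1 := pos_part _ _ _ mV iF.
  have i2 := pos_part _ _ (fun x => - F' x) mV (opp_int _ _ _ iF).
  transitivity (\int[P]_w (Num.max (F' (V w)) 0 * G' (W w) -
                           Num.max (- F' (V w)) 0 * G' (W w))).
    by apply: eq_Rintegral => w _; rewrite -mulrBl -maxB.
  rewrite RintegralB//; last 2 first.
  - exact: (integrable_indep (F := fun x => Num.max (F' x) 0)).
  - exact: (integrable_indep (F := fun x => Num.max (- F' x) 0)).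
  have m0 (H : T -> R) x : 0 <= Num.max (H x) 0 by rewrite le_max lexx orbT.
  rewrite (nonneg (fun x => Num.max (F' x) 0))//.
  rewrite (nonneg (fun x => Num.max (- F' x) 0))//; last exact: (m0 (fun x => - F' x)).
  rewrite -mulrBl -RintegralB//; congr (_ * _).
  by apply: eq_Rintegral => w _; rewrite -maxB.
move=> iF iG.
have i1 := pos_part _ _ _ mW iG.
have i2 := pos_part _ _ (fun x => - G x) mW (opp_int _ _ _ iG).
transitivity (\int[P]_w (F (V w) * Num.max (G (W w)) 0 -
                         F (V w) * Num.max (- G (W w)) 0)).
  by apply: eq_Rintegral => w _; rewrite -mulrBr -maxB.
rewrite RintegralB//; last 2 first.
- exact: (integrable_indep (G := fun x => Num.max (G x) 0)).
- exact: (integrable_indep (G := fun x => Num.max (- G x) 0)).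
have m0 (H : U -> R) x : 0 <= Num.max (H x) 0 by rewrite le_max lexx orbT.
rewrite (step F (fun x => Num.max (G x) 0))//.
rewrite (step F (fun x => Num.max (- G x) 0))//; last exact: (m0 (fun x => - G x)).
rewrite -mulrBr -RintegralB//; congr (_ * _).
by apply: eq_Rintegral => w _; rewrite -maxB.
Qed.

Lemma Rintegral_same_law (T : countType) (V V' : Omega -> T) (F : T -> R) :
  discrete_rv V -> discrete_rv V' ->
  (forall x, P (V @^-1` [set x]) = P (V' @^-1` [set x])) ->
  \int[P]_w F (V w) = \int[P]_w F (V' w).
Proof.
move=> mV mV' VV'.
have law H : (forall x, 0 <= H x)%E -> (\int[P]_w H (V w) = \int[P]_w H (V' w))%E.
  move=> H0; rewrite !integral_discrete_rv//.
  by apply: eq_esum => x _; rewrite VV'.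
rewrite /Rintegral; congr fine; rewrite integralE [RHS]integralE.
congr (_ - _)%E.
  under eq_integral do rewrite funeposE; under [RHS]eq_integral do rewrite funeposE.
  by apply: (law (fun x => maxe (F x)%:E 0)) => x; rewrite le_max lexx orbT.
under eq_integral do rewrite funenegE; under [RHS]eq_integral do rewrite funenegE.
by apply: (law (fun x => maxe (- (F x)%:E) 0)%E) => x; rewrite le_max lexx orbT.
Qed.

End Discrete.

Section indep_comp.
Context {R : realType} {d : measure_display} {Omega : measurableType d}.
Variable P : probability Omega R.

Lemma integral_preimage (T : Type) (V : Omega -> T) (A : set T) :
  discrete_rv V -> (\int[P]_w (\1_A (V w))%:E = P (V @^-1` A))%E.
Proof.
by move=> mV; have := integral_indic P measurableT (mV A); rewrite setIT.
Qed.

Lemma indep_rv_set (T U : countType) (V : Omega -> T) (W : Omega -> U) A B :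
  discrete_rv V -> discrete_rv W -> indep_rv P V W ->
  P (V @^-1` A `&` W @^-1` B) = (P (V @^-1` A) * P (W @^-1` B))%E.
Proof.
move=> mV mW VW; rewrite -!integral_preimage//.
rewrite -(ge0_integral_indep (F := fun x => (\1_A x)%:E) (G := fun x => (\1_B x)%:E))//;
  try by move=> x; rewrite lee_fin.
have := integral_indic P measurableT (measurableI _ _ (mV A) (mW B)).
by rewrite setIT => <-; apply: eq_integral => w _; rewrite indicI EFinM.
Qed.

Lemma same_law_set (T : countType) (V V' : Omega -> T) A :
  discrete_rv V -> discrete_rv V' ->
  (forall x, P (V @^-1` [set x]) = P (V' @^-1` [set x])) ->
  P (V @^-1` A) = P (V' @^-1` A).
Proof.
move=> mV mV' VV'; rewrite -!integral_preimage//.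
have A0 (x : T) : (0 <= (\1_A x)%:E :> \bar R)%E by rewrite lee_fin.
rewrite (integral_discrete_rv P mV A0) (integral_discrete_rv P mV' A0).
by apply: eq_esum => x _; rewrite VV'.
Qed.

End indep_comp.

Section Blocks.
Context {R : realType} {d : measure_display} {Omega : measurableType d}.
Variable P : probability Omega R.
Variable X : nat -> Omega -> int * int.
Hypothesis Xiid : iid_steps P X.

(** A stretch of steps kept as a list lives in a countable type; its atoms are finite intersections
    whose probability [iid_steps] prescribes, and walks and increments are functions of it. *)
Definition block s n w := [seq X i w | i <- iota s n].

Lemma discrete_step j : discrete_rv (X j).
Proof. by case: Xiid => mX _ _; apply: discrete_rv_countable => x. Qed.

Lemma discrete_block s n : discrete_rv (block s n).
Proof.
elim: n s => [|n IH] s.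
  move=> A; have [A0|A0] := pselect (A [::]).
    by rewrite (_ : _ @^-1` _ = setT)//; apply/seteqP; split.
  by rewrite (_ : _ @^-1` _ = set0)//; apply/seteqP; split.
apply: (discrete_rv_comp (fun z => z.1 :: z.2)
  (V := fun w => (X s w, block s.+1 n w))).
exact: discrete_rv_pair (discrete_step s) (IH _).
Qed.

Lemma size_block s n w : size (block s n w) = n.
Proof. by rewrite size_map size_iota. Qed.

Lemma block_law s n (t : seq (int * int)) : size t = n ->
  P (block s n @^-1` [set t]) = (\prod_(x <- t) P (X 0%N @^-1` [set x]))%E.
Proof.
move=> sz; case: Xiid => _ ind id.
pose A j := [set nth 0 t (j - s)%N].
have -> : block s n @^-1` [set t] =
    \bigcap_(j in [set` [fset j in iota s n]%fset]) X j @^-1` A j.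
  apply/seteqP; split => w.
    move=> /= tE j; rewrite /= !inE mem_iota => /andP[sj jn].
    by rewrite /A /= -tE /block (nth_map 0%N) ?size_iota ?nth_iota ?subnKC//; lia.
  move=> H /=; apply: (@eq_from_nth _ 0); first by rewrite size_block.
  move=> i; rewrite size_block => ni.
  rewrite (nth_map 0%N) ?size_iota// nth_iota//.
  have := H (s + i)%N; rewrite /A /= addKn; apply.
  by rewrite !inE mem_iota leq_addr/=; lia.
rewrite ind.
transitivity (\prod_(j <- iota s n) P (X 0%N @^-1` A j))%E.
  transitivity (\prod_(j <- [fset j in iota s n]%fset) P (X 0%N @^-1` A j))%E.
    by apply: eq_bigr => j _; exact: id.
  apply: perm_big; apply: uniq_perm => //; first exact: iota_uniq.
  by move=> i; rewrite !inE.
rewrite -[in RHS](mkseq_nth 0 t) sz /mkseq big_map.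
rewrite -{1}(addn0 s) iotaDl big_map.
by apply: eq_bigr => j _; rewrite /A addKn.
Qed.

Lemma block_law0 s n (t : seq (int * int)) : size t <> n ->
  P (block s n @^-1` [set t]) = 0%E.
Proof.
move=> sz; rewrite (_ : _ @^-1` _ = set0) ?measure0//.
by apply/seteqP; split => // w /= bt; apply: sz; rewrite -bt size_block.
Qed.

Lemma block_cat m k w : block 0 (m + k) w = block 0 m w ++ block m k w.
Proof. by rewrite /block iotaD map_cat. Qed.

(** Two lists of the right lengths describe one atom of the longer block, their concatenation, and
    [block_law] factors its mass; for other lengths both sides vanish. *)
Lemma indep_block m k : indep_rv P (block 0 m) (block m k).
Proof.
move=> t u.
have [st|/eqP st] := eqVneq (size t) m; last first.
  rewrite (block_law0 _ st) mul0e; apply/eqP; rewrite -measure_le0.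
  rewrite -(block_law0 0 st); apply: le_measure; rewrite ?inE.
  - by apply: measurableI; exact: discrete_block.
  - exact: discrete_block.
  - exact: subIsetl.
have [su|/eqP su] := eqVneq (size u) k; last first.
  rewrite (block_law0 _ su) mule0; apply/eqP; rewrite -measure_le0.
  rewrite -(block_law0 m su); apply: le_measure; rewrite ?inE.
  - by apply: measurableI; exact: discrete_block.
  - exact: discrete_block.
  - exact: subIsetr.
rewrite !block_law// -big_cat -(@block_law 0 (m + k)) ?size_cat ?st ?su//.
congr (P _); apply/seteqP; split => w; rewrite /= block_cat.
  by move=> [-> ->].
by move=> /eqP; rewrite eqseq_cat ?size_block// => /andP[/eqP -> /eqP ->].
Qed.

Lemma block_stationary m k t :
  P (block m k @^-1` [set t]) = P (block 0 k @^-1` [set t]).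
Proof.
have [st|/eqP st] := eqVneq (size t) k; first by rewrite !block_law.
by rewrite !block_law0.
Qed.

Definition incr m k w : int * int := \sum_(x <- block m k w) x.

Lemma walkE n w : walk X n w = incr 0 n w.
Proof. by rewrite /walk /incr /block big_map -[n in iota _ n]subn0 big_mkord. Qed.

Lemma walkD m k w : walk X (m + k) w = walk X m w + incr m k w.
Proof. by rewrite !walkE /incr block_cat big_cat. Qed.

Lemma discrete_incr m k : discrete_rv (incr m k).
Proof. exact: (discrete_rv_comp (fun t => \sum_(x <- t) x) (discrete_block m k)). Qed.

Lemma discrete_walk n : discrete_rv (walk X n).
Proof.
have -> : walk X n = incr 0 n by apply/funext => w; exact: walkE.
exact: discrete_incr.
Qed.

Lemma indep_walk_incr m k : indep_rv P (walk X m) (incr m k).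
Proof.
have -> : walk X m = incr 0 m by apply/funext => w; exact: walkE.
move=> x y; pose sum (t : seq (int * int)) := \sum_(z <- t) z.
exact: (indep_rv_set (sum @^-1` [set x]) (sum @^-1` [set y])
  (discrete_block 0 m) (discrete_block m k) (indep_block m k)).
Qed.

Lemma incr_stationary m k (A : set (int * int)) :
  P (incr m k @^-1` A) = P (walk X k @^-1` A).
Proof.
have -> : walk X k = incr 0 k by apply/funext => w; exact: walkE.
pose sum (t : seq (int * int)) := \sum_(z <- t) z.
apply: (same_law_set (sum @^-1` A) (discrete_block m k) (discrete_block 0 k)).
exact: block_stationary.
Qed.

Lemma incr1 n w : incr n 1 w = X n w.
Proof. by rewrite /incr /block /= big_seq1. Qed.

End Blocks.

Section Walk_law.
Context {R : realType} {d : measure_display} {Omega : measurableType d}.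
Variable P : probability Omega R.
Variable X : nat -> Omega -> int * int.
Hypothesis Xiid : iid_steps P X.

Definition pmf_walk n x : R := fine (P (walk X n @^-1` [set x])).

Lemma pmf_walkE n x : P (walk X n @^-1` [set x]) = (pmf_walk n x)%:E.
Proof. by rewrite /pmf_walk fineK//; apply: fin_num_measure; exact: (discrete_walk Xiid). Qed.

Lemma pmf_walk_ge0 n x : 0 <= pmf_walk n x.
Proof. exact: fine_ge0. Qed.

Lemma integrable_walk n (f : int * int -> R) (M : R) : bounded_by f M ->
  P.-integrable setT (EFin \o (fun w => f (walk X n w))).
Proof. exact: integrable_discrete_rv (discrete_walk Xiid n). Qed.

Lemma Rintegral_walkD m k (F G : int * int -> R) (M N : R) :
  bounded_by F M -> bounded_by G N ->
  \int[P]_w (F (walk X m w) * G (incr X m k w)) =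
  (\int[P]_w F (walk X m w)) * (\int[P]_w G (walk X k w)).
Proof.
move=> FM GN; have mW := discrete_walk Xiid m; have mI := discrete_incr Xiid m k.
rewrite (Rintegral_indep (F := F) (G := G) mW mI (indep_walk_incr Xiid m k)).
- congr (_ * _); apply: (Rintegral_same_law G mI (discrete_walk Xiid k)) => x.
  exact: incr_stationary.
- exact: integrable_walk FM.
- exact: integrable_discrete_rv mI GN.
Qed.

Lemma walk_step_same_law x : P (X 0%N @^-1` [set x]) = P (walk X 1 @^-1` [set x]).
Proof.
rewrite -(incr_stationary Xiid 0) (_ : X 0%N = incr X 0 1)//.
by apply/funext => w; rewrite incr1.
Qed.

End Walk_law.

(** * The characteristic function *)

Section Characteristic_function.
Context {R : realType} {d : measure_display} {Omega : measurableType d}.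
Variable P : probability Omega R.
Variable X : nat -> Omega -> int * int.
Hypothesis Xiid : iid_steps P X.

Definition phase (th : R * R) (z : int * int) : R :=
  th.1 * z.1%:~R + th.2 * z.2%:~R.

Lemma phaseD th y z : phase th (y + z) = phase th y + phase th z.
Proof. by rewrite /phase /= !intrD; ring. Qed.

Lemma phaseB th y z : phase th (y - z) = phase th y - phase th z.
Proof. by rewrite /phase /= !intrB; ring. Qed.

(* [chf] is the modulus of the characteristic function; only cosines and sines
   are used, so that no complex-valued integral is needed. *)
Definition ccos n th : R := \int[P]_w cos (phase th (walk X n w)).
Definition csin n th : R := \int[P]_w sin (phase th (walk X n w)).
Definition chf n th : R := Num.sqrt (ccos n th ^+ 2 + csin n th ^+ 2).

Lemma Rintegral_probability_cst (c : R) : \int[P]_w c = c.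
Proof.
rewrite Rintegral_cst// (_ : _ [set: Omega] = 1%E) ?mulr1//.
exact: probability_setT.
Qed.

Lemma bounded_cos (T : Type) (f : T -> R) : bounded_by (fun x => cos (f x)) 1.
Proof. by move=> x; exact: cos_max. Qed.

Lemma bounded_sin (T : Type) (f : T -> R) : bounded_by (fun x => sin (f x)) 1.
Proof. by move=> x; exact: sin_max. Qed.

Lemma integrable_cos_phase n th :
  P.-integrable setT (EFin \o (fun w => cos (phase th (walk X n w)))).
Proof. by apply: (integrable_walk Xiid n (f := fun z => cos (phase th z))); exact: bounded_cos. Qed.

Lemma integrable_sin_phase n th :
  P.-integrable setT (EFin \o (fun w => sin (phase th (walk X n w)))).
Proof. by apply: (integrable_walk Xiid n (f := fun z => sin (phase th z))); exact: bounded_sin. Qed.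

Lemma integrable_prod_walk m k (F G : int * int -> R) : bounded_by F 1 -> bounded_by G 1 ->
  P.-integrable setT (EFin \o (fun w => F (walk X m w) * G (incr X m k w))).
Proof.
move=> F1 G1.
apply: (integrable_indep (F := F) (G := G) (discrete_walk Xiid m)
  (discrete_incr Xiid m k) (indep_walk_incr Xiid m k)).
- exact: integrable_walk F1.
- exact: integrable_discrete_rv (discrete_incr Xiid m k) G1.
Qed.

Lemma ccosD m k th :
  ccos (m + k) th = ccos m th * ccos k th - csin m th * csin k th.
Proof.
have c1 := bounded_cos (phase th); have s1 := bounded_sin (phase th).
rewrite /ccos /csin -(Rintegral_walkD Xiid m k c1 c1) -(Rintegral_walkD Xiid m k s1 s1).
rewrite -RintegralB//; last 2 first.
- exact: (integrable_prod_walk m k c1 c1).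
- exact: (integrable_prod_walk m k s1 s1).
by apply: eq_Rintegral => w _; rewrite walkD phaseD cosD.
Qed.

Lemma csinD m k th :
  csin (m + k) th = csin m th * ccos k th + ccos m th * csin k th.
Proof.
have c1 := bounded_cos (phase th); have s1 := bounded_sin (phase th).
rewrite /ccos /csin -(Rintegral_walkD Xiid m k s1 c1) -(Rintegral_walkD Xiid m k c1 s1).
rewrite -RintegralD//; last 2 first.
- exact: (integrable_prod_walk m k s1 c1).
- exact: (integrable_prod_walk m k c1 s1).
by apply: eq_Rintegral => w _; rewrite walkD phaseD sinD.
Qed.

Lemma chf_ge0 n th : 0 <= chf n th. Proof. exact: sqrtr_ge0. Qed.

Lemma chf_sqr n th : chf n th ^+ 2 = ccos n th ^+ 2 + csin n th ^+ 2.
Proof. by rewrite sqr_sqrtr// addr_ge0// sqr_ge0. Qed.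

(** The two-square identity, that is, multiplicativity of the modulus of complex numbers with real
    part [ccos] and imaginary part [csin]. *)
Lemma chfD m k th : chf (m + k) th = chf m th * chf k th.
Proof.
rewrite -sqrtrM ?addr_ge0 ?sqr_ge0//; congr (Num.sqrt _).
by rewrite ccosD csinD; ring.
Qed.

Lemma walk0 w : walk X 0 w = 0. Proof. by rewrite /walk big_ord0. Qed.

Lemma chf0 th : chf 0 th = 1.
Proof.
rewrite /chf /ccos /csin; under eq_Rintegral do rewrite walk0.
under [X in _ + X ^+ 2]eq_Rintegral do rewrite walk0.
rewrite !Rintegral_probability_cst.
by rewrite cos2Dsin2 sqrtr1.
Qed.

Lemma chfX n th : chf n th = chf 1 th ^+ n.
Proof. by elim: n => [|n IH]; rewrite ?chf0 ?expr0// -addn1 chfD IH exprD expr1. Qed.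

Lemma ccos_le_chf n th : `|ccos n th| <= chf n th.
Proof. by rewrite -sqrtr_sqr ler_wsqrtr// lerDl sqr_ge0. Qed.

Lemma csin_le_chf n th : `|csin n th| <= chf n th.
Proof. by rewrite -sqrtr_sqr ler_wsqrtr// lerDr sqr_ge0. Qed.

Lemma Ecos_shift n th (c s : R) :
  \int[P]_w (c * cos (phase th (walk X n w)) + s * sin (phase th (walk X n w))) =
  c * ccos n th + s * csin n th.
Proof.
rewrite RintegralD//.
- by rewrite !RintegralZl//; [exact: integrable_sin_phase|exact: integrable_cos_phase].
- by have := integrableZl measurableT c (integrable_cos_phase n th).
- by have := integrableZl measurableT s (integrable_sin_phase n th).
Qed.

(** By Cauchy-Schwarz the variable [ccos * cos + csin * sin] never exceeds [chf], while its mean is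
    [chf ^+ 2]. *)
Lemma chf_le1 n th : chf n th <= 1.
Proof.
rewrite -(ler_pXn2r (ltn0Sn 1)) ?nnegrE ?chf_ge0// expr1n.
have [->|h0] := eqVneq (chf n th) 0; first by rewrite expr0n.
have hp : 0 < chf n th by rewrite lt_neqAle eq_sym h0 chf_ge0.
suff : chf n th ^+ 2 <= chf n th.
  rewrite expr2 -[X in _ <= X]mul1r ler_pM2r// => h1.
  by rewrite -expr2 exprn_ile1// chf_ge0.
rewrite {1}chf_sqr.
have -> : ccos n th ^+ 2 + csin n th ^+ 2 = ccos n th * ccos n th + csin n th * csin n th.
  by ring.
rewrite -Ecos_shift.
have -> : chf n th = \int[P]_w (chf n th).
  by rewrite Rintegral_probability_cst.
apply: le_Rintegral => //.
- apply: (integrable_walk Xiid n (f := fun z => ccos n th * cos (phase th z) + csin n th * sin (phase th z)) (M := `|ccos n th| + `|csin n th|)).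
  move=> z; apply: (le_trans (ler_normD _ _)); rewrite !normrM.
  by apply: lerD; rewrite ler_piMr// ?cos_max ?sin_max.
- exact: finite_measure_integrable_cst.
move=> w _; rewrite -(ger0_norm (chf_ge0 n th)); apply: ler_normlW.
rewrite -ler_sqr ?nnegrE// real_normK ?num_real// real_normK ?num_real// chf_sqr.
set u := phase th _; have := cos2Dsin2 u; set x := cos u; set y := sin u => xy.
rewrite -[leRHS]mulr1 -xy -subr_ge0.
rewrite (_ : _ - _ = (ccos n th * y - csin n th * x) ^+ 2) ?sqr_ge0//.
by ring.
Qed.

End Characteristic_function.

Section Trig.
Context {R : realType}.

Lemma cos_lipschitz (x y : R) : `|cos x - cos y| <= `|x - y|.
Proof.
wlog xy : x y / x <= y.
  move=> H; have [/H//|/ltW/H] := leP x y.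
  by rewrite distrC (distrC y).
rewrite distrC; have [z _ ->] : exists2 z, z \in `[x, y] & cos y - cos x = - sin z * (y - x).
  apply: (MVT_segment (f := cos) (df := fun z => - sin z)) => //.
  by apply: continuous_subspaceT => z; exact: continuous_cos.
by rewrite normrM normrN distrC ler_piMl// sin_max.
Qed.

Lemma sin_lipschitz (x y : R) : `|sin x - sin y| <= `|x - y|.
Proof.
wlog xy : x y / x <= y.
  move=> H; have [/H//|/ltW/H] := leP x y.
  by rewrite distrC (distrC y).
rewrite distrC; have [z _ ->] : exists2 z, z \in `[x, y] & sin y - sin x = cos z * (y - x).
  apply: (MVT_segment (f := sin) (df := fun z => cos z)) => //.
  by apply: continuous_subspaceT => z; exact: continuous_sin.
by rewrite normrM distrC ler_piMl// cos_max.
Qed.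

Lemma cos_eq1_pi (x : R) : `|x| <= pi -> cos x = 1 -> x = 0.
Proof.
move=> xpi; rewrite -(cos_norm x) -[in X in _ = X -> _](@cos0 R) => /cos_inj.
by rewrite !in_itv/= normr_ge0 xpi lexx pi_ge0 => /(_ isT isT)/normr0_eq0.
Qed.

End Trig.

(** * Continuity and strict contraction of the characteristic function *)

Section Aperiodicity.
Context {R : realType} {d : measure_display} {Omega : measurableType d}.
Variable P : probability Omega R.
Variable X : nat -> Omega -> int * int.
Hypothesis Xiid : iid_steps P X.

Lemma tail_vanishes (V : Omega -> int * int) (e : R) : discrete_rv V -> 0 < e ->
  exists k : nat, (P (V @^-1` [set z | (k < norm1 z)%N]) <= e%:E)%E.
Proof.
move=> mV e0; pose F k := V @^-1` [set z | (k < norm1 z)%N].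
have cF : P \o F @ \oo --> P (\bigcap_n F n).
  apply: nonincreasing_cvg_mu.
  - by apply: le_lt_trans (probability_le1 _ _) _; [exact: mV|rewrite ltry].
  - by move=> i; exact: mV.
  - by apply: bigcap_measurable => // i _; exact: mV.
  - by move=> m n mn; apply/subsetPset => w; apply: leq_trans.
have F0 : \bigcap_n F n = set0.
  by apply/seteqP; split => // w /(_ (norm1 (V w)) I); rewrite /F /= ltnn.
move: cF; rewrite F0 measure0 => /fine_cvgP[] _.
move=> /cvgrPdist_le/(_ e e0)[k _ /(_ k (leqnn k))] /=.
rewrite sub0r normrN ger0_norm ?fine_ge0// => ke; exists k.
by rewrite -(@fineK _ (P (F k))) ?lee_fin//; apply: fin_num_measure; exact: mV.
Qed.

Lemma phase_dist (t u : R * R) (e : R) z : `|t.1 - u.1| <= e -> `|t.2 - u.2| <= e ->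
  `|phase t z - phase u z| <= e * (norm1 z)%:R.
Proof.
move=> h1 h2; rewrite /phase (_ : _ - _ = (t.1 - u.1) * z.1%:~R + (t.2 - u.2) * z.2%:~R); last by ring.
rewrite (le_trans (ler_normD _ _))// !normrM /norm1 natrD mulrDr.
by rewrite !natr_absz -!intr_norm lerD// ler_wpM2r// ler0z.
Qed.

(** Off the event [k < norm1 (V w)] the two phases differ by at most [dl * k]; on it the integrand
    is at most [2 * M], and the event is improbable. *)
Lemma Rintegral_lipschitz (f : R -> R) (M : R) (V : Omega -> int * int) :
  discrete_rv V -> bounded_by f M -> (forall x y, `|f x - f y| <= `|x - y|) ->
  continuous (fun th => \int[P]_w f (phase th (V w))).
Proof.
move=> mV fM flip t; apply/cvgrPdist_le => e e0.
have M0 : 0 <= M by apply: le_trans (fM 0).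
(* The [+ 1] keeps the denominator positive when [M = 0]; the one in [dl] does the same for
   [k = 0]. *)
have e1 : 0 < e / (2 * (2 * M + 1)) by rewrite divr_gt0// mulr_gt0//; lra.
have [k kP] := tail_vanishes mV e1.
pose dl := e / (2 * (k%:R + 1)).
have dl0 : 0 < dl by rewrite divr_gt0// mulr_gt0// ltr_wpDl.
near=> u.
have u1 : `|t.1 - u.1| <= dl.
  near: u; have h : fst z @[z --> t] --> t.1 by exact: cvg_fst.
  by move/cvgrPdist_le : h => /(_ dl dl0).
have u2 : `|t.2 - u.2| <= dl.
  near: u; have h : snd z @[z --> t] --> t.2 by exact: cvg_snd.
  by move/cvgrPdist_le : h => /(_ dl dl0).
have iF th : P.-integrable setT (EFin \o (fun w => f (phase th (V w)))).
  by apply: (integrable_discrete_rv P (f := fun z => f (phase th z)) (M := M)).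
rewrite -RintegralB//.
pose A : set (int * int) := [set z | (k < norm1 z)%N].
have iA (c1 c2 : R) : P.-integrable setT (EFin \o (fun w => c1 + c2 * \1_A (V w))).
  apply: (integrable_discrete_rv P (f := fun z => c1 + c2 * \1_A z) (M := `|c1| + `|c2|)) => // z.
  rewrite (le_trans (ler_normD _ _))// lerD2l normrM ler_piMr//.
  by rewrite /indic; case: (_ \in _); rewrite ?normr1 ?normr0.
apply: (@le_trans _ _ (\int[P]_w (dl * k%:R + 2 * M * \1_A (V w)))).
  apply: le_trans; first apply: le_normr_Rintegral => //.
    by apply: (integrable_discrete_rv P (f := fun z => f (phase t z) - f (phase u z)) (M := M + M)) => // z; rewrite (le_trans (ler_normB _ _))// lerD.
  apply: le_Rintegral => //.
    apply: (integrable_discrete_rv P (f := fun z => `|f (phase t z) - f (phase u z)|) (M := M + M)) => // z.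
    by rewrite normr_id (le_trans (ler_normB _ _))// lerD.
  move=> w _; rewrite indicE; case: (pselect (A (V w))) => kw.
    rewrite mem_set//= mulr1 (le_trans (ler_normB _ _))//.
    rewrite (le_trans (lerD (fM _) (fM _)))//.
    have : 0 <= dl * k%:R by rewrite mulr_ge0// ltW.
    by lra.
  rewrite memNset//= mulr0 addr0 (le_trans (flip _ _))// (le_trans (phase_dist _ u1 u2))//.
  by rewrite ler_pM2l// ler_nat leqNgt; exact/negP.
have -> : \int[P]_w (dl * k%:R + 2 * M * \1_A (V w)) =
    dl * k%:R + 2 * M * fine (P (V @^-1` A)).
  rewrite RintegralD//; last 2 first.
  - exact: finite_measure_integrable_cst.
  - by have := iA 0 (2 * M); under eq_fun do rewrite add0r.
  rewrite Rintegral_probability_cst RintegralZl//.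
    by rewrite /Rintegral integral_preimage.
  by have := iA 0 1; under eq_fun do rewrite add0r mul1r.
have PA : fine (P (V @^-1` A)) <= e / (2 * (2 * M + 1)).
  by rewrite -lee_fin fineK//; apply: fin_num_measure; exact: mV.
have h1 : dl * k%:R <= e / 2.
  rewrite /dl (_ : e / (2 * (k%:R + 1)) * k%:R = e / 2 * (k%:R / (k%:R + 1))); last first.
    by field; rewrite gt_eqF// ltr_wpDl.
  rewrite ler_piMr//; first by lra.
  by rewrite ler_pdivrMr ?mul1r ?lerDl// ltr_wpDl.
have h2 : 2 * M * fine (P (V @^-1` A)) <= e / 2.
  apply: (@le_trans _ _ ((2 * M + 1) * (e / (2 * (2 * M + 1))))).
    apply: ler_pM => //; rewrite ?mulr_ge0// ?fine_ge0//.
    by lra.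
  have M1 : 2 * M + 1 != 0 by rewrite gt_eqF//; lra.
  suff -> : (2 * M + 1) * (e / (2 * (2 * M + 1))) = e / 2 by [].
  by field.
by lra.
Unshelve. all: by end_near. Qed.

End Aperiodicity.

Section Away_from_lattice.
Context {R : realType} {d : measure_display} {Omega : measurableType d}.
Variable P : probability Omega R.
Variable X : nat -> Omega -> int * int.
Hypothesis Xiid : iid_steps P X.
Hypothesis Xaper : aperiodic P X.

Local Notation chf := (chf P X).

(** Equality case of Cauchy-Schwarz: the squared distance [D] between the unit vector [(c, s)] and
    [exp (i phase)] has mean [2 - 2 = 0], so it vanishes at every atom of positive mass. *)
Lemma chf_eq1_atom th x : chf 1 th = 1 -> P (X 0%N @^-1` [set x]) != 0%E ->
  cos (phase th x) = ccos P X 1 th /\ sin (phase th x) = csin P X 1 th.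
Proof.
move=> h1; rewrite (walk_step_same_law Xiid) => Px.
set c := ccos P X 1 th; set s := csin P X 1 th.
have cs1 : c ^+ 2 + s ^+ 2 = 1 by rewrite -chf_sqr h1 expr1n.
pose D (z : int * int) := (c - cos (phase th z)) ^+ 2 + (s - sin (phase th z)) ^+ 2.
have DE z : D z = 2 - 2 * (c * cos (phase th z) + s * sin (phase th z)).
  have e2 := cos2Dsin2 (phase th z).
  rewrite (_ : D z = (c ^+ 2 + s ^+ 2) + (cos (phase th z) ^+ 2 + sin (phase th z) ^+ 2) -
    2 * (c * cos (phase th z) + s * sin (phase th z))); last by rewrite /D; ring.
  by rewrite cs1 e2.
have D0 z : 0 <= D z by rewrite /D addr_ge0// sqr_ge0.
have iD : P.-integrable setT (EFin \o (fun w => D (walk X 1 w))).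
  apply: (integrable_walk Xiid 1 (f := D) (M := 2 + 2 * (`|c| + `|s|))) => z.
  rewrite DE (le_trans (ler_normB _ _))// normrM ger0_norm// lerD2l ler_pM2l//.
  by rewrite (le_trans (ler_normD _ _))// !normrM lerD// ler_piMr// ?cos_max ?sin_max.
have ED : \int[P]_w D (walk X 1 w) = 0.
  under eq_Rintegral do rewrite DE.
  have icst : P.-integrable [set: Omega] (EFin \o cst (2 : R)).
    exact: finite_measure_integrable_cst.
  have ics : P.-integrable [set: Omega] (EFin \o (fun w => c * cos (phase th (walk X 1 w)) + s * sin (phase th (walk X 1 w)))).
    apply: (integrable_walk Xiid 1 (f := fun z => c * cos (phase th z) + s * sin (phase th z)) (M := `|c| + `|s|)) => z.
    by rewrite (le_trans (ler_normD _ _))// !normrM lerD// ler_piMr// ?cos_max ?sin_max.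
  rewrite RintegralB//; last by have := integrableZl measurableT 2 ics.
  rewrite Rintegral_probability_cst RintegralZl// Ecos_shift//.
  by rewrite -/c -/s -!expr2 cs1; ring.
have Dx : D x = 0.
  apply/eqP; rewrite -[_ == _]negbK; apply/negP => Dx0.
  have Dxp : 0 < D x by rewrite lt_neqAle eq_sym Dx0 D0.
  have : D x * fine (P (walk X 1 @^-1` [set x])) <= 0.
    rewrite -ED; have -> : fine (P (walk X 1 @^-1` [set x])) = \int[P]_w \1_[set x] (walk X 1 w).
      by rewrite /Rintegral integral_preimage//; exact: discrete_walk Xiid 1.
    have ix (a : R) : P.-integrable setT (EFin \o (fun w => a * \1_[set x] (walk X 1 w))).
      apply: (integrable_walk Xiid 1 (f := fun z => a * \1_[set x] z) (M := `|a|)) => z.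
      by rewrite normrM ler_piMr// indicE; case: (_ \in _); rewrite ?normr1 ?normr0.
    rewrite -RintegralZl//; last by have := ix 1; under eq_fun do rewrite mul1r.
    apply: le_Rintegral => // w _; rewrite indicE.
    case: (pselect ([set x] (walk X 1 w))) => [wx|wx].
      by rewrite mem_set//= mulr1 wx.
    by rewrite memNset//= mulr0.
  rewrite leNgt mulr_gt0// fine_gt0// lt_neqAle eq_sym Px measure_ge0/=.
  by apply: le_lt_trans (probability_le1 _ _) _; [exact: (discrete_walk Xiid 1)|rewrite ltry].
move/eqP: Dx; rewrite /D paddr_eq0 ?sqr_ge0// !sqrf_eq0 !subr_eq0.
by move=> /andP[/eqP -> /eqP ->].
Qed.

(** The points [z] with [cos (phase th z) = 1] form a subgroup. Were the modulus 1, all steps would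
    lie in one translate of it and aperiodicity would make it the whole lattice; the two basis
    vectors then force [th = 0], both coordinates being at most [pi] in absolute value. *)
Lemma chf_lt1 th : `|th.1| <= pi -> `|th.2| <= pi -> th != (0, 0) -> chf 1 th < 1.
Proof.
move=> t1 t2; rewrite lt_neqAle chf_le1// andbT; apply: contra => /eqP h1; apply/eqP.
pose H : {pred int * int} := [pred z | cos (phase th z) == 1].
have Hs z : z \in H -> cos (phase th z) = 1 /\ sin (phase th z) = 0.
  rewrite inE => /eqP cz; split => //.
  by apply: cos1sin0; rewrite cz normr1.
have zH : zmod_closed H.
  split; first by rewrite inE /phase /= !mulr0 addr0 cos0.
  move=> u v /Hs[cu su] /Hs[cv sv].
  by rewrite inE phaseB cosB cu cv su sv mul1r mul0r addr0.
have HT : forall z, z \in H.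
  have [[v Pv]|noatom] := pselect (exists v, P (X 0%N @^-1` [set v]) != 0%E).
    apply: (Xaper (v := v) zH) => x Px.
    have [cx sx] := chf_eq1_atom h1 Px; have [cv sv] := chf_eq1_atom h1 Pv.
    by rewrite inE phaseB cosB cx cv sx sv -!expr2 -chf_sqr h1 expr1n.
  apply: (Xaper (v := 0) zH) => x Px; exfalso; apply: noatom; by exists x.
have := HT (1, 0); have := HT (0, 1); rewrite !inE /phase /=.
rewrite !mulr0 !mulr1 add0r addr0 => /eqP/(cos_eq1_pi t2) h2 /eqP/(cos_eq1_pi t1) h3.
by rewrite (surjective_pairing th) h2 h3.
Qed.

Lemma continuous_chf1 : continuous (chf 1).
Proof.
move=> th; apply: (@continuous_comp _ _ _ (fun t => ccos P X 1 t ^+ 2 + csin P X 1 t ^+ 2) Num.sqrt).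
  apply: continuousD.
    apply: (@continuous_comp _ _ _ (ccos P X 1) (fun x : R => x ^+ 2)).
      apply: (Rintegral_lipschitz (M := 1)).
      - exact: discrete_walk Xiid 1.
      - exact: cos_max.
      - exact: cos_lipschitz.
    exact: exprn_continuous.
  apply: (@continuous_comp _ _ _ (csin P X 1) (fun x : R => x ^+ 2)).
    apply: (Rintegral_lipschitz (M := 1)).
    - exact: discrete_walk Xiid 1.
    - exact: sin_max.
    - exact: sin_lipschitz.
  exact: exprn_continuous.
exact: sqrt_continuous.
Qed.

Lemma chf_rect_bound (a b a' b' : R) :
  (forall t, a <= t.1 <= b -> a' <= t.2 <= b' -> chf 1 t < 1) ->
  exists2 rho : R, 0 <= rho < 1 &
    forall t, a <= t.1 <= b -> a' <= t.2 <= b' -> chf 1 t <= rho.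
Proof.
move=> H; have [[t0 [t01 t02]]|none] := pselect (exists t : R * R, a <= t.1 <= b /\ a' <= t.2 <= b'); last first.
  exists 0; first by rewrite lexx ltr01.
  by move=> t t1 t2; exfalso; apply: none; exists t.
have [|||c cA cmax] := @compact_EVT_max _ R (chf 1) (`[a, b] `*` `[a', b']).
- by exists t0; split => /=; rewrite in_itv.
- by apply: compact_setX; exact: segment_compact.
- by apply: continuous_subspaceT; exact: continuous_chf1.
exists (chf 1 c).
  rewrite chf_ge0/=; move: cA; rewrite inE => -[]; rewrite /= !in_itv /=; exact: H.
by move=> t t1 t2; apply: cmax; rewrite inE; split; rewrite /= in_itv.
Qed.

(** Outside the open box of half-sides [r1] and [r2], the square is a union of four closed
    rectangles, on each of which continuity and compactness turn the strict bound into a uniform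
    one. *)
Lemma chf_away_from_0 (r1 r2 : R) : 0 < r1 -> 0 < r2 ->
  exists2 rho : R, 0 <= rho < 1 & forall t : R * R, `|t.1| <= pi -> `|t.2| <= pi ->
    (r1 <= `|t.1|) || (r2 <= `|t.2|) -> chf 1 t <= rho.
Proof.
move=> r10 r20.
have inpi (x : R) : (- pi <= x <= pi) = (`|x| <= pi) by rewrite ler_norml.
have [p1 /andP[p10 p11] H1] : exists2 rho : R, 0 <= rho < 1 &
    forall t, r1 <= t.1 <= pi -> - pi <= t.2 <= pi -> chf 1 t <= rho.
  apply: chf_rect_bound => t /andP[t1 t1'] t2; apply: chf_lt1; rewrite -?inpi//.
    by rewrite t1' (le_trans _ t1)// (le_trans _ (ltW r10))// oppr_le0 pi_ge0.
  by apply/eqP => t0; move: t1; rewrite t0/= leNgt r10.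
have [p2 /andP[p20 p21] H2] : exists2 rho : R, 0 <= rho < 1 &
    forall t, - pi <= t.1 <= - r1 -> - pi <= t.2 <= pi -> chf 1 t <= rho.
  apply: chf_rect_bound => t /andP[t1 t1'] t2; apply: chf_lt1; rewrite -?inpi//.
    by rewrite t1 (le_trans t1')// (@le_trans _ _ 0) ?pi_ge0// oppr_le0 ltW.
  by apply/eqP => t0; move: t1'; rewrite t0/= leNgt oppr_lt0 r10.
have [p3 /andP[p30 p31] H3] : exists2 rho : R, 0 <= rho < 1 &
    forall t, - pi <= t.1 <= pi -> r2 <= t.2 <= pi -> chf 1 t <= rho.
  apply: chf_rect_bound => t t2 /andP[t1 t1']; apply: chf_lt1; rewrite -?inpi//.
    by rewrite t1' (le_trans _ t1)// (le_trans _ (ltW r20))// oppr_le0 pi_ge0.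
  by apply/eqP => t0; move: t1; rewrite t0/= leNgt r20.
have [p4 /andP[p40 p41] H4] : exists2 rho : R, 0 <= rho < 1 &
    forall t, - pi <= t.1 <= pi -> - pi <= t.2 <= - r2 -> chf 1 t <= rho.
  apply: chf_rect_bound => t t2 /andP[t1 t1']; apply: chf_lt1; rewrite -?inpi//.
    by rewrite t1 (le_trans t1')// (@le_trans _ _ 0) ?pi_ge0// oppr_le0 ltW.
  by apply/eqP => t0; move: t1'; rewrite t0/= leNgt oppr_lt0 r20.
exists (Num.max (Num.max p1 p2) (Num.max p3 p4)).
  by rewrite !le_max p10 /= !gt_max p11 p21 p31 p41.
move=> t t1 t2; rewrite !le_max => /orP[|] tr.
  move: (t1) tr; rewrite -inpi => /andP[l u].
  rewrite ler_normr => /orP[tr|tr]; [rewrite H1//|rewrite H2 ?orbT//]; rewrite ?inpi ?tr ?u ?l//.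
  by rewrite lerNr tr.
move: (t2) tr; rewrite -inpi => /andP[l u].
rewrite ler_normr => /orP[tr|tr]; [rewrite H3 ?orbT//|rewrite H4 ?orbT//]; rewrite ?inpi ?tr ?u ?l//.
by rewrite lerNr tr.
Qed.

End Away_from_lattice.

(** * Weak convergence on boxes *)

Section Box_test_functions.
Context {R : realType}.

(** A trapezoid, 1 up to [r] and 0 from [r'] on. Weak convergence is tested on continuous functions
    only, so the indicators of boxes are enclosed between products of trapezoids. *)
Definition plateau (r r' u : R) : R := Num.min 1 (Num.max 0 ((r' - `|u|) / (r' - r))).

Lemma plateau_ge0 r r' u : 0 <= plateau r r' u.
Proof. by rewrite /plateau le_min ler01 le_max lexx. Qed.

Lemma plateau_le1 r r' u : plateau r r' u <= 1.
Proof. by rewrite /plateau ge_min lexx. Qed.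

Lemma plateau1 r r' u : r < r' -> `|u| <= r -> plateau r r' u = 1.
Proof.
move=> rr' ur; have h : 1 <= (r' - `|u|) / (r' - r).
  by rewrite ler_pdivlMr ?subr_gt0// mul1r lerB.
apply/eqP; rewrite eq_le plateau_le1/= /plateau le_min lexx/= le_max h orbT//.
Qed.

Lemma plateau0 r r' u : r < r' -> r' <= `|u| -> plateau r r' u = 0.
Proof.
move=> rr' ur; have h : (r' - `|u|) / (r' - r) <= 0.
  by rewrite pmulr_lle0 ?invr_gt0 ?subr_gt0// subr_le0.
apply/eqP; rewrite eq_le plateau_ge0 andbT /plateau ge_min; apply/orP; right.
by rewrite ge_max lexx.
Qed.

Lemma continuous_plateau r r' : continuous (plateau r r').
Proof.
move=> u; apply: (@continuous_min _ _ (fun=> 1) (fun u => Num.max 0 ((r' - `|u|) / (r' - r)))).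
  exact: cst_continuous.
apply: (@continuous_max _ _ (fun=> 0) (fun u => (r' - `|u|) / (r' - r))).
  exact: cst_continuous.
apply: continuousM; last exact: cst_continuous.
apply: continuousB; first exact: cst_continuous.
exact: norm_continuous.
Qed.

Definition box_plateau (c : R * R) r r' (z : R * R) : R :=
  plateau r r' (z.1 - c.1) * plateau r r' (z.2 - c.2).

Definition box (c : R * R) (r : R) : set (R * R) :=
  [set z | `|z.1 - c.1| <= r /\ `|z.2 - c.2| <= r].

Lemma box_plateau_ge0 c r r' z : 0 <= box_plateau c r r' z.
Proof. by rewrite mulr_ge0// plateau_ge0. Qed.

Lemma box_plateau_le1 c r r' z : box_plateau c r r' z <= 1.
Proof. by rewrite mulr_ile1 ?plateau_ge0 ?plateau_le1. Qed.

Lemma indic_box_le c r r' z : r < r' -> \1_(box c r) z <= box_plateau c r r' z.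
Proof.
move=> rr'; rewrite indicE; case: (pselect (box c r z)) => [[h1 h2]|h].
  by rewrite mem_set//= /box_plateau !plateau1 ?mulr1.
by rewrite memNset//= box_plateau_ge0.
Qed.

Lemma box_plateau_le c r r' z : r < r' -> box_plateau c r r' z <= \1_(box c r') z.
Proof.
move=> rr'; rewrite indicE; case: (pselect (box c r' z)) => [h|h].
  by rewrite mem_set//= box_plateau_le1.
rewrite memNset//=; move/not_andP : h => [|] /negP; rewrite -ltNge => /ltW h;
  by rewrite /box_plateau (plateau0 rr' h) ?mul0r ?mulr0.
Qed.

Lemma continuous_box_plateau c r r' : continuous (box_plateau c r r').
Proof.
move=> z; rewrite /box_plateau; apply: cvgM.
  apply: (@continuous_comp _ _ _ (fun z : R * R => z.1 - c.1) (plateau r r')).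
    by apply: cvgB; [exact: cvg_fst|exact: cvg_cst].
  exact: continuous_plateau.
apply: (@continuous_comp _ _ _ (fun z : R * R => z.2 - c.2) (plateau r r')).
  by apply: cvgB; [exact: cvg_snd|exact: cvg_cst].
exact: continuous_plateau.
Qed.

Lemma measurable_box_plateau c r r' : measurable_fun setT (box_plateau c r r').
Proof.
have mp : measurable_fun setT (plateau r r').
  by apply: continuous_measurable_fun; exact: continuous_plateau.
apply: measurable_funM.
  by apply: (measurableT_comp mp); apply: measurable_funB.
by apply: (measurableT_comp mp); apply: measurable_funB.
Qed.

Lemma boxE c r : box c r =
  [set` `[c.1 - r, c.1 + r]] `*` [set` `[c.2 - r, c.2 + r]].
Proof.
apply/seteqP; split => [z [h1 h2]|z []]; rewrite /box /= !in_itv/= => *.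
  by rewrite -!ler_distlC; split; rewrite distrC.
by split; rewrite distrC ler_distlC.
Qed.

Lemma measurable_box c r : measurable (box c r).
Proof. by rewrite boxE; apply: measurableX; exact: measurable_itv. Qed.

Lemma lebesgue_box c (r : R) : 0 <= r ->
  ((lebesgue_measure \x lebesgue_measure)%E (box c r) = (4 * r ^+ 2)%:E)%E.
Proof.
have L (x : R) : 0 <= r -> lebesgue_measure (`[x - r, x + r]%classic : set R) = (2 * r)%:E.
  move=> r0; rewrite lebesgue_measure_itv/= lte_fin.
  have [->|rn0] := eqVneq r 0; first by rewrite subr0 addr0 ltxx mulr0.
  have rp : 0 < r by rewrite lt_neqAle eq_sym rn0.
  by rewrite ifT; [rewrite -EFinB; congr (_%:E); ring|lra].
move=> r0; rewrite boxE product_measure1E//.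
transitivity ((2 * r)%:E * (2 * r)%:E)%E; first by congr (_ * _)%E; exact: L.
by rewrite -EFinM; congr (_%:E); ring.
Qed.

End Box_test_functions.

Section Walk_probability.
Context {R : realType} {d : measure_display} {Omega : measurableType d}.
Variable P : probability Omega R.
Variable X : nat -> Omega -> int * int.
Hypothesis Xiid : iid_steps P X.

Definition prob_walk n (A : set (int * int)) : R := fine (P (walk X n @^-1` A)).

Lemma prob_walkE n A : P (walk X n @^-1` A) = (prob_walk n A)%:E.
Proof. by rewrite /prob_walk fineK//; apply: fin_num_measure; exact: (discrete_walk Xiid). Qed.

Lemma prob_walk_indic n A : prob_walk n A = \int[P]_w \1_A (walk X n w).
Proof. by rewrite /Rintegral integral_preimage//; exact: (discrete_walk Xiid). Qed.

Lemma bounded_indic (A : set (int * int)) : bounded_by (\1_A : _ -> R) 1.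
Proof. by move=> z; rewrite indicE; case: (_ \in _); rewrite ?normr1 ?normr0. Qed.

Lemma prob_walk_le_Rintegral n A (f : int * int -> R) (M : R) : bounded_by f M ->
  (forall z, \1_A z <= f z) -> prob_walk n A <= \int[P]_w f (walk X n w).
Proof.
move=> fM Af; rewrite prob_walk_indic; apply: le_Rintegral => //.
- exact: (integrable_walk Xiid n (bounded_indic A)).
- exact: integrable_walk fM.
Qed.

Lemma Rintegral_le_prob_walk n A (f : int * int -> R) (M : R) : bounded_by f M ->
  (forall z, f z <= \1_A z) -> \int[P]_w f (walk X n w) <= prob_walk n A.
Proof.
move=> fM Af; rewrite prob_walk_indic; apply: le_Rintegral => //.
- exact: integrable_walk fM.
- exact: (integrable_walk Xiid n (bounded_indic A)).
Qed.

End Walk_probability.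

Section Weak_limit.
Context {R : realType} {d : measure_display} {Omega : measurableType d}.
Variable P : probability Omega R.
Variable X : nat -> Omega -> int * int.
Hypothesis Xiid : iid_steps P X.
Variables (a1 a2 : R -> R) (g : R * R -> R).
Hypothesis Xlaw : cvg_in_law_to_density P (rescaled_walk X 0 0 a1 a2) g.
Hypothesis g_ge0 : forall z, 0 <= g z.
Hypothesis g_meas : measurable_fun setT g.

Definition scaled n (z : int * int) : R * R :=
  (z.1%:~R / a1 n%:R, z.2%:~R / a2 n%:R).

Lemma measurable_indic_box c (r : R) : measurable_fun setT (\1_(box c r) : R * R -> R).
Proof. by apply: measurable_indic; exact: measurable_box. Qed.

Lemma rescaled_walkE n w : rescaled_walk X 0 0 a1 a2 n w = scaled n (walk X n w).
Proof. by rewrite /rescaled_walk /coord1 /coord2 !mulr0 !subr0. Qed.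

(** The assumed convergence takes place in the extended reals; its limit is at most 1, as a limit of
    means of functions bounded by 1, and can therefore be read in [R]. *)
Lemma weak_limit_plateau c r r' : exists2 L : R,
    (\int[lebesgue_measure \x lebesgue_measure]_z (box_plateau c r r' z * g z)%:E)%E = L%:E &
    \int[P]_w box_plateau c r r' (scaled n (walk X n w)) @[n --> \oo] --> L.
Proof.
pose f := box_plateau c r r'.
have f01 z : `|f z| <= 1.
  by rewrite ger0_norm ?box_plateau_ge0// box_plateau_le1.
have cL := Xlaw (@continuous_box_plateau _ c r r') (ex_intro _ 1 f01).
set L := (\int[_]_z _)%E in cL *.
have EF n : (\int[P]_w (f (rescaled_walk X 0 0 a1 a2 n w))%:E)%E =
    (\int[P]_w f (scaled n (walk X n w)))%:E.
  rewrite /Rintegral fineK.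
    by apply: eq_integral => w _; rewrite rescaled_walkE.
  apply: integrable_fin_num => //.
  exact: (integrable_walk Xiid n (f := fun z => f (scaled n z)) (M := 1)).
have L0 : (0 <= L)%E.
  by apply: integral_ge0 => z _; rewrite lee_fin mulr_ge0// box_plateau_ge0.
have L1 : (L <= 1)%E.
  apply: (cvge_to_le cL); apply: nearW => n; rewrite EF lee_fin.
  rewrite -(Rintegral_probability_cst P 1); apply: le_Rintegral => //.
  - exact: (integrable_walk Xiid n (f := fun z => f (scaled n z)) (M := 1)).
  - exact: finite_measure_integrable_cst.
  - by move=> w _; exact: box_plateau_le1.
have Lf : L \is a fin_num by rewrite ge0_fin_numE// (le_lt_trans L1)// ltry.
exists (fine L); first by rewrite fineK.
move: cL; rewrite -(fineK Lf) => /fine_cvgP[_].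
by under eq_fun do rewrite /= EF /=.
Qed.

(** The main term is [M] times the area of the box of half-side [r']; enlarging [r] to [r'] is the
    price of a continuous test function. *)
Lemma weak_limit_upper c r r' (M e : R) : 0 <= r < r' -> 0 < e ->
  (forall z, box c r' z -> g z <= M) ->
  exists n0, forall n, (n0 <= n)%N ->
    prob_walk P X n [set z | box c r (scaled n z)] <= 4 * M * r' ^+ 2 + e.
Proof.
move=> /andP[r0 rr'] e0 gM; have [L LE cL] := weak_limit_plateau c r r'.
have r'0 : 0 <= r' by apply: le_trans r0 (ltW rr').
have M0 : 0 <= M.
  by apply: le_trans (gM c _); [exact: g_ge0|rewrite /box /= !subrr normr0].
have LU : L <= 4 * M * r' ^+ 2.
  rewrite -lee_fin -LE.
  apply: (@le_trans _ _ (\int[lebesgue_measure \x lebesgue_measure]_z (M * \1_(box c r') z)%:E)%E).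
    apply: ge0_le_integral => //.
    - by move=> z _; rewrite lee_fin mulr_ge0// box_plateau_ge0.
    - apply/measurable_EFinP/measurable_funM => //; exact: measurable_box_plateau.
    - apply/measurable_EFinP/measurable_funM => //; exact: measurable_indic_box.
    move=> z _; rewrite lee_fin.
    rewrite indicE; case: (pselect (box c r' z)) => h.
      rewrite mem_set//= mulr1; apply: le_trans (gM z h).
      by rewrite ler_piMl// box_plateau_le1.
    rewrite memNset//= mulr0; have := box_plateau_le c z rr'.
    rewrite indicE memNset//= => fz.
    by rewrite (_ : box_plateau c r r' z = 0) ?mul0r//; apply/le_anti; rewrite fz box_plateau_ge0.
  under eq_integral do rewrite EFinM.
  rewrite ge0_integralZl//; last first.
    by apply/measurable_EFinP; exact: measurable_indic_box.
  rewrite integral_indic//; last exact: measurable_box.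
  rewrite [X in (M%:E * X)%E](_ : _ = (4 * r' ^+ 2)%:E); last first.
    by rewrite setIT; exact: lebesgue_box.
  by rewrite -EFinM lee_fin; lra.
have Le : L < 4 * M * r' ^+ 2 + e by lra.
have [n0 _ n0P] := cvgr_lt L cL _ Le; exists n0 => n n0n.
apply: le_trans (ltW (n0P n n0n)).
apply: (prob_walk_le_Rintegral Xiid n (f := fun z => box_plateau c r r' (scaled n z)) (M := 1)).
  by move=> z; rewrite ger0_norm ?box_plateau_ge0// box_plateau_le1.
by move=> z; exact: (indic_box_le c (scaled n z) rr').
Qed.

Lemma weak_limit_lower c r r' (m e : R) : 0 <= r < r' -> 0 < e -> 0 <= m ->
  (forall z, box c r z -> m <= g z) ->
  exists n0, forall n, (n0 <= n)%N ->
    4 * m * r ^+ 2 - e <= prob_walk P X n [set z | box c r' (scaled n z)].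
Proof.
move=> /andP[r0 rr'] e0 m0 gm; have [L LE cL] := weak_limit_plateau c r r'.
have LU : 4 * m * r ^+ 2 <= L.
  rewrite -lee_fin -LE.
  apply: (@le_trans _ _ (\int[lebesgue_measure \x lebesgue_measure]_z (m * \1_(box c r) z)%:E)%E).
    under eq_integral do rewrite EFinM.
  rewrite ge0_integralZl//; last first.
      by apply/measurable_EFinP; exact: measurable_indic_box.
    rewrite integral_indic//; last exact: measurable_box.
    rewrite [X in (m%:E * X)%E](_ : _ = (4 * r ^+ 2)%:E); last first.
      by rewrite setIT; exact: lebesgue_box.
    by rewrite -EFinM lee_fin; lra.
  apply: ge0_le_integral => //.
  - by move=> z _; rewrite lee_fin mulr_ge0.
  - apply/measurable_EFinP/measurable_funM => //; exact: measurable_indic_box.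
  - apply/measurable_EFinP/measurable_funM => //; exact: measurable_box_plateau.
  move=> z _; rewrite lee_fin mulrC.
  have := indic_box_le c z rr'.
  rewrite indicE; case: (pselect (box c r z)) => h.
    by rewrite mem_set//= => fz; rewrite ler_pM// gm.
  by rewrite memNset//= mul0r => _; rewrite mulr_ge0// box_plateau_ge0.
have Le : 4 * m * r ^+ 2 - e < L by lra.
have [n0 _ n0P] := cvgr_gt L cL _ Le; exists n0 => n n0n.
apply: (le_trans (ltW (n0P n n0n))).
apply: (Rintegral_le_prob_walk Xiid n (f := fun z => box_plateau c r r' (scaled n z)) (M := 1)).
  by move=> z; rewrite ger0_norm ?box_plateau_ge0// box_plateau_le1.
by move=> z; exact: (box_plateau_le c (scaled n z) rr').
Qed.

End Weak_limit.

(** * Contraction of the characteristic function on scaled annuli *)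

Section Annulus.
Context {R : realType} {d : measure_display} {Omega : measurableType d}.
Variable P : probability Omega R.
Variable X : nat -> Omega -> int * int.
Hypothesis Xiid : iid_steps P X.
Variables (a1 a2 : R -> R) (g : R * R -> R).
Hypothesis Xlaw : cvg_in_law_to_density P (rescaled_walk X 0 0 a1 a2) g.
Hypothesis g_ge0 : forall z, 0 <= g z.
Hypothesis g_meas : measurable_fun setT g.
Hypothesis a1_gt0 : forall t, 0 < t -> 0 < a1 t.
Hypothesis a2_gt0 : forall t, 0 < t -> 0 < a2 t.
Variable m : R.
Hypothesis m_gt0 : 0 < m.
Hypothesis g_gtm : forall z, box (0, 0) 2 z -> m <= g z.

Local Notation chf := (chf P X).

(* With [(c, s)] the direction of the complex number [E exp (i phase)], of
   modulus [chf n th], this is [chf n th = E (1 - |(c, s) - exp (i phase)|^2 / 2)]. *)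
Lemma chf_defect n th (A B : set (int * int)) (eta kappa : R) :
  0 < kappa ->
  eta <= prob_walk P X n A -> eta <= prob_walk P X n B ->
  (forall y z, A y -> B z -> 4 * kappa <= 1 - cos (phase th z - phase th y)) ->
  chf n th <= 1 - kappa * eta \/ chf n th = 0.
Proof.
move=> k0 eA eB H.
have [->|r0] := eqVneq (chf n th) 0; [by right|left].
have rp : 0 < chf n th by rewrite lt_neqAle eq_sym r0 chf_ge0.
set r := chf n th in r0 rp *.
set c := ccos P X n th / r; set s := csin P X n th / r.
have cs1 : c ^+ 2 + s ^+ 2 = 1.
  rewrite /c /s !expr_div_n -mulrDl -chf_sqr divff// expf_neq0//.
pose h (z : int * int) := 1 - (c * cos (phase th z) + s * sin (phase th z)).
have hE z : h z = ((c - cos (phase th z)) ^+ 2 + (s - sin (phase th z)) ^+ 2) / 2.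
  have e2 := cos2Dsin2 (phase th z).
  rewrite (_ : _ / 2 = ((c ^+ 2 + s ^+ 2) + (cos (phase th z) ^+ 2 + sin (phase th z) ^+ 2)) / 2 -
    (c * cos (phase th z) + s * sin (phase th z))); last by field.
  by rewrite cs1 e2 /h; field.
have h0 z : 0 <= h z by rewrite hE divr_ge0// addr_ge0// sqr_ge0.
have hbd : bounded_by h (1 + (`|c| + `|s|)).
  move=> z; rewrite (le_trans (ler_normB _ _))// normr1 lerD2l.
  by rewrite (le_trans (ler_normD _ _))// !normrM lerD// ler_piMr// ?cos_max ?sin_max.
have Eh : \int[P]_w h (walk X n w) = 1 - r.
  have ics : P.-integrable [set: Omega] (EFin \o (fun w => c * cos (phase th (walk X n w)) + s * sin (phase th (walk X n w)))).
    apply: (integrable_walk Xiid n (f := fun z => c * cos (phase th z) + s * sin (phase th z)) (M := `|c| + `|s|)) => z.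
    by rewrite (le_trans (ler_normD _ _))// !normrM lerD// ler_piMr// ?cos_max ?sin_max.
  rewrite RintegralB//; last exact: finite_measure_integrable_cst.
  rewrite Rintegral_probability_cst Ecos_shift//; congr (_ - _).
  rewrite /c /s mulrAC (mulrAC _ _ (csin _ _ _ _)) -mulrDl -!expr2 -chf_sqr.
  by rewrite expr2 mulfK.
(* Parallelogram law: [h y + h z] is at least a quarter of the squared chord between the two unit
   vectors, that is [(1 - cos (phase th z - phase th y)) / 2]. *)
have pair y z : A y -> B z -> 2 * kappa <= h y + h z.
  move=> Ay Bz; have := H y z Ay Bz; rewrite cosB !hE.
  have := cos2Dsin2 (phase th z); have := cos2Dsin2 (phase th y).
  move: (cos (phase th z)) (sin (phase th z)) (cos (phase th y)) (sin (phase th y)).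
  move: (c) (s) => C S a b a' b' e1 e2 hk.
  have := sqr_ge0 (2 * C - a - a'); have := sqr_ge0 (2 * S - b - b').
  by nra.
have Ehge (D : set (int * int)) : (forall z, D z -> kappa <= h z) ->
    kappa * prob_walk P X n D <= 1 - r.
  move=> Dk; rewrite -Eh -ler_pdivlMl//.
  rewrite -RintegralZl//; last exact: integrable_walk hbd.
  apply: (prob_walk_le_Rintegral Xiid n (f := fun z => kappa^-1 * h z) (M := kappa^-1 * (1 + (`|c| + `|s|)))).
    by move=> z; rewrite normrM ger0_norm ?invr_ge0 ?(ltW k0)// ler_pM2l ?invr_gt0.
  move=> z; rewrite indicE; case: (pselect (D z)) => Dz.
    by rewrite mem_set//= ler_pdivlMl// mulr1 Dk.
  by rewrite memNset//= mulr_ge0// invr_ge0 ltW.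
(* One of the two sets consists entirely of points with [kappa <= h]: a point of [A] with a smaller
   value pushes the whole of [B] above [kappa]. *)
have [allA|/existsNP[y0 /not_implyP[Ay0 hy0]]] := pselect (forall y, A y -> kappa <= h y).
  have := Ehge A allA; have : kappa * eta <= kappa * prob_walk P X n A by rewrite ler_pM2l.
  by lra.
have allB z : B z -> kappa <= h z.
  by move=> Bz; have := pair _ _ Ay0 Bz; move/negP : hy0; rewrite -ltNge; lra.
have := Ehge B allB; have : kappa * eta <= kappa * prob_walk P X n B by rewrite ler_pM2l.
by lra.
Qed.

(** In scaled coordinates the phase is linear with slopes [t1] and [t2]. From a small box around
    [(0, 0)] to one around [(1, 0)] or [(0, 1)] it changes by about a slope of absolute value at
    least 1/2, and the weak limit gives these boxes a mass at least [eta], so [chf_defect]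
    applies. *)
Lemma chf_annulus : exists2 rho : R, 0 <= rho < 1 &
  exists2 n0 : nat, (0 < n0)%N & forall n th, (n0 <= n)%N ->
    let t1 := a1 n%:R * th.1 in let t2 := a2 n%:R * th.2 in
    `|t1| <= 1 -> `|t2| <= 1 -> (2^-1 <= `|t1|) || (2^-1 <= `|t2|) ->
    chf n th <= rho.
Proof.
(* Boxes of half-side [r'] blur the phase difference by at most 1/8 per coordinate, so it stays in
   [[4^-1, 5 / 4]], below [pi], and [4 * kappa] is the least value of [1 - cos] there. [eta] is half
   of the limiting lower bound [4 * m * r ^+ 2]. *)
pose r : R := 32^-1; pose r' : R := 16^-1.
pose eta := 2 * m * r ^+ 2.
pose kappa : R := (1 - cos 4^-1) / 4.
have k0 : 0 < kappa.
  rewrite divr_gt0// subr_gt0 -[ltRHS]cos0 ltr_cos ?in_itv/= ?lexx ?pi_ge0//.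
  by have := @pi_ge2 R; lra.
have rr' : 0 <= r < r' by rewrite /r /r'; lra.
have r_gt0 : 0 < r by rewrite /r; lra.
have e0 : 0 < eta by rewrite !mulr_gt0.
have low c : `|c.1| <= 1 -> `|c.2| <= 1 -> exists n0, forall n, (n0 <= n)%N ->
    eta <= prob_walk P X n [set z | box c r' (scaled a1 a2 n z)].
  move=> c1 c2.
  have [|n0 n0P] := @weak_limit_lower _ _ _ P X Xiid a1 a2 g Xlaw g_ge0 g_meas
    c r r' m eta rr' e0 (ltW m_gt0).
    move=> z [z1 z2]; apply: g_gtm; split; rewrite /= subr0.
      rewrite -(subrK c.1 z.1) (le_trans (ler_normD _ _))// (le_trans (lerD z1 c1))// /r.
      by lra.
    rewrite -(subrK c.2 z.2) (le_trans (ler_normD _ _))// (le_trans (lerD z2 c2))// /r.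
    by lra.
  exists n0 => n /n0P; apply: le_trans; rewrite /eta; lra.
have [n0 n0P] := low (0, 0) (ltac:(by rewrite normr0)) (ltac:(by rewrite normr0)).
have [n1 n1P] := low (1, 0) (ltac:(by rewrite normr1)) (ltac:(by rewrite normr0)).
have [n2 n2P] := low (0, 1) (ltac:(by rewrite normr0)) (ltac:(by rewrite normr1)).
(* The maximum with [0] covers the second outcome of [chf_defect], a vanishing modulus, which has no
   direction. *)
exists (Num.max 0 (1 - kappa * eta)).
  rewrite le_max lexx /= gt_max ltr01 /=.
  by have := mulr_gt0 k0 e0; lra.
exists (maxn 1 (maxn n0 (maxn n1 n2))); first by rewrite leq_max.
move=> n th; rewrite !geq_max => /and4P[n_gt0 nn0 nn1 nn2] t1 t2 t1_1 t2_1 half.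
have A1 : 0 < a1 n%:R by rewrite a1_gt0// ltr0n.
have A2 : 0 < a2 n%:R by rewrite a2_gt0// ltr0n.
have phaseE z : phase th z = t1 * (scaled a1 a2 n z).1 + t2 * (scaled a1 a2 n z).2.
  by rewrite /phase /scaled /t1 /t2 /=; field; rewrite !gt_eqF.
have cosK (x : R) : 4^-1 <= `|x| <= 5 / 4 -> 4 * kappa <= 1 - cos x.
  move=> /andP[x1 x2]; rewrite /kappa mulrCA divff// mulr1 lerD2l lerN2 -(cos_norm x).
  by rewrite leNgt ltr_cos ?in_itv/= -?leNgt//; have := @pi_ge2 R; lra.
suff : chf n th <= 1 - kappa * eta \/ chf n th = 0.
  by rewrite le_max => -[->|->]; rewrite ?orbT ?lexx.
have small (x y t : R) : `|t| <= 1 -> `|x| <= r' -> `|y| <= r' -> `|t * (x - y)| <= 8^-1.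
  move=> tt xx yy; rewrite normrM.
  have h : `|x - y| <= 8^-1 by rewrite (le_trans (ler_normB _ _))// (le_trans (lerD xx yy))// /r'; lra.
  by rewrite -[leRHS]mul1r; apply: ler_pM.
have aux (t x : R) : `|t| <= 1 -> 2^-1 <= `|t| -> `|x| <= 4^-1 -> 4^-1 <= `|t + x| <= 5 / 4.
  move=> tt tt' xx; apply/andP; split.
    have := ler_normB (t + x) x; rewrite addrK; lra.
  by rewrite (le_trans (ler_normD _ _))//; lra.
case/orP : half => half.
  apply: (chf_defect k0 (n0P n nn0) (n1P n nn1)) => y z [y1 y2] [z1 z2].
  apply: cosK; rewrite !phaseE.
  move: y1 y2 z1 z2; rewrite /= !subr0.
  move: (y.1%:~R / a1 n%:R) (y.2%:~R / a2 n%:R) (z.1%:~R / a1 n%:R) (z.2%:~R / a2 n%:R).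
  move=> Y1 Y2 Z1 Z2 y1 y2 z1 z2.
  rewrite (_ : t1 * Z1 + t2 * Z2 - (t1 * Y1 + t2 * Y2) =
    t1 + (t1 * ((Z1 - 1) - Y1) + t2 * (Z2 - Y2))); last by ring.
  apply: aux => //; rewrite (le_trans (ler_normD _ _))//.
  have := small _ _ _ t1_1 z1 y1; have := small _ _ _ t2_1 z2 y2; lra.
apply: (chf_defect k0 (n0P n nn0) (n2P n nn2)) => y z [y1 y2] [z1 z2].
apply: cosK; rewrite !phaseE.
move: y1 y2 z1 z2; rewrite /= !subr0.
move: (y.1%:~R / a1 n%:R) (y.2%:~R / a2 n%:R) (z.1%:~R / a1 n%:R) (z.2%:~R / a2 n%:R).
move=> Y1 Y2 Z1 Z2 y1 y2 z1 z2.
rewrite (_ : t1 * Z1 + t2 * Z2 - (t1 * Y1 + t2 * Y2) =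
  t2 + (t1 * (Z1 - Y1) + t2 * ((Z2 - 1) - Y2))); last by ring.
apply: aux => //; rewrite (le_trans (ler_normD _ _))//.
have := small _ _ _ t1_1 z1 y1; have := small _ _ _ t2_1 z2 y2; lra.
Qed.

End Annulus.

(** * Regular variation of the scaling functions *)

Section Limits_at_infinity.
Context {R : realType}.

Lemma near_pinftyP (Q : R -> Prop) :
  (\forall x \near +oo, Q x) <-> exists2 T : R, 0 < T & forall x, T <= x -> Q x.
Proof.
split => [[T [_ TQ]]|[T T0 TQ]].
  exists (`|T| + 1); first by rewrite ltr_wpDl.
  by move=> x Tx; apply: TQ; have := ler_norm T; lra.
by exists T; split; rewrite ?num_real// => x /ltW /TQ.
Qed.

Lemma cvg_pinftyP (f : R -> R) (l : R) :
  (f x @[x --> +oo] --> l) <->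
  (forall e, 0 < e -> exists2 T : R, 0 < T & forall x, T <= x -> `|f x - l| <= e).
Proof.
split => [/cvgrPdist_le fl e e0|H].
  have /near_pinftyP[T T0 TP] := fl e e0.
  by exists T => // x /TP; rewrite distrC.
apply/cvgrPdist_le => e e0; apply/near_pinftyP.
by have [T T0 TP] := H e e0; exists T => // x /TP; rewrite distrC.
Qed.

End Limits_at_infinity.

Section Scale_comparison.
Context {R : realFieldType}.

(** To be read with [x = a s], [y = a t], [u = sg x], [v = sg y]. The scaling relations
    [s * u ~ x ^+ 2], [t * v ~ y ^+ 2] and the Potter bound on [u / v] give [x / y] at most about
    [2 * s / t]. *)
Lemma scale_bound (s t x y u v K dl : R) : 0 < s -> 0 < t -> 0 < x -> 0 < y ->
  0 < dl -> dl <= 8^-1 -> 1 <= K -> s <= K * t ->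
  (1 - dl) * x ^+ 2 <= s * u -> t * v <= (1 + dl) * y ^+ 2 ->
  u * y <= 2 * x * v -> x <= 8 * K * y.
Proof.
move=> s0 t0 x0 y0 dl0 dl1 K1 sK Hs Ht huv.
have h3 : (1 - dl) * x ^+ 2 * y <= s * (2 * x * v).
  apply: (@le_trans _ _ (s * u * y)); first by rewrite ler_pM2r.
  by rewrite -mulrA ler_pM2l.
have h4 : t * ((1 - dl) * x ^+ 2 * y) <= s * (2 * x * ((1 + dl) * y ^+ 2)).
  apply: (@le_trans _ _ (t * (s * (2 * x * v)))); first by rewrite ler_pM2l.
  rewrite (_ : t * (s * (2 * x * v)) = s * (2 * x * (t * v))); last by ring.
  by rewrite !ler_pM2l ?mulr_gt0.
have h5 : t * ((1 - dl) * x) <= s * (2 * (1 + dl) * y).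
  rewrite -(ler_pM2r (mulr_gt0 x0 y0)).
  rewrite (_ : t * ((1 - dl) * x) * (x * y) = t * ((1 - dl) * x ^+ 2 * y)); last by ring.
  by rewrite (_ : s * (2 * (1 + dl) * y) * (x * y) = s * (2 * x * ((1 + dl) * y ^+ 2)))//; ring.
have h6 : s * (2 * (1 + dl) * y) <= t * (K * (2 * (1 + dl) * y)).
  rewrite (_ : t * (K * (2 * (1 + dl) * y)) = K * t * (2 * (1 + dl) * y)); last by ring.
  rewrite ler_pM2r// !mulr_gt0//; clear - dl0; lra.
move: (le_trans h5 h6); rewrite ler_pM2l// => h7.
have h8 : 0 < K * y by rewrite mulr_gt0//; lra.
have h9 : dl * x <= 8^-1 * x by rewrite ler_pM2r.
have h10 : dl * (K * y) <= 8^-1 * (K * y) by rewrite ler_pM2r.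
move: h7; rewrite (_ : K * (2 * (1 + dl) * y) = 2 * (K * y) + 2 * (dl * (K * y))); last by ring.
rewrite (_ : 8 * K * y = 8 * (K * y)) -?mulrA// mulrBl mul1r.
clear - h8 h9 h10; move: (dl * (K * y)) (dl * x) (K * y) h8 h9 h10 => p q r *; lra.
Qed.

Lemma scale_ratio_lower (s t x y u v dl : R) : 0 < s -> 0 < t -> 0 < x -> 0 < y ->
  0 < dl -> dl <= 8^-1 ->
  (1 - dl) * y ^+ 2 <= t * v -> s * u <= (1 + dl) * x ^+ 2 ->
  v <= (1 + dl) * u -> (1 - 8 * dl) * (y ^+ 2 * s) <= x ^+ 2 * t.
Proof.
move=> s0 t0 x0 y0 dl0 dl1 Ht Hs vu.
have k1 : (1 - dl) * (y ^+ 2 * s) <= (1 + dl) ^+ 2 * (x ^+ 2 * t).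
  apply: (@le_trans _ _ (t * ((1 + dl) * u) * s)).
    by rewrite [leLHS]mulrA ler_pM2r//; apply: (le_trans Ht); rewrite ler_pM2l.
  rewrite (_ : t * ((1 + dl) * u) * s = (1 + dl) * (s * u) * t); last by ring.
  rewrite (_ : _ ^+ 2 * _ = (1 + dl) * ((1 + dl) * x ^+ 2) * t); last by ring.
  by rewrite ler_pM2r// ler_pM2l//; lra.
have p0 : 0 < y ^+ 2 * s by rewrite !mulr_gt0.
move: (y ^+ 2 * s) (x ^+ 2 * t) p0 k1 => p q p0 k1.
have k2 : (1 - 8 * dl) * p * (1 + dl) ^+ 2 <= (1 - dl) * p.
  by rewrite mulrAC ler_pM2r//; clear - dl0 dl1; nra.
have k3 : 0 < (1 + dl) ^+ 2 by rewrite exprn_gt0//; lra.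
by rewrite -(ler_pM2r k3) (le_trans k2)// (le_trans k1)// mulrC.
Qed.

Lemma scale_ratio_upper (s t x y u v dl : R) : 0 < s -> 0 < t -> 0 < x -> 0 < y ->
  0 < dl -> dl <= 8^-1 ->
  (1 - dl) * x ^+ 2 <= s * u -> t * v <= (1 + dl) * y ^+ 2 ->
  u <= (1 + dl) * v -> x ^+ 2 * t <= (1 + 8 * dl) * (y ^+ 2 * s).
Proof.
move=> s0 t0 x0 y0 dl0 dl1 Hs Ht uv.
have k1 : (1 - dl) * (x ^+ 2 * t) <= (1 + dl) ^+ 2 * (y ^+ 2 * s).
  apply: (@le_trans _ _ (s * ((1 + dl) * v) * t)).
    by rewrite [leLHS]mulrA ler_pM2r//; apply: (le_trans Hs); rewrite ler_pM2l.
  rewrite (_ : s * ((1 + dl) * v) * t = (1 + dl) * (t * v) * s); last by ring.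
  rewrite (_ : _ ^+ 2 * _ = (1 + dl) * ((1 + dl) * y ^+ 2) * s); last by ring.
  by rewrite ler_pM2r// ler_pM2l//; lra.
have p0 : 0 < y ^+ 2 * s by rewrite !mulr_gt0.
move: (y ^+ 2 * s) (x ^+ 2 * t) p0 k1 => p q p0 k1.
have k2 : (1 + dl) ^+ 2 * p <= (1 - dl) * ((1 + 8 * dl) * p).
  by rewrite mulrA ler_pM2r//; clear - dl0 dl1; nra.
have k3 : 0 < 1 - dl by lra.
by rewrite -(ler_pM2l k3) (le_trans k1).
Qed.

End Scale_comparison.

Section Regular_variation.
Context {R : realType}.
Variables sg a : R -> R.
Hypothesis sg_mono : forall x y, x <= y -> sg x <= sg y.
Hypothesis sg_jump : exists2 eta : R, 0 < eta & forall y, 0 < sg y -> eta <= sg y.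
Hypothesis sg_sv : slowly_varying sg.
Hypothesis a_gt0 : forall t : R, 0 < t -> 0 < a t.
Hypothesis a_scale : asymp_equiv (pinfty_nbhs R)
  (fun t => sg (a t) / a t ^+ 2) (fun t => t^-1).

Lemma sg_uniform (M e : R) : 0 < M -> 0 < e ->
  exists2 y0 : R, 0 < y0 & forall y, y0 <= y -> 0 < sg y /\ sg (M * y) <= (1 + e) * sg y.
Proof.
move=> M0 e0; have [[m [_ mP]] lim] := sg_sv.
have [T T0 TP] := (cvg_pinftyP _ _).1 (lim M M0) e e0.
exists (Num.max T m); first by rewrite lt_max T0.
move=> y; rewrite ge_max => /andP[Ty my].
have sy := mP y my; split => //.
have := TP y Ty; rewrite ler_distl => /andP[_].
by rewrite ler_pdivrMr.
Qed.

(** What matters about 3/2 is that it is below 2: it makes the dyadic series in [integral_quadlin]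
    geometric of ratio 3/4. *)
Lemma sg_doubling : exists2 y0 : R, 0 < y0 & forall y, y0 <= y ->
  0 < sg y /\ sg (2 * y) <= 3 / 2 * sg y.
Proof.
have half0 : 0 < 2^-1 :> R by rewrite invr_gt0.
have [y0 y00 H] := sg_uniform (ltr0Sn R 1) half0.
exists y0 => // y /H[-> h]; split => //; apply: le_trans h _.
by rewrite (_ : 1 + 2^-1 = 3 / 2 :> R)//; field.
Qed.

Lemma pow2_unbounded (x : R) : exists k, x <= 2 ^+ k.
Proof.
exists (Num.bound `|x|); apply: (le_trans (ler_norm _)).
apply: (le_trans (ltW (archi_boundP (normr_ge0 x)))).
by rewrite -natrX ler_nat ltnW// ltn_expl.
Qed.

(** A Potter bound with exponent 1, by induction on the halvings of [x]: each costs a factor 3/2 on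
    [sg], while the right-hand side gains a factor 2. *)
Lemma sg_potter : exists2 y0 : R, 0 < y0 & forall x y, y0 <= y -> y <= x ->
  0 < sg y /\ sg x <= 2 * (x / y) * sg y.
Proof.
have [y0 y00 H] := sg_doubling; exists y0 => // x y y0y yx.
have y_gt0 : 0 < y by apply: lt_le_trans y0y.
have [sy _] := H y y0y; split => //.
have [k kP] := pow2_unbounded (x / y); move: kP; rewrite ler_pdivrMr//.
elim: k x yx => [|k IH] x yx xk.
  have -> : x = y by apply/le_anti; rewrite yx andbT; move: xk; rewrite expr0 mul1r.
  by rewrite divff ?gt_eqF//; lra.
have [x2y|x2y] := lerP x (2 * y).
  have [_ h] := H y y0y; apply: (le_trans (sg_mono x2y)); apply: (le_trans h).
  rewrite ler_pM2r//; have : 1 <= x / y by rewrite ler_pdivlMr// mul1r.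
  by lra.
have h2 : y <= x / 2 by lra.
have h3 : x / 2 <= 2 ^+ k * y by move: xk; rewrite exprS; lra.
have := IH _ h2 h3; have [_] := H _ (le_trans y0y h2).
rewrite (_ : 2 * (x / 2) = x); last by field.
have -> : 2 * (x / 2 / y) * sg y = (x / y) * sg y by field; rewrite gt_eqF.
have : 0 < x / y * sg y by rewrite mulr_gt0// divr_gt0//; lra.
by lra.
Qed.

Let h t := sg (a t) / a t ^+ 2.

Lemma h_asymp (e : R) : 0 < e -> exists2 T : R, 0 < T & forall t, T <= t -> `|t * h t - 1| <= e.
Proof.
move=> e0; have [T T0 TP] := (cvg_pinftyP _ _).1 a_scale e e0.
by exists T => // t /TP; rewrite invrK mulrC.
Qed.

(** [a t ^+ 2] is asymptotic to [t * sg (a t)], and [sg (a t)], once positive, is at least the jump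
    [eta]. Without such a floor [a t] could stay bounded while [sg (a t)] tends to [0]. *)
Lemma a_unbounded B : exists2 T : R, 0 < T & forall t, T <= t -> B <= a t.
Proof.
have [eta eta0 jump] := sg_jump.
have half0 : 0 < 2^-1 :> R by rewrite invr_gt0.
have [T T0 TP] := h_asymp half0.
pose B' : R := `|B| + 1; have B'1 : 0 < B' by rewrite ltr_wpDl.
exists (Num.max T (2 * B' ^+ 2 / eta)); first by rewrite lt_max T0.
move=> t; rewrite ge_max => /andP[Tt Bt].
have t0 : 0 < t by apply: lt_le_trans Tt.
have at0 := a_gt0 t0.
have := TP t Tt; rewrite ler_distl => /andP[h1 h2].
have hp : 0 < h t.
  by rewrite -(pmulr_rgt0 _ t0); lra.
have sp : 0 < sg (a t).
  by move: hp; rewrite /h pmulr_lgt0// invr_gt0 exprn_gt0.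
have h3 : t * eta <= 2 * a t ^+ 2.
  have : t * sg (a t) <= (1 + 2^-1) * a t ^+ 2.
    by rewrite -ler_pdivrMr ?exprn_gt0// -mulrA.
  have : t * eta <= t * sg (a t) by rewrite ler_pM2l// jump.
  have : 0 < a t ^+ 2 by rewrite exprn_gt0.
  by lra.
have h4 : 2 * B' ^+ 2 <= t * eta by rewrite -ler_pdivrMr.
have : B' ^+ 2 <= a t ^+ 2 by lra.
rewrite ler_sqr ?nnegrE; [move=> h5|exact: ltW|exact: ltW].
by apply: le_trans h5; rewrite /B'; have := ler_norm B; lra.
Qed.

(** Slow variation compares [sg (a s)] with [sg (a t)] only once [a s / a t] is known to be bounded.
    The Potter bound gives this first, within [8 * K] either way; by monotonicity, slow variation
    for the single factor [8 * K] then makes the two values of [sg] nearly equal, and [a ^+ 2]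
    inherits the ratio [s / t]. *)
Lemma a_ratio (K e : R) : 1 <= K -> 0 < e -> exists2 T : R, 0 < T & forall t s,
  T <= t -> t <= s -> s <= K * t ->
  (1 - e) * (s / t) <= (a s / a t) ^+ 2 <= (1 + e) * (s / t).
Proof.
move=> K1; wlog e1 : e / e <= 1.
  move=> H e0; have [/H/(_ e0)//|/ltW e1] := lerP e 1.
  have [T T0 TP] := H 1 (lexx _) ltr01; exists T => // t s Tt ts sK.
  have /andP[h1 h2] := TP t s Tt ts sK.
  have st : 0 <= s / t by rewrite divr_ge0//; lra.
  apply/andP; split; [apply: le_trans h1|apply: (le_trans h2)]; rewrite ler_wpM2r//; lra.
move=> e0; pose dl : R := e / 8; have dl0 : 0 < dl by rewrite divr_gt0.
have [T1 T10 T1P] := h_asymp dl0.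
have [y0 y00 pot] := sg_potter.
have K81 : 1 <= 8 * K by lra.
have K8 : 0 < 8 * K by lra.
have [y1 y10 uni] := sg_uniform K8 dl0.
have [T2 T20 T2P] := a_unbounded (Num.max y0 y1).
exists (Num.max T1 T2); first by rewrite lt_max T10.
move=> t s; rewrite ge_max => /andP[T1t T2t] ts sK.
have t0 : 0 < t by apply: lt_le_trans T1t.
have s0 : 0 < s by apply: lt_le_trans ts.
have x0 := a_gt0 s0; have z0 := a_gt0 t0.
have := T1P t T1t; have := T1P s (le_trans T1t ts).
have := T2P t T2t; have := T2P s (le_trans T2t ts).
rewrite /h !ge_max; move: (a s) (a t) x0 z0 => x y x0 z0 /andP[x_y0 x_y1] /andP[y_y0 y_y1].
rewrite !ler_distl => /andP[hs1 hs2] /andP[ht1 ht2].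
have [sx0 _] := pot x x x_y0 (lexx _); have [sy0 _] := pot y y y_y0 (lexx _).
have x2 : 0 < x ^+ 2 by rewrite exprn_gt0.
have y2 : 0 < y ^+ 2 by rewrite exprn_gt0.
have dl1 : dl <= 8^-1 by rewrite /dl; lra.
have Hs1 : (1 - dl) * x ^+ 2 <= s * sg x by move: hs1; rewrite mulrA ler_pdivlMr.
have Hs2 : s * sg x <= (1 + dl) * x ^+ 2 by move: hs2; rewrite mulrA ler_pdivrMr.
have Ht1 : (1 - dl) * y ^+ 2 <= t * sg y by move: ht1; rewrite mulrA ler_pdivlMr.
have Ht2 : t * sg y <= (1 + dl) * y ^+ 2 by move: ht2; rewrite mulrA ler_pdivrMr.
have xy : x <= 8 * K * y.
  have [h0|h0] := lerP x y; first by apply: (le_trans h0); rewrite ler_peMl ?(ltW z0).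
  have [_ h1] := pot x y y_y0 (ltW h0).
  apply: (scale_bound s0 t0 x0 z0 dl0 dl1 K1 sK Hs1 Ht2).
  by rewrite -ler_pdivlMr// (le_trans h1)// (_ : 2 * x * sg y / y = 2 * (x / y) * sg y)//; field; rewrite gt_eqF.
have yx : y <= 8 * K * x.
  have [h0|h0] := lerP y x; first by apply: (le_trans h0); rewrite ler_peMl ?(ltW x0).
  have [_ h1] := pot y x x_y0 (ltW h0).
  have tK : t <= K * s by apply: (le_trans ts); rewrite ler_peMl// ltW.
  apply: (scale_bound t0 s0 z0 x0 dl0 dl1 K1 tK Ht1 Hs2).
  by rewrite -ler_pdivlMr// (le_trans h1)// (_ : 2 * y * sg x / x = 2 * (y / x) * sg x)//; field; rewrite gt_eqF.
have sxy : sg x <= (1 + dl) * sg y.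
  by have [_] := uni y y_y1; apply: le_trans; exact: sg_mono.
have syx : sg y <= (1 + dl) * sg x.
  by have [_] := uni x x_y1; apply: le_trans; exact: sg_mono.
have e8 : e = 8 * dl by rewrite /dl; field.
rewrite expr_div_n e8; apply/andP; split.
  rewrite mulrA ler_pdivlMr// mulrAC ler_pdivrMr//.
  rewrite -mulrA [s * _]mulrC.
  exact: (scale_ratio_lower s0 t0 x0 z0 dl0 dl1 Ht1 Hs2 syx).
rewrite mulrA ler_pdivrMr// mulrAC ler_pdivlMr//.
rewrite (_ : _ * y ^+ 2 = (1 + 8 * dl) * (y ^+ 2 * s)); last by rewrite -mulrA [s * _]mulrC.
exact: (scale_ratio_upper s0 t0 x0 z0 dl0 dl1 Hs1 Ht2 sxy).
Qed.

(** Were [a s < B * a t], the Potter bound between these two values and the relation of [a ^+ 2] to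
    [t * sg (a t)] would give 8 at most 3, in units of [B ^+ 2 * a t ^+ 2]; the constant 16 is what
    leaves room for the losses. *)
Lemma a_growth (B : R) : 1 <= B -> exists2 T : R, 0 < T & forall t s,
  T <= t -> 16 * B ^+ 2 * t <= s -> B * a t <= a s.
Proof.
have half0 : 0 < 2^-1 :> R by rewrite invr_gt0.
move=> B1; have [T1 T10 T1P] := h_asymp half0.
have [y0 y00 pot] := sg_potter.
have [T2 T20 T2P] := a_unbounded y0.
exists (Num.max T1 T2); first by rewrite lt_max T10.
move=> t s; rewrite ge_max => /andP[T1t T2t] ts.
have t0 : 0 < t by apply: lt_le_trans T1t.
have B2 : 1 <= B ^+ 2 by rewrite exprn_ege1.
have tB : t <= B ^+ 2 * t by rewrite ler_peMl// ltW.
have t_s : t <= s by lra.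
have s0 : 0 < s by apply: lt_le_trans t_s.
have x0 := a_gt0 s0; have z0 := a_gt0 t0.
rewrite leNgt; apply/negP.
have := T1P t T1t; have := T1P s (le_trans T1t t_s).
have := T2P t T2t; have := T2P s (le_trans T2t t_s).
rewrite /h; move: (a s) (a t) x0 z0 => x y x0 z0 x_y0 y_y0.
rewrite !ler_distl => /andP[_ hs2] /andP[ht1 _] xBy.
have [sx0 h1] := pot (B * y) x x_y0 (ltW xBy).
have x2 : 0 < x ^+ 2 by rewrite exprn_gt0.
have y2 : 0 < y ^+ 2 by rewrite exprn_gt0.
have Hs2 : s * sg x <= (1 + 2^-1) * x ^+ 2 by move: hs2; rewrite mulrA ler_pdivrMr.
have Ht1 : (1 - 2^-1) * y ^+ 2 <= t * sg y by move: ht1; rewrite mulrA ler_pdivlMr.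
have By : 0 < B * y by rewrite mulr_gt0//; lra.
have h2 : sg y <= sg (B * y) by apply: sg_mono; rewrite ler_peMl// ltW.
have h3 : sg y * x <= 2 * (B * y) * sg x.
  apply: (@le_trans _ _ (2 * (B * y / x) * sg x * x)); first by rewrite ler_pM2r// (le_trans h2).
  by rewrite (_ : 2 * (B * y / x) * sg x * x = 2 * (B * y) * sg x)//; field; rewrite gt_eqF.
have h4 : s * (sg y * x) <= 3 * (B * y) * x ^+ 2.
  apply: (@le_trans _ _ (s * (2 * (B * y) * sg x))); first by rewrite ler_pM2l.
  rewrite (_ : s * (2 * (B * y) * sg x) = 2 * (B * y) * (s * sg x)); last by ring.
  rewrite (_ : 3 * (B * y) * x ^+ 2 = 2 * (B * y) * ((1 + 2^-1) * x ^+ 2)); last by field.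
  by rewrite ler_pM2l// mulr_gt0.
have h5 : s * sg y <= 3 * (B * y) * x.
  by rewrite -(ler_pM2r x0) -[leLHS]mulrA (le_trans h4)// expr2 mulrA.
have h6 : 3 * (B * y) * x <= 3 * (B * y) * (B * y) by apply: ler_wpM2l (ltW xBy); rewrite mulr_ge0// ltW.
have h7 : 16 * B ^+ 2 * (t * sg y) <= s * sg y.
  by rewrite mulrA ler_pM2r//; have [] := pot y y y_y0 (lexx _).
have h8 : 16 * B ^+ 2 * ((1 - 2^-1) * y ^+ 2) <= 16 * B ^+ 2 * (t * sg y).
  by rewrite ler_pM2l// mulr_gt0//; lra.
have h9 : 0 < B ^+ 2 * y ^+ 2 by rewrite mulr_gt0//; lra.
have h10 : 8 * (B ^+ 2 * y ^+ 2) <= 3 * (B ^+ 2 * y ^+ 2).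
  apply: (@le_trans _ _ (16 * B ^+ 2 * ((1 - 2^-1) * y ^+ 2))); first by lra.
  apply: (le_trans h8); apply: (le_trans h7); apply: (le_trans h5); apply: (le_trans h6).
  by rewrite (_ : 3 * (B * y) * (B * y) = 3 * (B ^+ 2 * y ^+ 2))//; ring.
by lra.
Qed.

End Regular_variation.

(** * Deviations of one coordinate *)

Section Lindeberg.
Context {R : realType}.

(* A smooth bounded substitute for [min (z^2) 1]: its second-order Taylor
   remainder is bounded by [quadlin], whose mean is finite under mere slow
   variation of the truncated second moment. *)
Definition lind (z : R) : R := z ^+ 2 / (1 + z ^+ 2).
Definition dlind (z : R) : R := 2 * z / (1 + z ^+ 2) ^+ 2.

Let den_gt0 (z : R) : 0 < 1 + z ^+ 2.
Proof. by rewrite ltr_pwDl// sqr_ge0. Qed.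

Lemma lindE z : lind z = 1 - (1 + z ^+ 2)^-1.
Proof. by rewrite /lind; field; rewrite gt_eqF. Qed.

Lemma lind_ge0 z : 0 <= lind z.
Proof. by rewrite divr_ge0 ?sqr_ge0 ?ltW. Qed.

Lemma lind_le1 z : lind z <= 1.
Proof. by rewrite lindE gerBl invr_ge0 ltW. Qed.

Lemma lind_ge_half z : 1 <= `|z| -> 2^-1 <= lind z.
Proof.
move=> z1; rewrite lindE.
have h : 2 <= 1 + z ^+ 2.
  have : 1 <= `|z| ^+ 2 by rewrite exprn_ege1.
  by rewrite real_normK ?num_real//; lra.
have : (1 + z ^+ 2)^-1 <= 2^-1 by rewrite lef_pV2 ?posrE.
by lra.
Qed.

Lemma norm_le_den (z : R) : 2 * `|z| <= 1 + z ^+ 2.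
Proof. by rewrite -(real_normK (num_real z)); have := sqr_ge0 (`|z| - 1); nra. Qed.

Lemma dlind_bound z : `|dlind z| <= 1.
Proof.
rewrite /dlind normrM normfV (ger0_norm (sqr_ge0 _)) ler_pdivrMr ?exprn_gt0// mul1r.
rewrite normrM ger0_norm//; apply: (le_trans (norm_le_den z)).
have h : 1 <= 1 + z ^+ 2 by rewrite lerDl sqr_ge0.
by rewrite [leRHS]expr2 ler_peMl// ltW.
Qed.

Lemma lind_taylor_quadratic s x : lind (s + x) - lind s - dlind s * x <= 4 * x ^+ 2.
Proof.
have A0 := den_gt0 s; have B0 := den_gt0 (s + x).
have D0 : 0 < (1 + s ^+ 2) ^+ 2 * (1 + (s + x) ^+ 2) by rewrite mulr_gt0// exprn_gt0.
rewrite -(ler_pM2r D0).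
have -> : (lind (s + x) - lind s - dlind s * x) * ((1 + s ^+ 2) ^+ 2 * (1 + (s + x) ^+ 2)) =
    x ^+ 2 * ((1 + s ^+ 2) - 2 * s ^+ 2 - 2 * s * (s + x)).
  by rewrite !lindE /dlind; field; rewrite !gt_eqF.
rewrite (_ : 4 * x ^+ 2 * _ = x ^+ 2 * (4 * ((1 + s ^+ 2) ^+ 2 * (1 + (s + x) ^+ 2)))); last by ring.
apply: ler_wpM2l; first exact: sqr_ge0.
have h1 : - (2 * s * (s + x)) <= s ^+ 2 + (s + x) ^+ 2.
  by have := sqr_ge0 (s + (s + x)); rewrite -subr_ge0; nra.
have hA : 1 <= 1 + s ^+ 2 by rewrite lerDl sqr_ge0.
have hB : 1 <= 1 + (s + x) ^+ 2 by rewrite lerDl sqr_ge0.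
have s2 := sqr_ge0 s; have sx2 := sqr_ge0 (s + x).
have hAB : 1 + s ^+ 2 <= (1 + s ^+ 2) ^+ 2 * (1 + (s + x) ^+ 2).
  rewrite [(1 + s ^+ 2) ^+ 2]expr2 -mulrA ler_peMr ?(ltW A0)//; exact: mulr_ege1.
have hBA : 1 + (s + x) ^+ 2 <= (1 + s ^+ 2) ^+ 2 * (1 + (s + x) ^+ 2).
  by rewrite ler_peMl ?(ltW B0)// exprn_ege1.
by move: h1 hAB hBA s2 sx2; move: (s ^+ 2) ((s + x) ^+ 2) (s * (s + x)) (_ * _) => p q r D; rewrite -mulrA; lra.
Qed.

Lemma lind_taylor_linear s x : lind (s + x) - lind s - dlind s * x <= 4 * `|x|.
Proof.
have A0 := den_gt0 s; have B0 := den_gt0 (s + x).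
have D0 : 0 < (1 + s ^+ 2) * (1 + (s + x) ^+ 2) by rewrite mulr_gt0.
have h1 : lind (s + x) - lind s <= 2 * `|x|.
  rewrite -(ler_pM2r D0).
  have -> : (lind (s + x) - lind s) * ((1 + s ^+ 2) * (1 + (s + x) ^+ 2)) =
      x * (s + (s + x)).
    by rewrite !lindE; field; rewrite !gt_eqF.
  apply: (le_trans (ler_norm _)); rewrite normrM -mulrA mulrCA ler_wpM2l//.
  rewrite (le_trans (ler_normD _ _))//.
  have n1 := norm_le_den s; have n2 := norm_le_den (s + x).
  have hA : 1 <= 1 + s ^+ 2 by rewrite lerDl sqr_ge0.
  have hB : 1 <= 1 + (s + x) ^+ 2 by rewrite lerDl sqr_ge0.
  have k1 : 1 + s ^+ 2 <= (1 + s ^+ 2) * (1 + (s + x) ^+ 2) by rewrite ler_peMr// ltW.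
  have k2 : 1 + (s + x) ^+ 2 <= (1 + s ^+ 2) * (1 + (s + x) ^+ 2) by rewrite ler_peMl// ltW.
  have := normr_ge0 s; have := normr_ge0 (s + x).
  move: n1 n2 k1 k2; move: (1 + s ^+ 2) (1 + (s + x) ^+ 2) => A B; move: (A * B) => D.
  by lra.
have h2 : - (dlind s * x) <= `|x|.
  by rewrite (le_trans (ler_norm _))// normrN normrM ler_piMl// dlind_bound.
by have := normr_ge0 x; lra.
Qed.

Definition quadlin (z : R) : R := Num.min (z ^+ 2) `|z|.

Lemma quadlin_ge0 z : 0 <= quadlin z.
Proof. by rewrite le_min sqr_ge0/= normr_ge0. Qed.

Lemma lind_taylor s x : lind (s + x) - lind s - dlind s * x <= 4 * quadlin x.
Proof.
rewrite /quadlin; case: (leP (x ^+ 2) `|x|) => _.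
  exact: lind_taylor_quadratic.
exact: lind_taylor_linear.
Qed.

End Lindeberg.

Section Truncated_moment.
Context {R : realType} {d : measure_display} {Omega : measurableType d}.
Variable P : probability Omega R.
Variable V : Omega -> int.
Hypothesis mV : discrete_rv V.

Definition trunc2 (x : R) (k : int) : R := if `|k%:~R| <= x then k%:~R ^+ 2 else 0.

Let sg := truncated_second_moment P (fun w => (V w)%:~R).

Lemma trunc2_ge0 x k : 0 <= trunc2 x k.
Proof. by rewrite /trunc2; case: ifP => _; rewrite ?sqr_ge0. Qed.

Lemma trunc2_bound x : bounded_by (trunc2 x) (x ^+ 2).
Proof.
move=> k; rewrite ger0_norm ?trunc2_ge0// /trunc2; case: ifP => [kx|_]; last exact: sqr_ge0.
by rewrite -(real_normK (num_real (k%:~R : R))) lerXn2r ?nnegrE// (le_trans _ kx).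
Qed.

Lemma le_trunc2 x y k : x <= y -> trunc2 x k <= trunc2 y k.
Proof.
move=> xy; rewrite /trunc2; case: ifP => [kx|_]; first by rewrite (le_trans kx xy).
exact: (trunc2_ge0 y k).
Qed.

Lemma truncated_second_momentE x : sg x = \int[P]_w trunc2 x (V w).
Proof.
rewrite /sg /truncated_second_moment Rintegral_mkcond.
apply: eq_Rintegral => w _; rewrite patchE /trunc2.
by case: (boolP (_ <= x)) => h; [rewrite mem_set|rewrite memNset//; exact/negP].
Qed.

Lemma integrable_trunc2 x : P.-integrable setT (EFin \o (fun w => trunc2 x (V w))).
Proof. exact: integrable_discrete_rv mV (@trunc2_bound x). Qed.

Lemma truncated_second_moment_mono x y : x <= y -> sg x <= sg y.
Proof.
move=> xy; rewrite !truncated_second_momentE; apply: le_Rintegral => //.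
- exact: integrable_trunc2.
- exact: integrable_trunc2.
- by move=> w _; exact: le_trunc2.
Qed.

Lemma truncated_second_moment_ge0 x : 0 <= sg x.
Proof. by rewrite truncated_second_momentE; apply: Rintegral_ge0 => w _; exact: trunc2_ge0. Qed.

Lemma truncated_second_moment_truncn x : 0 <= x -> sg x = sg (Num.truncn x)%:R.
Proof.
move=> x0; rewrite !truncated_second_momentE; apply: eq_Rintegral => w _.
by rewrite /trunc2 -intr_norm -natr_absz ler_nat truncn_ge_nat.
Qed.

(** [V] is integer-valued, so [sg] is a step function that changes only at natural numbers; its
    value at the first one where it is positive serves as [eta]. *)
Lemma truncated_second_moment_jump :
  exists2 eta : R, 0 < eta & forall y, 0 < sg y -> eta <= sg y.
Proof.
have [[k kP]|none] := pselect (exists k : nat, 0 < sg k%:R); last first.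
  exists 1 => // y y0; exfalso; apply: none.
  have [yn|yn] := lerP 0 y; first by exists (Num.truncn y); rewrite -truncated_second_moment_truncn.
  by exists 0%N; apply: lt_le_trans y0 _; apply: truncated_second_moment_mono; exact: ltW.
have exk : exists k : nat, 0 < sg k%:R by exists k.
exists (sg (ex_minn exk)%:R); case: ex_minnP => // k0 k0P k0min.
move=> y y0; have [yn|yn] := lerP 0 y; last first.
  (* A negative [y] cannot occur: [sg y] would be at most [sg 0], and the truncation at [0] keeps
     only the square of [0]. *)
  have : 0 < sg 0%:R.
    by apply: lt_le_trans y0 _; apply: truncated_second_moment_mono; exact: ltW.
  move/k0min; rewrite leqn0 => /eqP k00; move: k0P; rewrite k00 => k0P.
  exfalso; move: k0P; rewrite truncated_second_momentE.
  suff -> : \int[P]_w trunc2 0 (V w) = 0 by rewrite ltxx.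
  rewrite -[RHS](Rintegral_probability_cst P 0); apply: eq_Rintegral => w _.
  by rewrite /trunc2 normr_le0; case: ifP => // /eqP ->; rewrite expr0n.
rewrite [leRHS](truncated_second_moment_truncn yn); apply: truncated_second_moment_mono.
by rewrite ler_nat; apply: k0min; rewrite -truncated_second_moment_truncn.
Qed.

Lemma geometric_sum_bound n : \sum_(0 <= j < n) (3 / 4 : R) ^+ j <= 4.
Proof.
suff -> : \sum_(0 <= j < n) (3 / 4 : R) ^+ j = 4 * (1 - (3 / 4) ^+ n).
  have : 0 <= (3 / 4 : R) ^+ n by rewrite exprn_ge0.
  by move: (_ ^+ n) => x; lra.
elim: n => [|n IH]; first by rewrite big_geq// expr0 subrr mulr0.
by rewrite big_nat_recr//= IH exprS; field.
Qed.

Variable y0 : R.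
Hypothesis y0_gt0 : 0 < y0.
Hypothesis doubling : forall y, y0 <= y -> 0 < sg y /\ sg (2 * y) <= 3 / 2 * sg y.

Lemma doubling_iter y j : y0 <= y -> sg (2 ^+ j * y) <= (3 / 2) ^+ j * sg y.
Proof.
move=> yy; elim: j => [|j IH]; first by rewrite !expr0 !mul1r.
have yj : y0 <= 2 ^+ j * y.
  apply: (le_trans yy); rewrite ler_peMl//; first by rewrite (le_trans _ yy)// ltW.
  by rewrite exprn_ege1// ler1n.
rewrite exprS -mulrA; have [_ h] := doubling yj; apply: (le_trans h).
by rewrite exprS -[leRHS]mulrA ler_pM2l.
Qed.

(** [j] is the dyadic scale of [|u| / y]. By minimality [|u|] exceeds [2 ^+ (j - 1) * y] when
    [j > 0], which bounds the linear branch of [quadlin] by a truncated square; for [j = 0] the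
    quadratic branch is used. *)
Lemma quadlin_le_dyadic (y : R) k : 0 < y ->
  exists j, quadlin (k%:~R / y) <= 2 / 2 ^+ j / y ^+ 2 * trunc2 (2 ^+ j * y) k.
Proof.
move=> yp; set u : R := k%:~R.
have ex : exists j, `|u| <= 2 ^+ j * y.
  by have [j jP] := pow2_unbounded (`|u| / y); exists j; rewrite -ler_pdivrMr.
exists (ex_minn ex); case: ex_minnP => j uj jmin.
rewrite /trunc2 -/u uj; case: j uj jmin => [|j] uj jmin.
  apply: (@le_trans _ _ ((u / y) ^+ 2)); first by rewrite /quadlin ge_min lexx.
  rewrite expr_div_n expr0 divr1 [leLHS]mulrC -mulrA.
  by rewrite ler_peMl ?ler1n// mulr_ge0 ?sqr_ge0// invr_ge0 sqr_ge0.
have h : 2 ^+ j * y < `|u|.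
  by rewrite ltNge; apply/negP => /jmin; rewrite ltnn.
apply: (@le_trans _ _ `|u / y|); first by rewrite /quadlin ge_min lexx orbT.
rewrite normrM normfV (ger0_norm (ltW yp)) exprS.
have p0 : 0 < 2 ^+ j :> R by rewrite exprn_gt0.
have -> : 2 / (2 * 2 ^+ j) / y ^+ 2 * u ^+ 2 = `|u| / y * (`|u| / (2 ^+ j * y)).
  by rewrite -(real_normK (num_real u)); field; rewrite !gt_eqF.
have u0 : 0 <= `|u| / y by rewrite divr_ge0// ltW.
by rewrite ler_peMr// ler_pdivlMr ?mulr_gt0// mul1r ltW.
Qed.

(** The majorants of [quadlin_le_dyadic] are summed over all scales: each doubling multiplies [sg]
    by at most 3/2 and halves the weight, and 2 times the geometric sum 4 gives 8. *)
Lemma integral_quadlin y : y0 <= y ->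
  (\int[P]_w (quadlin ((V w)%:~R / y))%:E <= (8 * sg y / y ^+ 2)%:E)%E.
Proof.
move=> yy; have yp : 0 < y by apply: lt_le_trans yy.
pose F j w : R := 2 / 2 ^+ j / y ^+ 2 * trunc2 (2 ^+ j * y) (V w).
have c0 j : 0 <= 2 / 2 ^+ j / y ^+ 2 :> R by rewrite !divr_ge0// ?exprn_ge0// ltW.
have F0 j w : (0 <= (F j w)%:E)%E by rewrite lee_fin mulr_ge0// trunc2_ge0.
have mF j : measurable_fun setT (fun w => (F j w)%:E).
  exact: (discrete_rv_emeasurable (fun k => (2 / 2 ^+ j / y ^+ 2 * trunc2 (2 ^+ j * y) k)%:E) mV).
apply: (@le_trans _ _ (\int[P]_w (\sum_(j <oo) (F j w)%:E))%E).
  apply: ge0_le_integral => //.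
  - by move=> w _; rewrite lee_fin quadlin_ge0.
  - exact: (discrete_rv_emeasurable (fun k => (quadlin (k%:~R / y))%:E) mV).
  - exact: ge0_emeasurable_sum.
  move=> w _; have [j jP] := quadlin_le_dyadic (V w) yp.
  apply: (@le_trans _ _ (F j w)%:E); first by rewrite lee_fin.
  apply: (@le_trans _ _ (\sum_(0 <= i < j.+1) (F i w)%:E)%E).
    by rewrite big_nat_recr//= leeDr// sume_ge0.
  by apply: nneseries_lim_ge.
rewrite integral_nneseries//; apply: lime_le.
  by apply: is_cvg_nneseries => j _ _; exact: integral_ge0.
apply: nearW => n.
have EF j : (\int[P]_w (F j w)%:E = (2 / 2 ^+ j / y ^+ 2 * sg (2 ^+ j * y))%:E)%E.
  rewrite truncated_second_momentE EFinM /Rintegral fineK; last first.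
    by apply: integrable_fin_num => //; exact: integrable_trunc2.
  rewrite -ge0_integralZl//.
  - exact: (discrete_rv_emeasurable (fun k => (trunc2 (2 ^+ j * y) k)%:E) mV).
  - by move=> w _; rewrite lee_fin trunc2_ge0.
  - by rewrite lee_fin.
under eq_bigr do rewrite EF.
rewrite sumEFin lee_fin.
apply: (@le_trans _ _ (\sum_(0 <= j < n) (2 * sg y / y ^+ 2 * (3 / 4) ^+ j))).
  apply: ler_sum => j _.
  apply: (@le_trans _ _ (2 / 2 ^+ j / y ^+ 2 * ((3 / 2) ^+ j * sg y))).
    by rewrite ler_wpM2l// doubling_iter.
  rewrite le_eqVlt; apply/orP; left; apply/eqP.
  rewrite (_ : 3 / 4 = 3 / 2 / 2 :> R); last by field.
  by rewrite (expr_div_n (3 / 2)); field; rewrite !gt_eqF// ?exprn_gt0.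
rewrite -mulr_sumr; have s0 := truncated_second_moment_ge0 y.
apply: (@le_trans _ _ (2 * sg y / y ^+ 2 * 4)).
  apply: ler_wpM2l; last exact: geometric_sum_bound.
  by rewrite !mulr_ge0// invr_ge0 exprn_ge0// ltW.
rewrite (_ : 2 * sg y / y ^+ 2 * 4 = 8 * sg y / y ^+ 2)//; by field; rewrite gt_eqF.
Qed.

Lemma integrable_quadlin y : y0 <= y ->
  P.-integrable setT (EFin \o (fun w => quadlin ((V w)%:~R / y))).
Proof.
move=> yy; apply/integrableP; split.
  exact: (discrete_rv_emeasurable (fun k => (quadlin (k%:~R / y))%:E) mV).
under eq_integral do rewrite /= ger0_norm ?quadlin_ge0//.
by apply: (le_lt_trans (integral_quadlin yy)); rewrite ltry.
Qed.

Lemma Rintegral_quadlin y : y0 <= y ->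
  \int[P]_w quadlin ((V w)%:~R / y) <= 8 * sg y / y ^+ 2.
Proof.
move=> yy; rewrite -lee_fin /Rintegral fineK; first exact: integral_quadlin.
by apply: integrable_fin_num => //; exact: integrable_quadlin.
Qed.

(** [|u| <= y0 * (1 + quadlin (u / y0))]. Integrability of the step is what lets the first-order
    term of the expansion in [lind_increment] be factored by independence. *)
Lemma integrable_step : P.-integrable setT (EFin \o (fun w => (V w)%:~R : R)).
Proof.
have iq := integrable_quadlin (lexx y0).
have ic : P.-integrable setT (EFin \o cst y0) by exact: finite_measure_integrable_cst.
have iq2 : P.-integrable setT (EFin \o (fun w => y0 + y0 * quadlin ((V w)%:~R / y0))).
  have := integrableD measurableT ic (integrableZl measurableT y0 iq).
  by apply: eq_integrable => // w _.
apply: le_integrable iq2 => //.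
  exact: (discrete_rv_emeasurable (fun k => (k%:~R : R)%:E) mV).
move=> w _ /=; rewrite lee_fin; apply: le_trans (ler_norm _).
move: ((V w)%:~R : R) => u.
rewrite -{1}(divfK (lt0r_neq0 y0_gt0) u) normrM (ger0_norm (ltW y0_gt0)) mulrC.
rewrite -[X in _ <= X + _]mulr1 -mulrDr ler_pM2l//.
rewrite /quadlin; move: (u / y0) => v; case: (leP (v ^+ 2) `|v|) => h; last by rewrite lerDr.
have [v1|v1] := lerP `|v| 1; first by rewrite ler_wpDr// sqr_ge0.
rewrite ler_wpDl// -(real_normK (num_real v)) expr2 ler_peMl//; exact: ltW.
Qed.

End Truncated_moment.

Section Deviation_bound.
Context {R : realType} {d : measure_display} {Omega : measurableType d}.
Variable P : probability Omega R.
Variable X : nat -> Omega -> int * int.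
Hypothesis Xiid : iid_steps P X.
Hypothesis mean0 : ('E_P[coord1 X 0%N])%E = 0%:E.

Let sg := truncated_second_moment P (coord1 X 0%N).

Variable y0 : R.
Hypothesis y0_gt0 : 0 < y0.
Hypothesis doubling : forall y, y0 <= y -> 0 < sg y /\ sg (2 * y) <= 3 / 2 * sg y.

Let V w := (X 0%N w).1.

Let mV : discrete_rv V.
Proof. exact: (discrete_rv_comp fst (discrete_step Xiid 0)). Qed.

(** Lindeberg's replacement step: expanding [lind] around the walk at time [m], the first-order term
    has mean zero because the new step is centred and independent of the past. The constant is 4
    from [lind_taylor] times 8 from [Rintegral_quadlin]. *)
Lemma lind_increment m y : y0 <= y ->
  \int[P]_w lind ((walk X m.+1 w).1%:~R / y) <=
  \int[P]_w lind ((walk X m w).1%:~R / y) + 32 * sg y / y ^+ 2.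
Proof.
move=> yy; have yp : 0 < y by apply: lt_le_trans yy.
have mW := discrete_walk Xiid m; have mI := discrete_incr Xiid m 1.
pose F (z : int * int) := lind (z.1%:~R / y : R).
pose D (z : int * int) := dlind (z.1%:~R / y : R).
pose G (z : int * int) : R := z.1%:~R / y.
pose Q (z : int * int) : R := quadlin (z.1%:~R / y).
have F1 : bounded_by F 1 by move=> z; rewrite ger0_norm ?lind_ge0 ?lind_le1.
have D1 : bounded_by D 1 by move=> z; exact: dlind_bound.
have law1 x : P (incr X m 1 @^-1` [set x]) = P (X 0%N @^-1` [set x]).
  by rewrite (incr_stationary Xiid) -(walk_step_same_law Xiid).
have iF n : P.-integrable setT (EFin \o (fun w => F (walk X n w))).
  exact: integrable_walk F1.
have iD : P.-integrable setT (EFin \o (fun w => D (walk X m w))).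
  exact: integrable_walk D1.
have transfer (H : int * int -> R) :
    P.-integrable setT (EFin \o (fun w => H (X 0%N w))) ->
    P.-integrable setT (EFin \o (fun w => H (incr X m 1 w))).
  move=> /integrableP[_ iH]; apply/integrableP; split.
    exact: (discrete_rv_emeasurable (fun z => (H z)%:E) mI).
  move: iH; rewrite (integral_discrete_rv P (F := fun z => `|(H z)%:E|%E) (discrete_step Xiid 0))//.
  rewrite (integral_discrete_rv P (F := fun z => `|(H z)%:E|%E) mI)//.
  by under eq_esum do rewrite -law1.
have iG0 : P.-integrable setT (EFin \o (fun w => G (X 0%N w))).
  have := integrableZl measurableT y^-1 (integrable_step mV y0_gt0 doubling).
  by apply: eq_integrable => // w _; rewrite /= /G -EFinM mulrC.
have iG := transfer G iG0.
have iQ := transfer Q (integrable_quadlin mV y0_gt0 doubling yy).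
have EG : \int[P]_w G (incr X m 1 w) = 0.
  rewrite (Rintegral_same_law G mI (discrete_step Xiid 0) law1).
  have iV : P.-integrable setT (EFin \o (fun w => (X 0%N w).1%:~R : R)) :=
    integrable_step mV y0_gt0 doubling.
  rewrite /G RintegralZr//.
  move: mean0; rewrite unlock => h.
  by rewrite /Rintegral h /= mul0r.
have EDG : \int[P]_w (D (walk X m w) * G (incr X m 1 w)) = 0.
  by rewrite (Rintegral_indep mW mI (indep_walk_incr Xiid m 1) iD iG) EG mulr0.
have iDG : P.-integrable setT (EFin \o (fun w => D (walk X m w) * G (incr X m 1 w))).
  exact: integrable_indep mW mI (indep_walk_incr Xiid m 1) iD iG.
have EQ : \int[P]_w Q (incr X m 1 w) <= 8 * sg y / y ^+ 2.
  rewrite (Rintegral_same_law Q mI (discrete_step Xiid 0) law1).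
  exact (Rintegral_quadlin mV y0_gt0 doubling yy).
have iQ4 : P.-integrable setT (EFin \o (fun w => 4 * Q (incr X m 1 w))).
  by have := integrableZl measurableT 4 iQ.
have iA : P.-integrable setT (EFin \o (fun w => F (walk X m w) + D (walk X m w) * G (incr X m 1 w))).
  by have := integrableD measurableT (iF m) iDG.
apply: (@le_trans _ _ (\int[P]_w (F (walk X m w) + D (walk X m w) * G (incr X m 1 w) + 4 * Q (incr X m 1 w)))).
  apply: le_Rintegral => //.
  - exact: (iF m.+1).
  - by have := integrableD measurableT iA iQ4.
  move=> w _; rewrite -[m.+1]addn1 (walkD X m 1) /F /D /G /Q /= intrD mulrDl.
  have := lind_taylor ((walk X m w).1%:~R / y : R) ((incr X m 1 w).1%:~R / y); lra.
rewrite RintegralD// RintegralD// EDG addr0 RintegralZl// lerD2l.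
by rewrite (_ : 32 * sg y / y ^+ 2 = 4 * (8 * sg y / y ^+ 2)) ?ler_pM2l//; field; rewrite gt_eqF.
Qed.

(** Markov's inequality for [lind], which is [0] at time [0] and at least 1/2 on the event: the
    bounds of [lind_increment] add up over [m] steps, and 64 is twice 32. *)
Lemma deviation_bound m y : y0 <= y ->
  prob_walk P X m [set z | y <= `|z.1%:~R : R| ] <= 64 * m%:R * sg y / y ^+ 2.
Proof.
move=> yy; have yp : 0 < y by apply: lt_le_trans yy.
have h : \int[P]_w lind ((walk X m w).1%:~R / y) <= 32 * m%:R * sg y / y ^+ 2.
  elim: m => [|m IH].
    rewrite mulr0 !mul0r -(Rintegral_probability_cst P 0); apply: le_Rintegral => //.
    - by apply: (integrable_walk Xiid 0 (f := fun z => lind (z.1%:~R / y : R)) (M := 1)) => z; rewrite ger0_norm ?lind_ge0 ?lind_le1.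
    - exact: finite_measure_integrable_cst.
    - by move=> w _; rewrite walk0 /lind /= !mul0r expr0n /= mul0r.
  apply: (le_trans (lind_increment m yy)).
  apply: (le_trans (lerD IH (lexx _))).
  by rewrite -natr1 le_eqVlt; apply/orP; left; apply/eqP; ring.
apply: (@le_trans _ _ (\int[P]_w (2 * lind ((walk X m w).1%:~R / y)))).
  apply: (prob_walk_le_Rintegral Xiid m (f := fun z => 2 * lind (z.1%:~R / y)) (M := 2)).
    by move=> z; rewrite normrM ger0_norm// ler_piMr// ger0_norm ?lind_ge0 ?lind_le1.
  move=> z; rewrite indicE; case: (pselect ([set z | y <= `|z.1%:~R : R| ] z)) => yz.
    rewrite mem_set//= -ler_pdivrMl// mulr1; apply: lind_ge_half.
    by rewrite normrM normfV (ger0_norm (ltW yp)) ler_pdivlMr// mul1r.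
  by rewrite memNset//= mulr_ge0// lind_ge0.
rewrite RintegralZl//; last first.
  by apply: (integrable_walk Xiid m (f := fun z => lind (z.1%:~R / y : R)) (M := 1)) => z; rewrite ger0_norm ?lind_ge0 ?lind_le1.
apply: (@le_trans _ _ (2 * (32 * m%:R * sg y / y ^+ 2))); first by rewrite ler_pM2l.
by rewrite le_eqVlt; apply/orP; left; apply/eqP; ring.
Qed.

End Deviation_bound.

(** * Fourier inversion on a grid *)

Section Dirichlet.
Context {R : realType}.

Definition grid_size (L : nat) : nat := L.*2.+1.

(* Averages over this grid of [(- pi, pi)^2] replace the Fourier inversion
   integral: they separate the integers between [- L] and [L]. *)
Definition grid_pt L (i : nat) : R := 2 * pi * (i%:R - L%:R) / (grid_size L)%:R.

Let MR L : (grid_size L)%:R = 2 * L%:R + 1 :> R.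
Proof. by rewrite /grid_size -natr1 -muln2 natrM mulrC. Qed.

Let M0 L : 0 < (grid_size L)%:R :> R. Proof. by rewrite ltr0n. Qed.

Lemma grid_pt_pi L (i : 'I_(grid_size L)) : `|grid_pt L i| <= pi.
Proof.
have pi0 := @pi_gt0 R.
have iM : i%:R <= 2 * L%:R :> R.
  by rewrite -[2 * _]natrM ler_nat mul2n -ltnS.
rewrite /grid_pt normrM normfV (ger0_norm (ltW (M0 L))) ler_pdivrMr// normrM ger0_norm; last by lra.
have : `|i%:R - L%:R| <= L%:R :> R.
  by rewrite ler_norml; have : 0 <= i%:R :> R by []; lra.
move=> h; apply: (@le_trans _ _ (2 * pi * L%:R)); first by rewrite ler_wpM2l//; lra.
by rewrite MR (_ : pi * _ = 2 * pi * L%:R + pi) ?lerDl ?ltW//; ring.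
Qed.

Definition dirichlet L (z : int) : R := \sum_(i < grid_size L) cos (grid_pt L i * z%:~R).

Lemma grid_sin0 L (z : int) : \sum_(i < grid_size L) sin (grid_pt L i * z%:~R) = 0.
Proof.
set S := LHS; suff : S = - S by move=> /eqP; rewrite -addr_eq0 -mulr2n mulrn_eq0/= => /eqP.
(* Reversing the ordinals sends each grid point to its opposite. *)
rewrite {1}/S (reindex_inj rev_ord_inj)/= -sumrN; apply: eq_bigr => i _.
rewrite -sinN; congr sin; rewrite -mulNr; congr (_ * _); rewrite /grid_pt.
rewrite -mulNr -mulrN; congr (_ * _ / _); rewrite subSS natrB; last by rewrite -ltnS.
by rewrite -muln2 natrM; ring.
Qed.

Lemma dirichlet0 L : dirichlet L 0 = (grid_size L)%:R.
Proof.
rewrite /dirichlet; under eq_bigr do rewrite mulr0 cos0.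
by rewrite sumr_const card_ord.
Qed.

Lemma dirichlet_le L z : `|dirichlet L z| <= (grid_size L)%:R.
Proof.
rewrite (le_trans (ler_norm_sum _ _ _))//.
rewrite (le_trans (ler_sum _ (fun i _ => cos_max _)))//.
by rewrite sumr_const card_ord.
Qed.

Lemma sin_natpi (n : nat) : sin (n%:R * pi) = 0 :> R.
Proof.
elim: n => [|n IH]; first by rewrite mul0r sin0.
by rewrite -natr1 mulrDl mul1r sinDpi IH oppr0.
Qed.

(** With [h] half the spacing of the angles, [2 * sin h * cos v = sin (v + h) - sin (v - h)]
    telescopes, and both end values are sines of multiples of [pi]. The size condition keeps [h]
    strictly between [0] and [pi], so that [sin h] can be cancelled. *)
Lemma dirichlet_eq0 L (z : int) : z != 0 -> (`|z| < grid_size L)%N -> dirichlet L z = 0.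
Proof.
move=> z0 zM.
have -> : dirichlet L z = \sum_(i < grid_size L) cos (grid_pt L i * `|z|%N%:R).
  rewrite /dirichlet; apply: eq_bigr => i _.
  rewrite natr_absz intr_norm.
  by have [h|h] := lerP 0 (z%:~R : R); [rewrite ger0_norm|rewrite ltr0_norm// mulrN cosN].
set m := `|z|%N in zM *; have m0 : (0 < m)%N by rewrite absz_gt0.
pose h : R := pi * m%:R / (grid_size L)%:R.
have pi0 := @pi_gt0 R.
have sh : 0 < sin h.
  apply: sin_gt0_pi; rewrite /h divr_gt0 ?mulr_gt0 ?ltr0n//=.
  by rewrite ltr_pdivrMr// ltr_pM2l// ltr_nat.
suff : 2 * sin h * (\sum_(i < grid_size L) cos (grid_pt L i * m%:R)) = 0.
  by move/eqP; rewrite mulf_eq0 mulf_eq0 pnatr_eq0 (gt_eqF sh)/= => /eqP.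
pose u (i : nat) := sin ((2 * (i%:R - L%:R) - 1) * h).
transitivity (\sum_(0 <= i < grid_size L) (u i.+1 - u i)).
  rewrite big_mkord mulr_sumr; apply: eq_bigr => i _.
  have iS : i.+1%:R = i%:R + 1 :> R by rewrite natr1.
  rewrite /u iS; set k : R := i%:R - L%:R.
  rewrite (_ : grid_pt L i * m%:R = 2 * k * h); last by rewrite /grid_pt /h -/k; ring.
  rewrite (_ : (2 * (i%:R + 1 - L%:R) - 1) * h = 2 * k * h + h); last by rewrite /k; ring.
  rewrite (_ : (2 * k - 1) * h = 2 * k * h - h); last by ring.
  by rewrite sinD sinB; ring.
rewrite telescope_sumr// /u.
have e1 : (2 * ((grid_size L)%:R - L%:R) - 1) * h = m%:R * pi.
  by rewrite (_ : 2 * ((grid_size L)%:R - L%:R) - 1 = (grid_size L)%:R); [rewrite /h; field; rewrite gt_eqF|rewrite MR; ring].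
have e2 : (2 * (0%:R - L%:R) - 1) * h = - (m%:R * pi).
  rewrite (_ : 2 * (0%:R - L%:R) - 1 = - (grid_size L)%:R); last by rewrite MR; ring.
  by rewrite /h; field; rewrite gt_eqF.
by rewrite e1 e2 sinN sin_natpi oppr0 subr0.
Qed.

Definition grid_mean L (F : R * R -> R) : R :=
  (\sum_(i < grid_size L) \sum_(j < grid_size L) F (grid_pt L i, grid_pt L j)) /
  (grid_size L)%:R ^+ 2.

Lemma grid_mean_cos L (z : int * int) : grid_mean L (fun th => cos (phase th z)) =
  dirichlet L z.1 / (grid_size L)%:R * (dirichlet L z.2 / (grid_size L)%:R).
Proof.
rewrite /grid_mean /phase /=.
transitivity ((dirichlet L z.1 * dirichlet L z.2) / (grid_size L)%:R ^+ 2); last first.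
  by field; rewrite gt_eqF.
congr (_ / _).
transitivity (dirichlet L z.1 * dirichlet L z.2 -
   (\sum_(i < grid_size L) sin (grid_pt L i * z.1%:~R)) *
   (\sum_(j < grid_size L) sin (grid_pt L j * z.2%:~R))); last by rewrite grid_sin0 mul0r subr0.
rewrite /dirichlet !mulr_suml -sumrB; apply: eq_bigr => i _.
by rewrite !mulr_sumr -sumrB; apply: eq_bigr => j _; rewrite cosD.
Qed.

Lemma grid_mean_le L F G : (forall i j : 'I_(grid_size L),
    F (grid_pt L i, grid_pt L j) <= G (grid_pt L i, grid_pt L j)) ->
  grid_mean L F <= grid_mean L G.
Proof.
move=> FG; rewrite /grid_mean ler_pM2r ?invr_gt0 ?exprn_gt0//.
by apply: ler_sum => i _; apply: ler_sum => j _.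
Qed.

Lemma grid_mean_norm L F : `|grid_mean L F| <= grid_mean L (fun th => `|F th|).
Proof.
rewrite /grid_mean normrM normfV (ger0_norm (ltW (exprn_gt0 2 (M0 L)))).
rewrite ler_pM2r ?invr_gt0 ?exprn_gt0// (le_trans (ler_norm_sum _ _ _))//.
by apply: ler_sum => i _; exact: ler_norm_sum.
Qed.

Lemma grid_mean_sum L (I : Type) (s : seq I) (F : I -> R * R -> R) :
  grid_mean L (fun th => \sum_(i <- s) F i th) = \sum_(i <- s) grid_mean L (F i).
Proof.
rewrite /grid_mean -mulr_suml; congr (_ / _).
under eq_bigr do rewrite exchange_big/=.
by rewrite exchange_big.
Qed.

Lemma grid_meanZ L (c : R) F : grid_mean L (fun th => c * F th) = c * grid_mean L F.
Proof.
rewrite /grid_mean mulrA; congr (_ / _); rewrite mulr_sumr; apply: eq_bigr => i _.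
by rewrite mulr_sumr.
Qed.

Lemma grid_meanB L F G : grid_mean L (fun th => F th - G th) = grid_mean L F - grid_mean L G.
Proof.
rewrite /grid_mean -mulrBl; congr (_ / _); rewrite -sumrB; apply: eq_bigr => i _.
by rewrite -sumrB.
Qed.

(** The minimum with [n] and the maximum with [0] are what the induction on [n] carries; the bound
    of interest is [b + 1 - a]. *)
Lemma count_interval n (a b : R) : a <= b + 1 ->
  \sum_(i < n) (if a <= i%:R <= b then 1 else 0 : R) <= Num.max 0 (Num.min n%:R (b + 1) - a).
Proof.
move=> ab; elim: n => [|n IH]; first by rewrite big_ord0 le_max lexx.
rewrite big_ord_recr/=; case: ifP => [/andP[an nb]|_].
  have -> : Num.min n.+1%:R (b + 1) = n%:R + 1 :> R.
    by rewrite -natr1; apply/min_idPl; rewrite lerD2r.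
  have -> : Num.max 0 (n%:R + 1 - a) = n%:R - a + 1 by rewrite max_r; lra.
  rewrite lerD2r; apply: (le_trans IH).
  have -> : Num.min n%:R (b + 1) = n%:R :> R by apply/min_idPl; lra.
  by rewrite max_r// subr_ge0.
rewrite addr0; apply: (le_trans IH); rewrite ge_max le_max lexx/= le_max.
apply/orP; right; rewrite lerD2r le_min ge_min ge_min lexx orbT andbT.
by rewrite ler_nat leqnSn.
Qed.

(** A half-side [r] catches at most [2 * q + 1] points per axis, where
    [q = r * grid_size L / (2 * pi)] is at most [r * grid_size L / 4]; the condition
    [2 <= r * grid_size L] absorbs the [+ 1]. *)
Lemma grid_mean_box L (r1 r2 : R) : 0 < r1 -> 0 < r2 ->
  2 <= r1 * (grid_size L)%:R -> 2 <= r2 * (grid_size L)%:R ->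
  grid_mean L (fun th => if (`|th.1| <= r1) && (`|th.2| <= r2) then 1 else 0) <= r1 * r2.
Proof.
move=> r10 r20 h1 h2; rewrite /grid_mean ler_pdivrMr ?exprn_gt0//=.
pose ct r := \sum_(i < grid_size L) (if `|grid_pt L i| <= r then 1 else 0 : R).
have -> : \sum_(i < grid_size L) \sum_(j < grid_size L)
    (if (`|grid_pt L i| <= r1) && (`|grid_pt L j| <= r2) then 1 else 0) = ct r1 * ct r2.
  rewrite /ct mulr_suml; apply: eq_bigr => i _; rewrite mulr_sumr; apply: eq_bigr => j _.
  by case: (_ <= r1); case: (_ <= r2); rewrite /= ?mulr1 ?mulr0 ?mul0r.
have ct0 r : 0 <= ct r by apply: sumr_ge0 => i _; case: ifP.
have ctr r : 0 < r -> 2 <= r * (grid_size L)%:R -> ct r <= r * (grid_size L)%:R.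
  move=> r0 hr; have pi2 := @pi_ge2 R.
  pose q : R := r * (grid_size L)%:R / (2 * pi).
  have q0 : 0 < q by rewrite divr_gt0 ?mulr_gt0//; lra.
  have q4 : q <= r * (grid_size L)%:R / 4.
    rewrite /q ler_pM2l ?mulr_gt0// lef_pV2 ?posrE//; lra.
  apply: (@le_trans _ _ (\sum_(i < grid_size L) (if L%:R - q <= i%:R <= L%:R + q then 1 else 0 : R))).
    apply: ler_sum => i _; rewrite -ler_distl.
    have -> : (`|i%:R - L%:R| <= q) = (`|grid_pt L i| <= r).
      rewrite /grid_pt normrM normfV (ger0_norm (ltW (M0 L))) ler_pdivrMr// normrM ger0_norm; last by lra.
      by rewrite -ler_pdivlMl ?mulr_gt0 ?pi_gt0// mulrC.
    by [].
  apply: (le_trans (count_interval _ _)); first by lra.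
  rewrite ge_max; apply/andP; split; first by lra.
  apply: (@le_trans _ _ (L%:R + q + 1 - (L%:R - q))).
    by rewrite lerD2r ge_min lexx orbT.
  by lra.
rewrite (_ : r1 * r2 * _ = (r1 * (grid_size L)%:R) * (r2 * (grid_size L)%:R)); last by ring.
by apply: ler_pM => //; exact: ctr.
Qed.

End Dirichlet.

Section Dyadic_series.
Context {R : realType}.

(** In the application [8 ^+ i] is the weight [2 ^+ i] times the box area [4 ^+ i]. The exponent
    [2 ^ i - 1] makes the term [i = 0] equal to 1, as the innermost box requires, where only
    [chf <= 1] is used. *)
Lemma dyadic_series (rho : R) : 0 <= rho < 1 -> exists2 C : R, 0 < C &
  forall N, \sum_(0 <= i < N) 8 ^+ i * rho ^+ (2 ^ i - 1) <= C.
Proof.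
move=> /andP[r0 r1]; pose s i : R := 8 ^+ i * rho ^+ (2 ^ i - 1).
have s0 i : 0 <= s i by rewrite mulr_ge0// exprn_ge0.
have [i0 i0P] : exists i0, forall i, (i0 <= i)%N -> s i.+1 <= s i / 2.
  have rn : `|rho| < 1 by rewrite ger0_norm.
  have e0 : 0 < 16^-1 :> R by rewrite invr_gt0.
  have [k _ kP] := cvgr_lt 0 (cvg_expr rn) _ e0.
  exists k => i ki.
  have h : rho ^+ (2 ^ i) <= 16^-1.
    by apply/ltW/kP; apply: (leq_trans ki); rewrite ltnW// ltn_expl.
  have -> : s i.+1 = s i * (8 * rho ^+ (2 ^ i)).
    rewrite /s exprS (_ : (2 ^ i.+1 - 1 = (2 ^ i - 1) + 2 ^ i)%N) ?exprD; first by ring.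
    by rewrite expnS; have := expn_gt0 2 i; lia.
  by rewrite ler_wpM2l//; lra.
pose S N := \sum_(0 <= i < N) s i.
have SS N : S N.+1 = S N + s N by rewrite /S big_nat_recr.
have mono N k : S N <= S (N + k)%N.
  elim: k => [|k IH]; first by rewrite addn0.
  by rewrite addnS SS (le_trans IH)// lerDl.
(* Once terms halve, the partial sum plus twice the next term cannot increase. *)
have bound k : S (i0 + k)%N + 2 * s (i0 + k)%N <= S i0 + 2 * s i0.
  elim: k => [|k IH]; first by rewrite addn0.
  apply: le_trans IH; rewrite addnS SS.
  by have := i0P (i0 + k)%N (leq_addr _ _); lra.
exists (S i0 + 2 * s i0 + 1).
  have : 0 <= S i0 by apply: sumr_ge0.
  by have := s0 i0; lra.
move=> N; apply: (le_trans (mono N i0)); rewrite addnC.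
by have := bound N; have := s0 (i0 + N)%N; lra.
Qed.

End Dyadic_series.

Section Inversion.
Context {R : realType} {d : measure_display} {Omega : measurableType d}.
Variable P : probability Omega R.
Variable X : nat -> Omega -> int * int.
Hypothesis Xiid : iid_steps P X.

Local Notation chf := (chf P X).

Lemma Rintegral_sum (I : Type) (s : seq I) (f : I -> Omega -> R) :
  (forall i, P.-integrable setT (EFin \o f i)) ->
  P.-integrable setT (EFin \o (fun w => \sum_(i <- s) f i w)) /\
  \int[P]_w (\sum_(i <- s) f i w) = \sum_(i <- s) \int[P]_w f i w.
Proof.
move=> fi; elim: s => [|i s [IH1 IH2]].
  rewrite big_nil; under eq_fun do rewrite big_nil.
  split; first exact: finite_measure_integrable_cst.
  exact: Rintegral_probability_cst.
under eq_fun do rewrite big_cons; split.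
  by have := integrableD measurableT (fi i) IH1.
by rewrite RintegralD// IH2 big_cons.
Qed.

Lemma Ecos_walk_shift n x th : \int[P]_w cos (phase th (walk X n w - x)) =
  ccos P X n th * cos (phase th x) + csin P X n th * sin (phase th x).
Proof.
under eq_Rintegral do rewrite phaseB cosB.
rewrite [ccos P X n th * _]mulrC [csin P X n th * _]mulrC -(Ecos_shift Xiid).
by apply: eq_Rintegral => w _; rewrite [_ * cos (phase th x)]mulrC [_ * sin (phase th x)]mulrC.
Qed.

Lemma grid_mean_walk L n x :
  \int[P]_w grid_mean L (fun th => cos (phase th (walk X n w - x))) =
  grid_mean L (fun th => ccos P X n th * cos (phase th x) + csin P X n th * sin (phase th x)).
Proof.
rewrite /grid_mean.
have ic th : P.-integrable setT (EFin \o (fun w => cos (phase th (walk X n w - x)))).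
  by apply: (integrable_walk Xiid n (f := fun z => cos (phase th (z - x))) (M := 1)) => z; exact: cos_max.
have isum i := @Rintegral_sum _ (index_enum 'I_(grid_size L))
  (fun j w => cos (phase (grid_pt L i, grid_pt L j) (walk X n w - x))) (fun j => ic _).
have [ii iE] := @Rintegral_sum _ (index_enum 'I_(grid_size L))
  (fun i w => \sum_(j < grid_size L) cos (phase (grid_pt L i, grid_pt L j) (walk X n w - x)))
  (fun i : 'I_(grid_size L) => (isum i).1).
rewrite RintegralZr// iE; congr (_ / _); apply: eq_bigr => i _.
by rewrite (isum i).2; apply: eq_bigr => j _; rewrite Ecos_walk_shift.
Qed.

(** The kernel is 1 at [0], vanishes at every other [z] of norm below [grid_size L], and is at most
    1 in absolute value elsewhere. *)
Lemma grid_kernel_indic L (z : int * int) :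
  `| \1_[set (0 : int * int)] z - grid_mean L (fun th => cos (phase th z)) : R | <=
  \1_[set y | (grid_size L <= norm1 y)%N] z.
Proof.
have M0 : 0 < (grid_size L)%:R :> R by rewrite ltr0n.
have h1 k : `|dirichlet L k / (grid_size L)%:R : R| <= 1.
  by rewrite normrM normfV (ger0_norm (ltW M0)) ler_pdivrMr// mul1r dirichlet_le.
rewrite grid_mean_cos !indicE; case: (leqP (grid_size L) (norm1 z)) => zL.
  rewrite [in leRHS]mem_set//=; have [->|z0] := eqVneq z 0.
    rewrite mem_set//= dirichlet0 divff ?gt_eqF// mulr1 subrr normr0//.
  rewrite memNset/=; last by move=> /= zz; rewrite zz eqxx in z0.
  by rewrite sub0r normrN normrM mulr_ile1.
rewrite [in leRHS]memNset/=; last by move=> /=; rewrite leqNgt zL.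
have [->|z0] := eqVneq z 0.
  rewrite mem_set//= dirichlet0 divff ?gt_eqF// mulr1 subrr normr0//.
rewrite memNset/=; last by move=> /= zz; rewrite zz eqxx in z0.
move: zL z0; rewrite /norm1; case: z => z1 z2 /= zL z0.
have [z10|z10] := eqVneq z1 0; last first.
  rewrite (dirichlet_eq0 z10) ?mul0r ?subr0 ?normr0//.
  by apply: leq_ltn_trans zL; rewrite leq_addr.
have z20 : z2 != 0 by apply: contra z0 => /eqP ->; rewrite z10.
rewrite (dirichlet_eq0 z20) ?mul0r ?mulr0 ?subr0 ?normr0//.
by apply: leq_ltn_trans zL; rewrite leq_addl.
Qed.

(** The error is at most the probability that the walk is far from [x]. The dependence of [L0] on
    [n] and [x] is harmless: the grid means are later bounded for all large [L] at once. *)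
Lemma pmf_grid_approx n x (e : R) : 0 < e -> exists L0, forall L, (L0 <= L)%N ->
  `| pmf_walk P X n x - grid_mean L (fun th => ccos P X n th * cos (phase th x) +
     csin P X n th * sin (phase th x)) | <= e.
Proof.
move=> e0.
have mV : discrete_rv (fun w => walk X n w - x).
  exact: (discrete_rv_comp (fun z => z - x) (discrete_walk Xiid n)).
have [k kP] := tail_vanishes P mV e0.
exists k => L kL; rewrite -grid_mean_walk.
have -> : pmf_walk P X n x = \int[P]_w \1_[set (0 : int * int)] (walk X n w - x).
  rewrite -[LHS]/(prob_walk P X n [set x]) (prob_walk_indic Xiid); apply: eq_Rintegral => w _.
  rewrite !indicE; congr (_%:R); congr nat_of_bool.
  apply/idP/idP; rewrite !inE /=; first by move=> ->; rewrite subrr.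
  by move=> /subr0_eq.
have i1 : P.-integrable setT (EFin \o (fun w => \1_[set (0 : int * int)] (walk X n w - x) : R)).
  apply: (integrable_walk Xiid n (f := fun z => \1_[set (0 : int * int)] (z - x)) (M := 1)) => z.
  exact: bounded_indic.
pose K (z : int * int) : R := grid_mean L (fun th => cos (phase th (z - x))).
have M0 : 0 < (grid_size L)%:R :> R by rewrite ltr0n.
have K1 : bounded_by K 1.
  move=> z; rewrite /K grid_mean_cos normrM mulr_ile1//.
    by rewrite normrM normfV (ger0_norm (ltW M0)) ler_pdivrMr// mul1r dirichlet_le.
  by rewrite normrM normfV (ger0_norm (ltW M0)) ler_pdivrMr// mul1r dirichlet_le.
have i2 : P.-integrable setT (EFin \o (fun w => K (walk X n w))) by exact: integrable_walk K1.
rewrite -RintegralB//.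
have i3 : P.-integrable setT (EFin \o (fun w => \1_[set (0 : int * int)] (walk X n w - x) - K (walk X n w))).
  by have := integrableB measurableT i1 i2.
apply: (le_trans (le_normr_Rintegral measurableT i3)).
apply: (@le_trans _ _ (\int[P]_w \1_[set z | (k < norm1 z)%N] (walk X n w - x))).
  apply: le_Rintegral => //.
  - by have := integrable_abse i3.
  - apply: (integrable_walk Xiid n (f := fun z => \1_[set z | (k < norm1 z)%N] (z - x)) (M := 1)) => z.
    exact: bounded_indic.
  move=> w _; apply: (le_trans (grid_kernel_indic L _)).
  rewrite !indicE ler_nat; case: (boolP (_ \in [set y | (_ <= norm1 y)%N])) => //.
  rewrite inE/= => h; rewrite mem_set//=; apply: leq_trans h.
  by rewrite /grid_size ltnS (leq_trans kL)// -addnn leq_addr.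
rewrite /Rintegral (integral_preimage P _ mV) -lee_fin fineK//.
by apply: fin_num_measure; exact: mV.
Qed.

Lemma pmf_le_grid n x (B : R) L0 :
  (forall L, (L0 <= L)%N -> grid_mean L (chf n) <= B) -> pmf_walk P X n x <= B.
Proof.
move=> HB; apply/ler_addgt0Pr => e e0.
have [L1 H] := pmf_grid_approx n x e0.
have := H (maxn L0 L1) (leq_maxr _ _); have := HB (maxn L0 L1) (leq_maxl _ _).
set L := maxn L0 L1 => h1 h2.
have h3 : grid_mean L (fun th => ccos P X n th * cos (phase th x) +
     csin P X n th * sin (phase th x)) <= grid_mean L (chf n).
  apply: grid_mean_le => i j; set th := (_, _).
  rewrite -(ger0_norm (chf_ge0 P X n th)); apply: ler_normlW.
  rewrite -ler_sqr ?nnegrE// real_normK ?num_real// real_normK ?num_real// chf_sqr.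
  have xy := cos2Dsin2 (phase th x); rewrite -[leRHS]mulr1 -xy -subr_ge0.
  rewrite (_ : _ - _ = (ccos P X n th * sin (phase th x) - csin P X n th * cos (phase th x)) ^+ 2) ?sqr_ge0//.
  by ring.
by move: h2; rewrite ler_distl => /andP[_]; lra.
Qed.

Lemma pmf_dist_grid n x y (B : R) L0 :
  (forall L, (L0 <= L)%N ->
     grid_mean L (fun th => chf n th * `|phase th (x - y)|) <= B) ->
  `|pmf_walk P X n x - pmf_walk P X n y| <= 2 * B.
Proof.
move=> HB; apply/ler_addgt0Pr => e e0.
have e20 : 0 < e / 2 by rewrite divr_gt0.
have [L1 H1] := pmf_grid_approx n x e20.
have [L2 H2] := pmf_grid_approx n y e20.
pose L := maxn L0 (maxn L1 L2).
have l0 : (L0 <= L)%N by rewrite leq_maxl.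
have l1 : (L1 <= L)%N by rewrite /L !leq_max leqnn orbT.
have l2 : (L2 <= L)%N by rewrite /L !leq_max leqnn !orbT.
have := H1 L l1; have := H2 L l2; have := HB L l0.
set U := grid_mean L (fun th => ccos P X n th * cos (phase th x) + _).
set V := grid_mean L (fun th => ccos P X n th * cos (phase th y) + _).
set W := grid_mean L (fun th => chf n th * _) => hW hV hU.
have h3 : `|U - V| <= 2 * W.
  rewrite /U /V -grid_meanB (le_trans (grid_mean_norm _ _))// -grid_meanZ.
  apply: grid_mean_le => i j; set th := (_, _) : R * R.
  rewrite (_ : _ - _ = ccos P X n th * (cos (phase th x) - cos (phase th y)) +
    csin P X n th * (sin (phase th x) - sin (phase th y))); last by ring.
  rewrite (le_trans (ler_normD _ _))// !normrM mulr_natl mulr2n phaseB.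
  by apply: lerD; apply: ler_pM; rewrite ?ccos_le_chf ?csin_le_chf ?cos_lipschitz ?sin_lipschitz.
rewrite (_ : pmf_walk P X n x - pmf_walk P X n y =
  (pmf_walk P X n x - U) + (U - V) + (V - pmf_walk P X n y)); last by ring.
rewrite (le_trans (ler_normD _ _))// (le_trans (lerD (ler_normD _ _) (lexx _)))//.
by rewrite (distrC V); lra.
Qed.

End Inversion.

(** * Uniform and Lipschitz bounds for the point probabilities *)

Section Dyadic_boxes.
Context {R : realType} {d : measure_display} {Omega : measurableType d}.
Variable P : probability Omega R.
Variable X : nat -> Omega -> int * int.
Hypothesis Xiid : iid_steps P X.

Local Notation chf := (chf P X).

Variables (rho kappa C : R).
Hypothesis rho01 : 0 <= rho < 1.
Hypothesis kappa1 : 1 <= kappa.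
Hypothesis series_le : forall N, \sum_(0 <= i < N) 8 ^+ i * rho ^+ (2 ^ i - 1) <= C.

(** The first [2 ^ J = 2 ^ j * 2 ^ (J - j)] steps consist of [2 ^ (J - j)] stretches, each
    contributing one factor [rho]. *)
Lemma chf_dyadic (n J j : nat) th : (2 ^ J <= n)%N -> (j < J)%N ->
  chf 1 th ^+ (2 ^ j) <= rho -> chf n th <= rho ^+ (2 ^ (J - j) - 1).
Proof.
move=> Jn jJ h; have /andP[r0 r1] := rho01.
have c0 := chf_ge0 P X 1 th; have c1 := chf_le1 Xiid 1 th.
rewrite (chfX Xiid); apply: (@le_trans _ _ (chf 1 th ^+ (2 ^ j * 2 ^ (J - j)))).
  by apply: ler_wiXn2l => //; rewrite -expnD subnKC// ltnW.
rewrite exprM; apply: (@le_trans _ _ (rho ^+ (2 ^ (J - j)))).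
  by rewrite lerXn2r// ?nnegrE// exprn_ge0.
by apply: ler_wiXn2l => //; [exact: ltW|exact: leq_subr].
Qed.

(* Every grid point lies in the innermost box [j = J] or in some shell
   between boxes [j] and [j + 1], where the decay of [chf n] beats the growth
   of the boxes. *)
Lemma grid_dyadic_bound (n j0 J : nat) (r1 r2 : nat -> R) (A1 A2 : R) :
  (2 ^ J <= n)%N -> (j0 <= J)%N -> 0 < A1 -> 0 < A2 ->
  (forall j, (j0 <= j <= J)%N -> 0 < r1 j /\ r1 j <= kappa * 2 ^+ (J - j) / A1) ->
  (forall j, (j0 <= j <= J)%N -> 0 < r2 j /\ r2 j <= kappa * 2 ^+ (J - j) / A2) ->
  (forall th : R * R, `|th.1| <= pi -> `|th.2| <= pi ->
     (`|th.1| <= r1 J /\ `|th.2| <= r2 J) \/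
     exists j, [/\ (j0 <= j < J)%N, `|th.1| <= r1 j, `|th.2| <= r2 j &
       chf 1 th ^+ (2 ^ j) <= rho]) ->
  exists L0, forall L, (L0 <= L)%N ->
    grid_mean L (fun th => chf n th * (1 + A1 * `|th.1| + A2 * `|th.2|)) <=
    3 * kappa ^+ 3 * C / (A1 * A2).
Proof.
move=> Jn j0J A10 A20 hr1 hr2 cover.
have /andP[rho0 rho1] := rho01.
(* [L] has to be large enough for [grid_mean_box] on every box at once. The absolute values keep the
   terms nonnegative at indices below [j0], where nothing is known of the radii. *)
pose tot : R := \sum_(0 <= j < J.+1) (2 / `|r1 j| + 2 / `|r2 j|).
exists (Num.bound tot) => L LL.
have totM : tot <= (grid_size L)%:R.
  apply: (le_trans (ler_norm _)); apply: (le_trans (ltW (archi_boundP (normr_ge0 _)))).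
  have t0 : 0 <= tot by apply: sumr_ge0 => j _; rewrite addr_ge0// divr_ge0.
  rewrite ger0_norm// ler_nat (leq_trans LL)// /grid_size -addnn -addnS leq_addr//.
have termM j : (j <= J)%N -> 2 / `|r1 j| + 2 / `|r2 j| <= (grid_size L)%:R.
  move=> jJ; apply: le_trans totM; rewrite /tot big_mkord.
  have jS : (j < J.+1)%N by rewrite ltnS.
  rewrite (bigD1 (Ordinal jS))//= lerDl; apply: sumr_ge0 => i _.
  by rewrite addr_ge0// divr_ge0.
have sizes j : (j0 <= j <= J)%N -> 2 <= r1 j * (grid_size L)%:R /\ 2 <= r2 j * (grid_size L)%:R.
  move=> jj; have /andP[_ jJ] := jj.
  have [p1 _] := hr1 j jj; have [p2 _] := hr2 j jj.
  have := termM j jJ; rewrite !gtr0_norm// => h.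
  have q1 : 0 < 2 / r1 j by rewrite divr_gt0.
  have q2 : 0 < 2 / r2 j by rewrite divr_gt0.
  by split; rewrite mulrC -ler_pdivrMr//; lra.
pose N := (J - j0).+1.
pose B i (th : R * R) : R := if (`|th.1| <= r1 (J - i)%N) && (`|th.2| <= r2 (J - i)%N) then 1 else 0.
(* The index [i = J - j] counts outward from the innermost box; [3 * kappa * 2 ^+ i] bounds the
   weight on the box and the power of [rho] bounds [chf n] on the shell. *)
pose w i : R := 3 * kappa * 2 ^+ i * rho ^+ (2 ^ i - 1).
have k3 : 0 <= 3 * kappa by rewrite mulr_ge0// (le_trans ler01).
have w0 i : 0 <= w i.
  by rewrite /w; apply: mulr_ge0; [apply: mulr_ge0 => //; exact: exprn_ge0|exact: exprn_ge0].
apply: (@le_trans _ _ (grid_mean L (fun th => \sum_(0 <= i < N) w i * B i th))).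
  apply: grid_mean_le => i1 i2; set th := (_, _).
  have t1 : `|th.1| <= pi by exact: grid_pt_pi.
  have t2 : `|th.2| <= pi by exact: grid_pt_pi.
  have single i : (i < N)%N -> chf n th * (1 + A1 * `|th.1| + A2 * `|th.2|) <= w i * B i th ->
     chf n th * (1 + A1 * `|th.1| + A2 * `|th.2|) <= \sum_(0 <= k < N) w k * B k th.
    move=> iN h; apply: (le_trans h); rewrite big_mkord (bigD1 (Ordinal iN))//= lerDl.
    by apply: sumr_ge0 => k _; rewrite mulr_ge0// /B; case: ifP.
  have weight j : (j0 <= j <= J)%N -> `|th.1| <= r1 j -> `|th.2| <= r2 j ->
     1 + A1 * `|th.1| + A2 * `|th.2| <= 3 * kappa * 2 ^+ (J - j).
    move=> jj h1 h2; have [_ p1] := hr1 j jj; have [_ p2] := hr2 j jj.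
    have q1 : A1 * `|th.1| <= kappa * 2 ^+ (J - j).
      by rewrite mulrC -ler_pdivlMr// (le_trans h1).
    have q2 : A2 * `|th.2| <= kappa * 2 ^+ (J - j).
      by rewrite mulrC -ler_pdivlMr// (le_trans h2).
    have q3 : 1 <= kappa * 2 ^+ (J - j) by apply: mulr_ege1 => //; rewrite exprn_ege1// ler1n.
    by rewrite -mulrA; lra.
  have W0 : 0 <= 1 + A1 * `|th.1| + A2 * `|th.2|.
    by rewrite !addr_ge0// mulr_ge0// ltW.
  have [[h1 h2]|[j [/andP[j0j jJ] h1 h2 h3]]] := cover th t1 t2.
    apply: (single 0%N) => //; rewrite /B subn0 h1 h2 /= mulr1 /w !expr0 !mulr1.
    have := weight J; rewrite j0J leqnn subnn expr0 mulr1 => /(_ isT h1 h2) hw.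
    by apply: le_trans hw; rewrite ler_piMl// chf_le1.
  apply: (single (J - j)%N); first by rewrite /N ltnS leq_sub2l.
  rewrite /B subKn ?(ltnW jJ)// h1 h2 /= mulr1 /w mulrC.
  apply: ler_pM; rewrite ?chf_ge0//; last exact: chf_dyadic.
  by apply: weight => //; rewrite j0j ltnW.
rewrite grid_mean_sum.
apply: (@le_trans _ _ (\sum_(0 <= i < N) w i * (kappa ^+ 2 * 4 ^+ i / (A1 * A2)))).
  rewrite big_seq [leRHS]big_seq; apply: ler_sum => i; rewrite mem_index_iota /= /N ltnS => iJ.
  rewrite grid_meanZ ler_wpM2l//.
  have iJ' : (i <= J)%N := leq_trans iJ (leq_subr _ _).
  have jj : (j0 <= J - i <= J)%N by rewrite leq_subr andbT leq_subRL// addnC -leq_subRL.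
  have [p1 q1] := hr1 _ jj; have [p2 q2] := hr2 _ jj; have [s1 s2] := sizes _ jj.
  apply: (le_trans (grid_mean_box p1 p2 s1 s2)).
  move: q1 q2; rewrite subKn// => q1 q2.
  apply: (@le_trans _ _ ((kappa * 2 ^+ i / A1) * (kappa * 2 ^+ i / A2))).
    by apply: ler_pM => //; exact: ltW.
  rewrite le_eqVlt; apply/orP; left; apply/eqP.
  rewrite (_ : 4 = 2 * 2 :> R) ?exprMn; last by rewrite -natrM.
  by field; rewrite !gt_eqF.
apply: (@le_trans _ _ (3 * kappa ^+ 3 / (A1 * A2) * \sum_(0 <= i < N) 8 ^+ i * rho ^+ (2 ^ i - 1))).
  rewrite mulr_sumr; apply: ler_sum => i _.
  rewrite le_eqVlt; apply/orP; left; apply/eqP; rewrite /w.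
  rewrite (_ : 8 = 2 * 4 :> R) ?exprMn; last by rewrite -natrM.
  by field; rewrite !gt_eqF.
have k0 : 0 < kappa := lt_le_trans ltr01 kappa1.
rewrite (_ : 3 * kappa ^+ 3 * C / (A1 * A2) = 3 * kappa ^+ 3 / (A1 * A2) * C); last by ring.
apply: ler_wpM2l; last exact: series_le.
by rewrite divr_ge0 ?mulr_ge0 ?exprn_ge0// ltW// mulr_gt0.
Qed.

End Dyadic_boxes.

Section Local_bounds.
Context {R : realType} {d : measure_display} {Omega : measurableType d}.
Variable P : probability Omega R.
Variable X : nat -> Omega -> int * int.
Hypothesis Xiid : iid_steps P X.
Hypothesis Xaper : aperiodic P X.

Local Notation chf := (chf P X).

(* Locally uniform regular variation of index 1/2. *)
Definition half_regular (a : R -> R) := forall K e : R, 1 <= K -> 0 < e ->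
  exists2 T : R, 0 < T & forall t s, T <= t -> t <= s -> s <= K * t ->
  (1 - e) * (s / t) <= (a s / a t) ^+ 2 <= (1 + e) * (s / t).

Lemma half_regular_le (a : R -> R) K : half_regular a -> (forall t, 0 < t -> 0 < a t) -> 1 <= K ->
  exists2 T : R, 0 < T & forall t s, T <= t -> t <= s -> s <= K * t ->
  a s <= 2 * K * a t /\ a t <= 2 * a s.
Proof.
move=> ra a0 K1; have h2 : 0 < 2^-1 :> R by rewrite invr_gt0.
have [T T0 TP] := ra K 2^-1 K1 h2; exists T => // t s Tt ts sK.
have t0 : 0 < t by apply: lt_le_trans Tt.
have s0 : 0 < s by apply: lt_le_trans ts.
have at0 := a0 t t0; have as0 := a0 s s0.
have /andP[l u] := TP t s Tt ts sK.
have st1 : 1 <= s / t by rewrite ler_pdivlMr// mul1r.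
have stK : s / t <= K by rewrite ler_pdivrMr.
have q0 : 0 < a s / a t by rewrite divr_gt0.
split.
  rewrite -ler_pdivrMr//; have K0 : 0 <= 2 * K by lra.
  rewrite -ler_sqr ?nnegrE// ?(ltW q0)//; apply: (le_trans u).
  rewrite exprMn; have : K <= K ^+ 2 by rewrite expr2 ler_peMr//; lra.
  by lra.
have : 2^-1 <= a s / a t.
  rewrite -ler_sqr ?nnegrE// ?(ltW q0)//; apply: le_trans l.
  by rewrite expr2; lra.
by rewrite ler_pdivlMr//; lra.
Qed.

(** The true growth is by the square root of 2. The factor 2 matches the [2^-1] of the annulus
    hypothesis: a frequency outside the box at [2 ^ j.+1] has a scaled coordinate of size at least
    1/2 at time [2 ^ j]. *)
Lemma half_regular_double (a : R -> R) : half_regular a -> (forall t, 0 < t -> 0 < a t) ->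
  exists2 T : R, 0 < T & forall t s, T <= t -> t <= s -> s <= 2 * t -> a s <= 2 * a t.
Proof.
move=> ra a0; have h2 : 0 < 2^-1 :> R by rewrite invr_gt0.
have [|T T0 TP] := ra 2 2^-1 _ h2; first by rewrite ler1n.
exists T => // t s Tt ts sK.
have t0 : 0 < t by apply: lt_le_trans Tt.
have s0 : 0 < s by apply: lt_le_trans ts.
have at0 := a0 t t0; have as0 := a0 s s0.
have /andP[l u] := TP t s Tt ts sK.
have stK : s / t <= 2 by rewrite ler_pdivrMr.
have q0 : 0 < a s / a t by rewrite divr_gt0.
rewrite -ler_pdivrMr// -ler_sqr ?nnegrE// ?(ltW q0)//; apply: (le_trans u).
by rewrite expr2; lra.
Qed.

Variables (a1 a2 : R -> R).
Hypothesis a1_gt0 : forall t : R, 0 < t -> 0 < a1 t.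
Hypothesis a2_gt0 : forall t : R, 0 < t -> 0 < a2 t.
Hypothesis ra1 : half_regular a1.
Hypothesis ra2 : half_regular a2.
Hypothesis annulus : exists2 rho : R, 0 <= rho < 1 &
  exists2 n0 : nat, (0 < n0)%N & forall n th, (n0 <= n)%N ->
    let t1 := a1 n%:R * th.1 in let t2 := a2 n%:R * th.2 in
    `|t1| <= 1 -> `|t2| <= 1 -> (2^-1 <= `|t1|) || (2^-1 <= `|t2|) ->
    chf n th <= rho.

Let p2 j : R := (2 ^ j)%:R.

Let p2_gt0 j : 0 < p2 j. Proof. by rewrite ltr0n expn_gt0. Qed.

Let p2S j : p2 j.+1 = 2 * p2 j.
Proof. by rewrite /p2 expnS natrM. Qed.

Lemma dyadic_growth (a : R -> R) j0 : (forall t, 0 < t -> 0 < a t) ->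
  (forall j, (j0 <= j)%N -> a (p2 j.+1) <= 2 * a (p2 j)) ->
  forall j J, (j0 <= j <= J)%N -> a (p2 J) <= 2 ^+ (J - j) * a (p2 j).
Proof.
move=> a0 H j J /andP[j0j jJ]; rewrite -{1}(subnKC jJ).
elim: (J - j)%N => [|k IH]; first by rewrite addn0 expr0 mul1r.
rewrite addnS; apply: (le_trans (H _ (leq_trans j0j (leq_addr _ _)))).
by rewrite exprS -mulrA ler_pM2l.
Qed.

(** The origin of the weight in [grid_dyadic_bound]: its constant term serves the uniform bound, its
    linear terms absorb the phase in the Lipschitz bound. *)
Lemma phase_weight (th : R * R) (z : int * int) (b1 b2 : R) : 0 < b1 -> 0 < b2 ->
  `|phase th z| <= (`|z.1%:~R| / b1 + `|z.2%:~R| / b2) * (1 + b1 * `|th.1| + b2 * `|th.2|).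
Proof.
move=> b10 b20; rewrite /phase (le_trans (ler_normD _ _))// !normrM.
have e1 : `|th.1| * `|z.1%:~R| = `|z.1%:~R| / b1 * (b1 * `|th.1|).
  by field; rewrite gt_eqF.
have e2 : `|th.2| * `|z.2%:~R| = `|z.2%:~R| / b2 * (b2 * `|th.2|).
  by field; rewrite gt_eqF.
rewrite e1 e2.
have u0 : 0 <= `|z.1%:~R| / b1 by rewrite divr_ge0// ltW.
have v0 : 0 <= `|z.2%:~R| / b2 by rewrite divr_ge0// ltW.
have s0 : 0 <= b1 * `|th.1| by rewrite mulr_ge0// ltW.
have t0 : 0 <= b2 * `|th.2| by rewrite mulr_ge0// ltW.
move: u0 v0 s0 t0; move: (_ / b1) (_ / b2) (_ * `|th.1|) (_ * `|th.2|) => u v s t *.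
rewrite -subr_ge0 (_ : _ - _ = u + v + u * t + v * s); last by ring.
by rewrite !addr_ge0// mulr_ge0.
Qed.

Lemma local_bounds : exists2 C : R, 0 < C & exists n0 : nat, forall n, (n0 <= n)%N ->
  (forall x, pmf_walk P X n x <= C / (a1 n%:R * a2 n%:R)) /\
  (forall x y, `|pmf_walk P X n x - pmf_walk P X n y| <=
     C / (a1 n%:R * a2 n%:R) *
     (`|(x - y).1%:~R| / a1 n%:R + `|(x - y).2%:~R| / a2 n%:R)).
Proof.
have [rq /andP[rq0 rq1] [nq nq0 annP]] := annulus.
have [T1 T10 D1] := half_regular_double ra1 a1_gt0.
have [T2 T20 D2] := half_regular_double ra2 a2_gt0.
have [j1 j1P] := pow2_unbounded (Num.max T1 T2).
pose j0 := maxn nq j1.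
have big j : (j0 <= j)%N -> T1 <= p2 j /\ T2 <= p2 j.
  move=> jj; have : Num.max T1 T2 <= p2 j.
    apply: (le_trans j1P); rewrite /p2 natrX ler_eXn2l ?ltr1n//.
    by rewrite (leq_trans _ jj)// leq_maxr.
  by rewrite ge_max => /andP.
have G1 j : (j0 <= j)%N -> a1 (p2 j.+1) <= 2 * a1 (p2 j).
  move=> /big[h1 h2]; apply: D1 => //; rewrite p2S//.
  by rewrite ler_peMl ?ler1n// ltW.
have G2 j : (j0 <= j)%N -> a2 (p2 j.+1) <= 2 * a2 (p2 j).
  move=> /big[h1 h2]; apply: D2 => //; rewrite p2S//.
  by rewrite ler_peMl ?ler1n// ltW.
have A1 j : 0 < a1 (p2 j) by exact: a1_gt0.
have A2 j : 0 < a2 (p2 j) by exact: a2_gt0.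
(* On the outermost shell, at a fixed distance from [0], the contraction comes from aperiodicity;
   its power [2 ^ j0] is the time assigned to the shell [j0]. *)
have [r0 /andP[r00 r01] away] := chf_away_from_0 Xiid Xaper
  (r1 := (a1 (p2 j0.+1))^-1) (r2 := (a2 (p2 j0.+1))^-1)
  (ltac:(by rewrite invr_gt0)) (ltac:(by rewrite invr_gt0)).
pose rho := Num.max rq (r0 ^+ (2 ^ j0)).
have rho01 : 0 <= rho < 1.
  rewrite le_max rq0 /= gt_max rq1 /=.
  by rewrite exprn_ilt1// ?expn_eq0.
have [C C0 CP] := dyadic_series rho01.
pose kappa := Num.max 1 (Num.max (4 * a1 (p2 j0)) (4 * a2 (p2 j0))).
have kappa1 : 1 <= kappa by rewrite le_max lexx.
have kappaA : 4 * a1 (p2 j0) <= kappa by rewrite !le_max lexx orbT.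
have kappaB : 4 * a2 (p2 j0) <= kappa by rewrite !le_max lexx !orbT.
have k0 : 0 < kappa := lt_le_trans ltr01 kappa1.
(* The outermost box has half-side 4, larger than [pi], and so contains the whole grid; [kappa] is
   taken large enough for it to obey the same bound as the other boxes. *)
pose r1 j : R := if (j <= j0)%N then 4 else (a1 (p2 j))^-1.
pose r2 j : R := if (j <= j0)%N then 4 else (a2 (p2 j))^-1.
have radius (a : R -> R) J j : (forall t, 0 < t -> 0 < a t) ->
    (forall j, (j0 <= j)%N -> a (p2 j.+1) <= 2 * a (p2 j)) ->
    4 * a (p2 j0) <= kappa -> (j0 <= j <= J)%N ->
    let r := if (j <= j0)%N then 4 else (a (p2 j))^-1 in
    0 < r /\ r <= kappa * 2 ^+ (J - j) / a (p2 J).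
  move=> a0 G ka jj; have /andP[j0j jJ] := jj; rewrite /=; case: ifP => jj0.
    have -> : j = j0 by apply/eqP; rewrite eqn_leq jj0.
    split => //; rewrite ler_pdivlMr ?a0//.
    have j0J : (j0 <= j0 <= J)%N by rewrite leqnn (leq_trans j0j).
    have h := dyadic_growth a0 G j0J.
    apply: (@le_trans _ _ (4 * (2 ^+ (J - j0) * a (p2 j0)))); first by rewrite ler_pM2l.
    by rewrite mulrCA mulrC ler_wpM2r// exprn_ge0.
  split; first by rewrite invr_gt0 a0.
  rewrite ler_pdivlMr ?a0// ler_pdivrMl ?a0// mulrC -mulrA.
  have h := dyadic_growth a0 G jj.
  by apply: (le_trans h); rewrite ler_peMl// mulr_ge0 ?exprn_ge0// ltW// a0.
(* 48 is 3 from [grid_dyadic_bound], times 4 for replacing [2 ^ J] by [n] in both scales, times 4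
   for the Lipschitz bound: 2 from [pmf_dist_grid] and 2 from one more change of scale. *)
exists (48 * kappa ^+ 3 * C); first by rewrite !mulr_gt0// exprn_gt0.
exists (2 ^ j0.+1)%N => n n_big.
pose J := trunc_log 2 n.
have n_gt0 : (0 < n)%N by rewrite (leq_trans _ n_big)// expn_gt0.
have /andP[Jn nJ] : (2 ^ J <= n < 2 ^ J.+1)%N by exact: trunc_log_bounds.
have jJ : (j0 < J)%N by rewrite -(@trunc_expnK 2 j0.+1)// leq_trunc_log.
have j0J := ltnW jJ.
have cover (th : R * R) : `|th.1| <= pi -> `|th.2| <= pi ->
     (`|th.1| <= r1 J /\ `|th.2| <= r2 J) \/
     exists j, [/\ (j0 <= j < J)%N, `|th.1| <= r1 j, `|th.2| <= r2 j &
       chf 1 th ^+ (2 ^ j) <= rho].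
  move=> t1 t2.
  have pi4 : pi <= 4 :> R by have := @pihalf_lt2 R; lra.
  (* Unless box [J] contains [th], the induction on [J] finds a box [j] that contains it while the
     next one does not. *)
  have [QJ|[j [/andP[j0j jJ'] [h1 h2] nQ]]] :
     (`|th.1| <= r1 J /\ `|th.2| <= r2 J) \/ exists j, [/\ (j0 <= j < J)%N,
       `|th.1| <= r1 j /\ `|th.2| <= r2 j & ~ (`|th.1| <= r1 j.+1 /\ `|th.2| <= r2 j.+1)].
    move: j0J; clear - t1 t2 pi4; elim: J => [|J IH] j0J.
      left; rewrite /r1 /r2; move: j0J; rewrite leqn0 => /eqP ->; rewrite leqnn; split; exact: le_trans pi4.
    have [Q|nQ] := pselect (`|th.1| <= r1 J.+1 /\ `|th.2| <= r2 J.+1); first by left.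
    move: j0J; rewrite leq_eqVlt => /orP[/eqP j0E|]; last rewrite ltnS => j0J.
      left; rewrite /r1 /r2 -j0E leqnn; split; exact: le_trans pi4.
    right; have [Q|[j [/andP[j1' j2] Q1 Q2]]] := IH j0J.
      by exists J; rewrite j0J ltnSn.
    by exists j; rewrite j1' ltnS ltnW.
  - by left.
  right; exists j; split => //; first by rewrite j0j.
  have [jE|jj0] := eqVneq j j0.
    rewrite jE in nQ *; rewrite /rho le_max; apply/orP; right.
    rewrite lerXn2r// ?nnegrE ?chf_ge0//; apply: away => //.
    move: nQ; rewrite /r1 /r2 ltnNge leqnn /= => /not_andP[|] /negP; rewrite -ltNge => /ltW ->//.
    by rewrite orbT.
  have jgt : (j0 < j)%N by rewrite ltn_neqAle eq_sym jj0.
  have [r1j r2j] : r1 j = (a1 (p2 j))^-1 /\ r2 j = (a2 (p2 j))^-1.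
    by rewrite /r1 /r2 leqNgt jgt.
  have [r1S r2S] : r1 j.+1 = (a1 (p2 j.+1))^-1 /\ r2 j.+1 = (a2 (p2 j.+1))^-1.
    by rewrite /r1 /r2 leqNgt ltnS j0j.
  move: h1 h2 nQ; rewrite r1j r2j r1S r2S => h1 h2 nQ.
  have B1 : 0 < a1 (2 ^ j)%:R := A1 j.
  have B2 : 0 < a2 (2 ^ j)%:R := A2 j.
  rewrite -(chfX Xiid) /rho le_max; apply/orP; left; apply: annP.
  - apply: leq_trans (leq_trans j0j (ltnW (ltn_expl j (ltnSn 1)))); exact: leq_maxl.
  - by rewrite normrM (gtr0_norm B1) -ler_pdivlMl ?mulr1.
  - by rewrite normrM (gtr0_norm B2) -ler_pdivlMl ?mulr1.
  have B1' := A1 j.+1; have B2' := A2 j.+1.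
  have g1 := G1 j j0j; have g2 := G2 j j0j.
  rewrite !normrM (gtr0_norm B1) (gtr0_norm B2).
  move/not_andP : nQ => [|] /negP; rewrite -ltNge => hh; apply/orP; [left|right].
    rewrite -ler_pdivrMl//; apply: le_trans (ltW hh).
    by rewrite -invfM lef_pV2 ?posrE ?mulr_gt0// mulrC.
  rewrite -ler_pdivrMl//; apply: le_trans (ltW hh).
  by rewrite -invfM lef_pV2 ?posrE ?mulr_gt0// mulrC.
have [L0 L0P] := grid_dyadic_bound Xiid rho01 kappa1 CP Jn j0J (A1 J) (A2 J)
  (fun j jj => radius a1 J j a1_gt0 G1 kappaA jj)
  (fun j jj => radius a2 J j a2_gt0 G2 kappaB jj) cover.
set B : R := 3 * kappa ^+ 3 * C / (a1 (p2 J) * a2 (p2 J)) in L0P.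
have n2 : n%:R <= 2 * p2 J by rewrite -p2S ler_nat ltnW.
have nge : p2 J <= n%:R by rewrite ler_nat.
have [b1 b2] := big J j0J.
have E1 : a1 n%:R <= 2 * a1 (p2 J) by apply: D1.
have E2 : a2 n%:R <= 2 * a2 (p2 J) by apply: D2.
have a1n : 0 < a1 n%:R by rewrite a1_gt0// ltr0n.
have a2n : 0 < a2 n%:R by rewrite a2_gt0// ltr0n.
have I1 : (a1 (p2 J))^-1 <= 2 / a1 n%:R by rewrite ler_pdivlMr// ler_pdivrMl// mulrC.
have I2 : (a2 (p2 J))^-1 <= 2 / a2 n%:R by rewrite ler_pdivlMr// ler_pdivrMl// mulrC.
have BE : B <= 12 * kappa ^+ 3 * C / (a1 n%:R * a2 n%:R).
  have c0 : 0 < 3 * kappa ^+ 3 * C by rewrite !mulr_gt0// exprn_gt0.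
  have -> : 12 * kappa ^+ 3 * C / (a1 n%:R * a2 n%:R) =
     3 * kappa ^+ 3 * C * (2 / a1 n%:R * (2 / a2 n%:R)) by field; rewrite !gt_eqF.
  rewrite /B ler_pM2l// invfM; apply: ler_pM => //; rewrite invr_ge0 ltW//.
have B0 : 0 <= B by rewrite /B divr_ge0 ?mulr_ge0 ?exprn_ge0 ?(ltW k0) ?(ltW C0)// ltW.
have D0 : 0 < 12 * kappa ^+ 3 * C / (a1 n%:R * a2 n%:R).
  by rewrite divr_gt0 ?mulr_gt0// exprn_gt0.
have DE : 48 * kappa ^+ 3 * C / (a1 n%:R * a2 n%:R) = 4 * (12 * kappa ^+ 3 * C / (a1 n%:R * a2 n%:R)).
  by field; rewrite !gt_eqF.
have W1 (th : R * R) : 1 <= 1 + a1 (p2 J) * `|th.1| + a2 (p2 J) * `|th.2|.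
  by rewrite -addrA lerDl addr_ge0// mulr_ge0// ltW.
split=> [x|x y].
  apply: (@le_trans _ _ B).
    apply: (@pmf_le_grid _ _ _ P X Xiid n x _ L0) => L /L0P; apply: le_trans.
    by apply: grid_mean_le => i j; rewrite ler_peMr ?chf_ge0.
  by rewrite DE; lra.
set z := x - y.
set q := `|z.1%:~R| / a1 (p2 J) + `|z.2%:~R| / a2 (p2 J).
have q0 : 0 <= q by rewrite addr_ge0// divr_ge0// ltW.
have qE : q <= 2 * (`|z.1%:~R| / a1 n%:R + `|z.2%:~R| / a2 n%:R).
  rewrite mulrDr; apply: lerD.
    by rewrite mulrCA ler_wpM2l.
  by rewrite mulrCA ler_wpM2l.
apply: (@le_trans _ _ (2 * (q * B))).
  apply: (@pmf_dist_grid _ _ _ P X Xiid n x y _ L0) => L /L0P h.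
  apply: (@le_trans _ _ (q * grid_mean L (fun th => chf n th * (1 + a1 (p2 J) * `|th.1| + a2 (p2 J) * `|th.2|)))); last first.
    by rewrite ler_wpM2l.
  rewrite -grid_meanZ; apply: grid_mean_le => i j; set th := (_, _) : R * R.
  rewrite mulrCA ler_wpM2l ?chf_ge0//.
  exact: phase_weight.
rewrite DE; apply: (@le_trans _ _ (2 * (2 * (`|z.1%:~R| / a1 n%:R + `|z.2%:~R| / a2 n%:R) *
  (12 * kappa ^+ 3 * C / (a1 n%:R * a2 n%:R))))).
  by rewrite ler_pM2l//; apply: ler_pM.
by rewrite le_eqVlt; apply/orP; left; apply/eqP; ring.
Qed.

End Local_bounds.

(** * Local limit theorem at the origin *)

Section LLT_arithmetic.
Context {R : realFieldType}.

(** [N] counts the lattice points of the box of half-sides [dl * a1 n] and [dl * a2 n], [Pq] is its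
    probability, [D = 4 * dl ^+ 2] its scaled area, [c] is [1 / (a1 n * a2 n)], and [u] compares
    [N * c] with [D]. Half of [e] pays for the Lipschitz error [k], the other half for [eta] and
    [tau]. *)
Lemma llt_arith (g0 e eta tau u k D p c N Pq : R) :
  0 < g0 -> 0 < e -> e <= g0 -> eta = e / 16 -> tau = e / (64 * g0) ->
  0 <= k -> k <= e / 2 -> 0 < D -> 0 < N -> 0 < c ->
  N * c = D * u -> (1 - tau) ^+ 2 <= u -> u <= (1 + tau) ^+ 2 ->
  `|N * p - Pq| <= N * (k * c) ->
  D * ((g0 - eta) * (1 - tau) ^+ 2 - eta) <= Pq ->
  Pq <= D * ((g0 + eta) * (1 + tau) ^+ 2 + eta) ->
  `|p - g0 * c| <= e * c.
Proof.
move=> g00 e0 eg etaE tauE k0 ke D0 N0 c0 NcE ul uu Hp Pl Pu.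
have tau0 : 0 < tau by rewrite tauE divr_gt0// mulr_gt0.
have tauG : tau * g0 = e / 64 by rewrite tauE; field; rewrite gt_eqF.
have tau1 : tau <= 64^-1.
  by rewrite tauE ler_pdivrMr ?mulr_gt0// mulrA mulVf ?mul1r.
have sq : (1 + tau) ^+ 2 <= (1 + 8 * tau) * (1 - tau) ^+ 2 by nra.
have v1 : 2^-1 <= (1 - tau) ^+ 2 by nra.
have eta0 : 0 < eta by rewrite etaE divr_gt0.
have u0 : 0 < u by apply: lt_le_trans ul; lra.
have tauE2 : tau * eta <= eta / 64 by rewrite mulrC ler_pM2l.
have up : (g0 + eta) * (1 + tau) ^+ 2 + eta <= (g0 + e / 2) * u.
  apply: (@le_trans _ _ ((g0 + e / 2) * (1 - tau) ^+ 2)); last by rewrite ler_wpM2l//; lra.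
  apply: (@le_trans _ _ ((g0 + eta) * ((1 + 8 * tau) * (1 - tau) ^+ 2) + 2 * eta * (1 - tau) ^+ 2)).
    by apply: lerD; [rewrite ler_wpM2l//; lra|rewrite -mulrA mulrCA ler_peMr ?(ltW eta0)//; lra].
  rewrite mulrA -mulrDl ler_wpM2r//; first by rewrite sqr_ge0.
  rewrite mulrDl !mulrDr !mulr1.
  have e1 : g0 * (8 * tau) = e / 8 by rewrite mulrCA (mulrC g0) tauG; field.
  have e2 : eta * (8 * tau) <= eta / 8 by rewrite mulrCA (mulrC eta); lra.
  by rewrite e1; lra.
have lo : (g0 - e / 2) * u <= (g0 - eta) * (1 - tau) ^+ 2 - eta.
  apply: (@le_trans _ _ ((g0 - e / 2) * ((1 + 8 * tau) * (1 - tau) ^+ 2))).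
    by rewrite ler_wpM2l//; [lra|exact: le_trans sq].
  apply: (@le_trans _ _ ((g0 - eta) * (1 - tau) ^+ 2 - 2 * eta * (1 - tau) ^+ 2)); last first.
    by rewrite lerD2l lerN2 -mulrA mulrCA ler_peMr ?(ltW eta0)//; lra.
  rewrite mulrA -mulrBl ler_wpM2r//; first by rewrite sqr_ge0.
  rewrite mulrDr mulr1 mulrBl.
  have e1 : g0 * (8 * tau) = e / 8 by rewrite mulrCA (mulrC g0) tauG; field.
  have e2 : 0 <= e / 2 * (8 * tau) by rewrite mulr_ge0//; lra.
  by rewrite e1; lra.
move: Hp; rewrite ler_distl => /andP[Hl Hu].
have kc : N * (k * c) = D * (u * k) by rewrite mulrCA NcE; ring.
have ku : u * k <= e / 2 * u by rewrite mulrC ler_wpM2r// ltW.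
have Dku : D * (u * k) <= D * (e / 2 * u) by rewrite ler_wpM2l// ltW.
have Dup : D * ((g0 + eta) * (1 + tau) ^+ 2 + eta) <= D * ((g0 + e / 2) * u) by rewrite ler_wpM2l// ltW.
have Dlo : D * ((g0 - e / 2) * u) <= D * ((g0 - eta) * (1 - tau) ^+ 2 - eta) by rewrite ler_wpM2l// ltW.
rewrite ler_distl; apply/andP; split; rewrite -(ler_pM2l N0).
  have -> : N * (g0 * c - e * c) = D * ((g0 - e / 2) * u) - D * (e / 2 * u).
    have -> : N * (g0 * c - e * c) = (g0 - e) * (N * c) by ring.
    by rewrite NcE; field.
  by apply: (@le_trans _ _ (Pq - N * (k * c))) => //; rewrite kc; lra.
have -> : N * (g0 * c + e * c) = D * ((g0 + e / 2) * u) + D * (e / 2 * u).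
  have -> : N * (g0 * c + e * c) = (g0 + e) * (N * c) by ring.
  by rewrite NcE; field.
by apply: (@le_trans _ _ (Pq + N * (k * c))) => //; rewrite kc; lra.
Qed.

End LLT_arithmetic.

Section Box_sums.
Context {R : realType} {d : measure_display} {Omega : measurableType d}.
Variable P : probability Omega R.
Variable X : nat -> Omega -> int * int.
Hypothesis Xiid : iid_steps P X.

Lemma sum_indic_interval (q : nat) (k : int) :
  \sum_(i < q.*2.+1) ((k == i%:Z - q%:Z)%:R : R) = (`|k| <= q)%N%:R.
Proof.
case: (leqP `|k| q) => kq; last first.
  rewrite big1// => i _; case: eqP => // kE; exfalso; move: kq; rewrite kE.
  by have := ltn_ord i; lia.
have iq : (absz (k + q%:Z)%R < q.*2.+1)%N by lia.
rewrite (bigD1 (Ordinal iq))//= big1 ?addr0.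
  by rewrite (_ : k == _) //; apply/eqP; lia.
move=> i /eqP ii; case: eqP => // kE; exfalso; apply: ii; apply/val_inj => /=.
by rewrite kE; lia.
Qed.

Lemma prob_box_sum n (q1 q2 : nat) :
  prob_walk P X n [set y | (`|y.1| <= q1)%N && (`|y.2| <= q2)%N] =
  \sum_(i < q1.*2.+1) \sum_(j < q2.*2.+1)
     pmf_walk P X n (i%:Z - q1%:Z, j%:Z - q2%:Z).
Proof.
rewrite (prob_walk_indic Xiid).
pose f (i : 'I_q1.*2.+1) (j : 'I_q2.*2.+1) w : R :=
  \1_[set (i%:Z - q1%:Z, j%:Z - q2%:Z)] (walk X n w).
have fi i j : P.-integrable setT (EFin \o f i j).
  exact: (integrable_walk Xiid n (bounded_indic [set (i%:Z - q1%:Z, j%:Z - q2%:Z)])).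
have s1 i := @Rintegral_sum _ _ _ P _ (index_enum 'I_q2.*2.+1) (f i) (fi i).
have s2 := @Rintegral_sum _ _ _ P _ (index_enum 'I_q1.*2.+1)
  (fun i w => \sum_(j < q2.*2.+1) f i j w) (fun i => (s1 i).1).
transitivity (\int[P]_w (\sum_(i < q1.*2.+1) \sum_(j < q2.*2.+1) f i j w)).
  apply: eq_Rintegral => w _; rewrite /f; case: (walk X n w) => z1 z2.
  transitivity (((`|z1| <= q1)%N%:R : R) * (`|z2| <= q2)%N%:R).
    rewrite indicE /=; case: (boolP ((`|z1| <= q1)%N && (`|z2| <= q2)%N)) => [h|h].
      by rewrite mem_set//=; case/andP : h => -> ->; rewrite mulr1.
    rewrite memNset/=; last by apply/negP.
    by move: h; rewrite negb_and => /orP[/negbTE ->|/negbTE ->]; rewrite ?mul0r ?mulr0.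
  rewrite -!sum_indic_interval mulr_suml; apply: eq_bigr => i _.
  rewrite mulr_sumr; apply: eq_bigr => j _; rewrite indicE -natrM mulnb; congr (_%:R).
  congr nat_of_bool; rewrite -[RHS]/(_ \in _); apply/idP/idP.
    by move=> /andP[/eqP -> /eqP ->]; rewrite inE.
  by rewrite inE /= => -[-> ->]; rewrite !eqxx.
rewrite s2.2; apply: eq_bigr => i _; rewrite (s1 i).2; apply: eq_bigr => j _.
by rewrite -[RHS]/(prob_walk P X n [set _]) (prob_walk_indic Xiid).
Qed.

End Box_sums.

Section Centered_ord.

Lemma centered_ord (q : nat) (i : 'I_q.*2.+1) : (`|(i%:Z - q%:Z)%R|%N <= q)%N.
Proof. by case: i => i /=; lia. Qed.

End Centered_ord.

Section LLT_origin.
Context {R : realType} {d : measure_display} {Omega : measurableType d}.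
Variable P : probability Omega R.
Variable X : nat -> Omega -> int * int.
Hypothesis Xiid : iid_steps P X.
Variables (a1 a2 : R -> R) (g : R * R -> R).
Hypothesis Xlaw : cvg_in_law_to_density P (rescaled_walk X 0 0 a1 a2) g.
Hypothesis g_ge0 : forall z, 0 <= g z.
Hypothesis g_meas : measurable_fun setT g.
Hypothesis g_cont0 : forall e : R, 0 < e ->
  exists2 dl : R, 0 < dl & forall z, box (0, 0) dl z -> `|g z - g (0, 0)| <= e.
Hypothesis g0_gt0 : 0 < g (0, 0).
Hypothesis a1_gt0 : forall t : R, 0 < t -> 0 < a1 t.
Hypothesis a2_gt0 : forall t : R, 0 < t -> 0 < a2 t.
Hypothesis a1_oo : forall B : R, exists n0 : nat, forall n, (n0 <= n)%N -> B <= a1 n%:R.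
Hypothesis a2_oo : forall B : R, exists n0 : nat, forall n, (n0 <= n)%N -> B <= a2 n%:R.
Hypothesis lipschitz : exists2 C : R, 0 < C & exists n0 : nat, forall n, (n0 <= n)%N ->
  forall x y, `|pmf_walk P X n x - pmf_walk P X n y| <=
     C / (a1 n%:R * a2 n%:R) *
     (`|(x - y).1%:~R| / a1 n%:R + `|(x - y).2%:~R| / a2 n%:R).

(** Truncation misses [2 * dl * a] by at most 1, and the lower bound on [a] makes 1 at most the
    fraction [tau] of it. *)
Lemma lattice_count (dl tau a : R) : 0 < dl -> 0 < tau -> 0 < a ->
  (2 * dl * tau)^-1 <= a ->
  (1 - tau) * (2 * dl * a) <= ((Num.truncn (dl * a)).*2.+1)%:R <= (1 + tau) * (2 * dl * a).
Proof.
move=> dl0 tau0 a0 h.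
have da0 : 0 <= dl * a by rewrite mulr_ge0// ltW.
have /andP[q1 q2] := truncn_itv da0.
have h1 : 1 <= tau * (2 * dl * a).
  rewrite (_ : tau * _ = 2 * dl * tau * a); last by ring.
  by rewrite -ler_pdivrMl ?mulr_gt0// mulr1.
have -> : ((Num.truncn (dl * a)).*2.+1)%:R = 2 * (Num.truncn (dl * a))%:R + 1 :> R.
  by rewrite -addn1 -mul2n natrD natrM.
have q3 : dl * a < (Num.truncn (dl * a))%:R + 1 by rewrite natr1.
have e1 s : (1 + s) * (2 * dl * a) = 2 * (dl * a) + s * (2 * dl * a) by ring.
rewrite !e1 mulNr; move: h1 q1 q3; move: (dl * a) (Num.truncn _)%:R (tau * _) => x q y.
by move=> h1 q1 q3; apply/andP; split; lra.
Qed.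

Lemma llt_origin (eps : R) : 0 < eps -> exists2 dl : R, 0 < dl &
  exists n0 : nat, forall n x, (n0 <= n)%N ->
    `|x.1%:~R| <= dl * a1 n%:R -> `|x.2%:~R| <= dl * a2 n%:R ->
    `|pmf_walk P X n x - g (0, 0) / (a1 n%:R * a2 n%:R)| <= eps / (a1 n%:R * a2 n%:R).
Proof.
move=> eps0; set g0 := g (0, 0).
(* Capping the error at [g0] keeps [g0 - eta] nonnegative and [tau] at most 1/64. *)
pose e : R := Num.min eps g0.
have e0 : 0 < e by rewrite lt_min eps0.
have eg : e <= g0 by rewrite ge_min lexx orbT.
have ee : e <= eps by rewrite ge_min lexx.
pose eta : R := e / 16; pose tau : R := e / (64 * g0).
have eta0 : 0 < eta by rewrite divr_gt0.
have tau0 : 0 < tau by rewrite divr_gt0// mulr_gt0.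
have tau1 : tau <= 64^-1 by rewrite ler_pdivrMr ?mulr_gt0// mulrA mulVf ?mul1r.
have [C C0 [nC HC]] := lipschitz.
have [dg dg0 gP] := g_cont0 eta0.
(* The first bound keeps the box of half-side [(1 + tau) * dl] where [g] varies by at most [eta];
   the second makes the Lipschitz error [k] at most [e / 2], two points of the box being at most
   [2 * dl] apart in each scaled coordinate. *)
pose dl : R := Num.min (dg / 2) (e / (8 * C)).
have dl0 : 0 < dl by rewrite lt_min !divr_gt0// mulr_gt0.
have dlg : dl <= dg / 2 by rewrite ge_min lexx.
have dlC : dl <= e / (8 * C) by rewrite ge_min lexx orbT.
pose k : R := 4 * C * dl.
have k0 : 0 <= k by rewrite !mulr_ge0// ltW.
have ke : k <= e / 2.
  move: dlC; rewrite ler_pdivlMr ?mulr_gt0// /k; lra.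
pose D : R := 4 * dl ^+ 2.
have D0 : 0 < D by rewrite mulr_gt0// exprn_gt0.
have t1 : 0 < 1 - tau by lra.
(* The box at [dl] is enclosed by test functions that fall from 1 to 0 between [dl] and
   [(1 + tau) * dl], respectively between [(1 - tau) * dl] and [dl]. *)
have rU : 0 <= dl < (1 + tau) * dl by rewrite (ltW dl0)/= ltr_pMl// ltrDl.
have rL : 0 <= (1 - tau) * dl < dl by rewrite mulr_ge0 ?(ltW t1) ?(ltW dl0)//= gtr_pMl//; lra.
have eD : 0 < D * eta by rewrite mulr_gt0.
have near r : r <= (1 + tau) * dl -> forall z, box (0, 0) r z -> `|g z - g0| <= eta.
  move=> hr z [z1 z2]; apply: gP; have h : r <= dg.
    apply: (le_trans hr); apply: (@le_trans _ _ (2 * dl)); first by rewrite ler_pM2r//; lra.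
    by lra.
  by split; [exact: le_trans h|exact: le_trans h].
have [nU HU] := @weak_limit_upper _ _ _ P X Xiid a1 a2 g Xlaw g_ge0 g_meas (0, 0) dl
   ((1 + tau) * dl) (g0 + eta) (D * eta) rU eD
   (fun z bz => ltac:(by have := near _ (lexx _) z bz; rewrite ler_distl => /andP[_])).
have m0 : 0 <= g0 - eta by rewrite /eta; lra.
have rL' : (1 - tau) * dl <= (1 + tau) * dl by rewrite ler_pM2r//; lra.
have [nL HL] := @weak_limit_lower _ _ _ P X Xiid a1 a2 g Xlaw g_ge0 g_meas (0, 0)
   ((1 - tau) * dl) dl (g0 - eta) (D * eta) rL eD m0
   (fun z bz => ltac:(by have := near _ rL' z bz; rewrite ler_distl => /andP[])).
have [n1 H1] := a1_oo (2 * dl * tau)^-1.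
have [n2 H2] := a2_oo (2 * dl * tau)^-1.
exists dl => //.
exists (maxn 1 (maxn nC (maxn nU (maxn nL (maxn n1 n2))))) => n x.
rewrite !geq_max => /and5P[n_gt0 nC_le nU_le nL_le /andP[n1_le n2_le]] x1 x2.
have A1 : 0 < a1 n%:R by rewrite a1_gt0// ltr0n.
have A2 : 0 < a2 n%:R by rewrite a2_gt0// ltr0n.
have /andP[c1l c1u] := lattice_count dl0 tau0 A1 (H1 n n1_le).
have /andP[c2l c2u] := lattice_count dl0 tau0 A2 (H2 n n2_le).
have hC := HC n nC_le; have hU := HU n nU_le; have hL := HL n nL_le.
set q1 := Num.truncn (dl * a1 n%:R) in c1l c1u.
set q2 := Num.truncn (dl * a2 n%:R) in c2l c2u.
pose N : R := q1.*2.+1%:R * q2.*2.+1%:R.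
have N0 : 0 < N by rewrite mulr_gt0 ?ltr0n.
pose c : R := (a1 n%:R * a2 n%:R)^-1.
have c0 : 0 < c by rewrite invr_gt0 mulr_gt0.
have boxE : [set z | box (0, 0) dl (scaled a1 a2 n z)] =
    [set y : int * int | (`|y.1| <= q1)%N && (`|y.2| <= q2)%N].
  have coord (a : R) (z : int) : 0 < a -> (`|z%:~R / a - 0| <= dl) = (`|z| <= Num.truncn (dl * a))%N.
    move=> aa; rewrite subr0 normrM normfV (gtr0_norm aa) ler_pdivrMr//.
    by rewrite truncn_ge_nat ?natr_absz ?intr_norm// mulr_ge0// ltW.
  apply/seteqP; split => z.
    by case; rewrite /= (coord _ _ A1) (coord _ _ A2) => -> ->.
  by move=> /= /andP[z1 z2]; split; rewrite /= ?(coord _ _ A1) ?(coord _ _ A2).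
set p := pmf_walk P X n x.
pose Pq : R := prob_walk P X n [set y : int * int | (`|y.1| <= q1)%N && (`|y.2| <= q2)%N].
have diff : `|N * p - Pq| <= N * (k * c).
  rewrite /Pq (prob_box_sum Xiid).
  have cst (v : R) : \sum_(i < q1.*2.+1) \sum_(j < q2.*2.+1) v = N * v.
    under eq_bigr do rewrite sumr_const card_ord.
    by rewrite sumr_const card_ord -mulrnA mulnC -mulr_natl natrM.
  rewrite -!cst -sumrB (le_trans (ler_norm_sum _ _ _))//; apply: ler_sum => i _.
  rewrite -sumrB (le_trans (ler_norm_sum _ _ _))//; apply: ler_sum => j _.
  apply: (le_trans (hC _ _)).
  have side (a : R) (q : nat) (i' : 'I_q.*2.+1) (t : int) : 0 < a -> q = Num.truncn (dl * a) ->
      `|t%:~R| <= dl * a -> `|(t - (i'%:Z - q%:Z))%:~R| / a <= 2 * dl.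
    move=> aa qE ht; rewrite ler_pdivrMr// intrB (le_trans (ler_normB _ _))//.
    have : `|(i'%:Z - q%:Z)%:~R : R| <= dl * a.
      rewrite -intr_norm -natr_absz -truncn_ge_nat ?mulr_ge0 ?(ltW aa) ?(ltW dl0)// -qE.
      exact: centered_ord.
    by lra.
  have s1 := side _ q1 i x.1 A1 erefl x1; have s2 := side _ q2 j x.2 A2 erefl x2.
  rewrite /k /c (_ : 4 * C * dl * _ = C / (a1 n%:R * a2 n%:R) * (2 * dl + 2 * dl)); last by ring.
  apply: ler_wpM2l; first by rewrite divr_ge0 ?mulr_ge0 ?(ltW C0) ?(ltW A1) ?(ltW A2).
  exact: lerD.
have uE : N * c = D * (N * c / D) by field; rewrite gt_eqF.
have AA : 0 < a1 n%:R * a2 n%:R by rewrite mulr_gt0.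
have DA : D * (a1 n%:R * a2 n%:R) = (2 * dl * a1 n%:R) * (2 * dl * a2 n%:R) by rewrite /D; ring.
have B1 : 0 < 2 * dl * a1 n%:R by rewrite !mulr_gt0.
have B2 : 0 < 2 * dl * a2 n%:R by rewrite !mulr_gt0.
have main := @llt_arith R g0 e eta tau (N * c / D) k D p c N Pq g0_gt0 e0 eg erefl erefl
  k0 ke D0 N0 c0 uE.
have {main} : `|p - g0 * c| <= e * c.
  apply: main => //.
  - rewrite ler_pdivlMr// ler_pdivlMr// -mulrA DA expr2 mulrACA.
    by apply: ler_pM => //; rewrite mulr_ge0// ltW.
  - rewrite ler_pdivrMr// ler_pdivrMr// -mulrA DA expr2 mulrACA.
    by apply: ler_pM.
  - rewrite /Pq -boxE; apply: le_trans hL.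
    by rewrite le_eqVlt; apply/orP; left; apply/eqP; rewrite /D; ring.
  - rewrite /Pq -boxE; apply: (le_trans hU).
    by rewrite le_eqVlt; apply/orP; left; apply/eqP; rewrite /D; ring.
move=> h; apply: (le_trans h); rewrite ler_pM2r//.
Qed.

End LLT_origin.

(** * Positivity, measurability and continuity of the Gaussian density *)

Section Normal_density.
Context {R : realType}.
Variables (m : R * R) (s11 s12 s22 : R).
Hypothesis D_gt0 : 0 < s11 * s22 - s12 ^+ 2.
Let g := normal_pdf2 m s11 s12 s22.

Lemma normal_pdf2_gt0 z : 0 < g z.
Proof. by rewrite divr_gt0 ?expR_gt0// !mulr_gt0 ?pi_gt0 ?sqrtr_gt0. Qed.

Lemma measurable_normal_pdf2 : measurable_fun setT g.
Proof.
have mu1 : measurable_fun setT (fun z : R * R => z.1 - m.1).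
  by apply: measurable_funB => //; exact: measurable_fst.
have mu2 : measurable_fun setT (fun z : R * R => z.2 - m.2).
  by apply: measurable_funB => //; exact: measurable_snd.
apply: measurable_funM => //; apply: measurableT_comp => //.
apply: measurable_funM => //; apply: measurableT_comp => //.
apply: measurable_funD; last by apply: measurable_funM => //; exact: measurable_funX.
apply: measurable_funB; first by apply: measurable_funM => //; exact: measurable_funX.
by apply: measurable_funM => //; apply: measurable_funM.
Qed.

Lemma continuous_normal_pdf2 : continuous g.
Proof.
move=> z.
have c1 : (fun z : R * R => z.1 - m.1) @ z --> z.1 - m.1.
  by apply: cvgB; [exact: cvg_fst|exact: cvg_cst].
have c2 : (fun z : R * R => z.2 - m.2) @ z --> z.2 - m.2.
  by apply: cvgB; [exact: cvg_snd|exact: cvg_cst].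
apply: cvgMl.
pose q (z : R * R) := - (s22 * (z.1 - m.1) ^+ 2 - 2 * s12 * (z.1 - m.1) * (z.2 - m.2) +
  s11 * (z.2 - m.2) ^+ 2) / (2 * (s11 * s22 - s12 ^+ 2)).
suff cq : q @ z --> q z by exact: (cvg_comp _ _ cq (@continuous_expR R _)).
apply: cvgMl; apply: cvgN; apply: cvgD; last by apply: cvgMr; exact: cvgM.
apply: cvgB; first by apply: cvgMr; exact: cvgM.
by apply: cvgM => //; apply: cvgMr.
Qed.

Lemma normal_pdf2_near0 (e : R) : 0 < e ->
  exists2 dl : R, 0 < dl & forall z, box (0, 0) dl z -> `|g z - g (0, 0)| <= e.
Proof.
move=> e0; have /cvgrPdist_le/(_ _ e0) := @continuous_normal_pdf2 (0, 0).
case/nbhs_ballP => r /= r0 h; exists (r / 2) => [|z [z1 z2]]; first by rewrite divr_gt0.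
have rr : r / 2 < r by rewrite ltr_pdivrMr// mulr2n mulrDr mulr1 ltrDl.
rewrite distrC; apply: h; split; rewrite /ball/= distrC; exact: le_lt_trans rr.
Qed.

Lemma normal_pdf2_box (r : R) :
  exists2 mm : R, 0 < mm & forall z, box (0, 0) r z -> mm <= g z.
Proof.
pose U := r + `|m.1|; pose V := r + `|m.2|.
pose B := `|s22| * U ^+ 2 + 2 * `|s12| * U * V + `|s11| * V ^+ 2.
pose D := s11 * s22 - s12 ^+ 2; have D0 : 0 < D := D_gt0.
exists (expR (- B / (2 * D)) / (2 * pi * Num.sqrt D)).
  by rewrite divr_gt0 ?expR_gt0// !mulr_gt0 ?pi_gt0 ?sqrtr_gt0.
move=> z [z1 z2]; rewrite /g /normal_pdf2 -/D.
rewrite ler_pM2r ?invr_gt0 ?mulr_gt0 ?pi_gt0 ?sqrtr_gt0// ler_expR.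
rewrite ler_pM2r ?invr_gt0 ?mulr_gt0// lerN2.
have hU : `|z.1 - m.1| <= U.
  by rewrite (le_trans (ler_normB _ _))// lerD2r; move: z1; rewrite /= subr0.
have hV : `|z.2 - m.2| <= V.
  by rewrite (le_trans (ler_normB _ _))// lerD2r; move: z2; rewrite /= subr0.
move: (z.1 - m.1) (z.2 - m.2) hU hV => u v hU hV.
apply: (le_trans (ler_norm _)); apply: (le_trans (ler_normD _ _)); apply: lerD; last first.
  by rewrite normrM normrX ler_wpM2l// lerXn2r ?nnegrE// (le_trans _ hV).
apply: (le_trans (ler_normB _ _)); apply: lerD.
  by rewrite normrM normrX ler_wpM2l// lerXn2r ?nnegrE// (le_trans _ hU).
by rewrite !normrM ger0_norm// ler_pM// ?mulr_ge0// ler_pM ?mulr_ge0.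
Qed.

End Normal_density.

(** * Short times *)

Section Small_times.
Context {R : realType} {d : measure_display} {Omega : measurableType d}.
Variable P : probability Omega R.

Lemma indep_rvC (T U : Type) (V : Omega -> T) (W : Omega -> U) :
  indep_rv P V W -> indep_rv P W V.
Proof. by move=> VW x y; rewrite setIC VW muleC. Qed.

(** With [V w] frozen at [y], the event asks [W] to hit the single point [x - y], which has
    probability at most [b]. *)
Lemma sum_indep_atom (V W : Omega -> int * int) x (A : set (int * int)) (b : R) :
  discrete_rv V -> discrete_rv W -> indep_rv P V W -> 0 <= b ->
  (forall z, P (W @^-1` [set z]) <= b%:E)%E ->
  (P ((V @^-1` A) `&` ((fun w => (V w + W w)%R) @^-1` [set x])) <= b%:E * P (V @^-1` A))%E.
Proof.
move=> mV mW VW b0 Wb.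
have mA : measurable (V @^-1` A) by [].
have mS : discrete_rv (fun w => V w + W w).
  exact: (discrete_rv_comp (fun z => z.1 + z.2) (discrete_rv_pair mV mW)).
have mD : measurable ((V @^-1` A) `&` ((fun w => V w + W w) @^-1` [set x])).
  by apply: measurableI => //; exact: mS.
have := integral_indic P measurableT mD; rewrite setIT => <-.
have := integral_indic P measurableT mA; rewrite setIT => <-.
under eq_integral => w _.
  rewrite (_ : (_)%:E = (\1_A (V w) * \1_[set x] (V w + W w))%:E); last first.
    by rewrite indicI.
  over.
rewrite (ge0_integral_freeze (H := fun y z => (\1_A y * \1_[set x] (y + z))%:E) mV mW VW); last first.
  by move=> y z; rewrite lee_fin.
rewrite -ge0_integralZl//; last exact: (discrete_rv_emeasurable (fun y => (\1_A y)%:E) mV).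
apply: ge0_le_integral => //.
- by move=> w _; apply: integral_ge0 => w' _; rewrite lee_fin.
- exact: (discrete_rv_emeasurable (fun y => \int[P]_w' (\1_A y * \1_[set x] (y + W w'))%:E)%E mV).
- exact: (discrete_rv_emeasurable (fun y => b%:E * (\1_A y)%:E)%E mV).
move=> w _; under eq_integral do rewrite EFinM.
rewrite ge0_integralZl//; last first.
  exact: (discrete_rv_emeasurable (fun z => (\1_[set x] (V w + z))%:E) mW).
rewrite muleC; apply: lee_pmul => //.
  by apply: integral_ge0 => w' _; rewrite lee_fin.
rewrite (_ : (\int[P]_w' _)%E = P (W @^-1` [set x - V w])) ?Wb//.
have := integral_indic P measurableT (mW [set x - V w]); rewrite setIT => <-.
apply: eq_integral => w' _; congr (_%:E); rewrite /indic; congr (_%:R); congr nat_of_bool.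
apply/idP/idP; rewrite !inE /=.
  by move=> <-; rewrite addrC addKr.
by move=> ->; rewrite addrC subrK.
Qed.

Variable X : nat -> Omega -> int * int.
Hypothesis Xiid : iid_steps P X.

(* One of the two halves of a path from [0] to [x] moves by at least half of
   the first coordinate of [x]; the other half costs a factor [b]. *)
Lemma pmf_walkD_le m k x (b : R) :
  (forall z, pmf_walk P X m z <= b) -> (forall z, pmf_walk P X k z <= b) ->
  pmf_walk P X (m + k) x <= b *
    (prob_walk P X m [set z | `|x.1%:~R| / 2 <= `|z.1%:~R : R| ] +
     prob_walk P X k [set z | `|x.1%:~R| / 2 <= `|z.1%:~R : R| ]).
Proof.
move=> mb kb; set A := [set z | _].
have b0 : 0 <= b by apply: le_trans (mb 0); exact: pmf_walk_ge0.
have mW := discrete_walk Xiid m; have mI := discrete_incr Xiid m k.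
have ind := indep_walk_incr Xiid m k.
have E1 : (P ((walk X m @^-1` A) `&` (fun w => walk X m w + incr X m k w)%R @^-1` [set x]) <=
    b%:E * (prob_walk P X m A)%:E)%E.
  rewrite -prob_walkE//; apply: sum_indep_atom => // z.
  by rewrite incr_stationary// pmf_walkE// lee_fin.
have E2 : (P ((incr X m k @^-1` A) `&` (fun w => incr X m k w + walk X m w)%R @^-1` [set x]) <=
    b%:E * (prob_walk P X k A)%:E)%E.
  rewrite -prob_walkE// -(incr_stationary Xiid m); apply: sum_indep_atom => //.
    exact: indep_rvC.
  by move=> z; rewrite pmf_walkE// lee_fin.
have mS : discrete_rv (fun w => walk X m w + incr X m k w).
  exact: (discrete_rv_comp (fun z => z.1 + z.2) (discrete_rv_pair mW mI)).
rewrite -lee_fin EFinM EFinD -pmf_walkE// muleDr//.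
apply: le_trans (leeD E1 E2); apply: le_trans (measureU2 _ _ _); last 2 first.
- by apply: measurableI; [exact: mW|exact: mS].
- apply: measurableI; first exact: mI.
  by under eq_fun do rewrite addrC; exact: mS.
apply: le_measure; rewrite ?inE; first exact: (discrete_walk Xiid).
  apply: measurableU; apply: measurableI; [exact: mW|exact: mS|exact: mI|].
  by under eq_fun do rewrite addrC; exact: mS.
move=> w /=; rewrite walkD => wx.
have [h|h] := lerP (`|x.1%:~R| / 2) (`|(walk X m w).1%:~R : R|); first by left.
right; split; last by rewrite /= addrC.
rewrite /A /= leNgt; apply/negP => h'.
have : `|x.1%:~R : R| <= `|(walk X m w).1%:~R| + `|(incr X m k w).1%:~R|.
  by rewrite -wx /= intrD ler_normD.
by lra.
Qed.

Lemma pmf_walk_le1 n x : pmf_walk P X n x <= 1.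
Proof. by rewrite -lee_fin -pmf_walkE// probability_le1//; exact: (discrete_walk Xiid). Qed.

Variables (a1 a2 : R -> R).
Hypothesis a1_gt0 : forall t : R, 0 < t -> 0 < a1 t.
Hypothesis a2_gt0 : forall t : R, 0 < t -> 0 < a2 t.
Hypothesis ra1 : half_regular a1.
Hypothesis ra2 : half_regular a2.
Hypothesis sup_bound : exists2 C : R, 0 < C & exists n0 : nat, forall n, (n0 <= n)%N ->
  forall x, pmf_walk P X n x <= C / (a1 n%:R * a2 n%:R).

Lemma finite_upper_bound (f : nat -> R) n : exists2 M : R, 0 < M & forall i, (i < n)%N -> f i <= M.
Proof.
elim: n => [|n [M M0 IH]]; first by exists 1.
exists (Num.max M (f n)); first by rewrite lt_max M0.
move=> i; rewrite ltnS leq_eqVlt => /orP[/eqP ->|/IH h]; first by rewrite le_max lexx orbT.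
by rewrite le_max h.
Qed.

(** Meant for [k] either half of [n]. For large [n], regular variation gives [a1 n <= 6 * a1 k] and
    likewise for [a2], whence 36; the finitely many other [n] are covered by the trivial bound 1 and
    an upper bound [M] of [a1 n * a2 n]. *)
Lemma half_time_bound : exists2 C : R, 0 < C & forall n k x, (0 < n)%N ->
  (n <= k.*2.+1)%N -> (k <= n)%N -> pmf_walk P X k x <= C / (a1 n%:R * a2 n%:R).
Proof.
have [C C0 [n0 HC]] := sup_bound.
have K1 : 1 <= 3 :> R by lra.
have [T1 T10 D1] := half_regular_le ra1 a1_gt0 K1.
have [T2 T20 D2] := half_regular_le ra2 a2_gt0 K1.
pose n1 := (maxn 1 (maxn n0 (maxn (Num.truncn T1).+1 (Num.truncn T2).+1))).
have [M M0 HM] := finite_upper_bound (fun n => a1 n%:R * a2 n%:R) n1.*2.+1.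
exists (M + C * 36) => [|n k x n_gt0 nk kn]; first by rewrite addr_gt0// mulr_gt0.
have A0 : 0 < a1 n%:R * a2 n%:R by rewrite mulr_gt0 ?a1_gt0 ?a2_gt0// ltr0n.
rewrite ler_pdivlMr//; have [n_small|n_large] := ltnP n n1.*2.+1.
  apply: (@le_trans _ _ (1 * M)); last by rewrite mul1r lerDl mulr_ge0// ltW.
  by apply: ler_pM; rewrite ?pmf_walk_ge0 ?pmf_walk_le1 ?HM ?(ltW A0).
have k_large : (n1 <= k)%N.
  by rewrite -leq_double -ltnS (leq_trans n_large nk).
move: k_large; rewrite !geq_max => /and4P[k0 nk0 kT1 kT2].
have T1k : T1 <= k%:R by rewrite ltW// (lt_le_trans (truncnS_gt _))// ler_nat.
have T2k : T2 <= k%:R by rewrite ltW// (lt_le_trans (truncnS_gt _))// ler_nat.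
have kn' : k%:R <= n%:R :> R by rewrite ler_nat.
have n3k : n%:R <= 3 * k%:R :> R.
  by rewrite -natrM ler_nat (leq_trans nk)// mulSn mul2n -add1n leq_add2r.
have [A1 _] := D1 _ _ T1k kn' n3k; have [A2 _] := D2 _ _ T2k kn' n3k.
have a1k : 0 < a1 k%:R by rewrite a1_gt0// ltr0n.
have a2k : 0 < a2 k%:R by rewrite a2_gt0// ltr0n.
apply: (@le_trans _ _ (C / (a1 k%:R * a2 k%:R) * (36 * (a1 k%:R * a2 k%:R)))).
  apply: ler_pM; rewrite ?pmf_walk_ge0 ?(ltW A0) ?HC//.
  rewrite (_ : 36 * _ = 2 * 3 * a1 k%:R * (2 * 3 * a2 k%:R)); last by ring.
  by apply: ler_pM => //; rewrite ltW// ?a1_gt0 ?a2_gt0 ?ltr0n.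
rewrite (_ : _ / _ * _ = C * 36) ?lerDr ?(ltW M0)//.
by field; rewrite !gt_eqF.
Qed.

Variables (sg : R -> R) (y0 : R).
Hypothesis deviation : forall m y, y0 <= y ->
  prob_walk P X m [set z | y <= `|z.1%:~R : R| ] <= 64 * m%:R * sg y / y ^+ 2.

Lemma small_time_bound : exists2 C : R, 0 < C & forall n x, (0 < n)%N ->
  y0 <= `|x.1%:~R| / 2 -> pmf_walk P X n x <=
    C / (a1 n%:R * a2 n%:R) * n%:R * (sg (`|x.1%:~R| / 2) / (`|x.1%:~R| / 2) ^+ 2).
Proof.
have [C C0 HC] := half_time_bound; exists (C * 64) => [|n x n0 y0x]; first by rewrite mulr_gt0.
have nE : n = (n./2 + uphalf n)%N by rewrite addnC uphalf_half -addnA addnn odd_double_half.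
have b1 z : pmf_walk P X n./2 z <= C / (a1 n%:R * a2 n%:R).
  apply: HC => //; last by rewrite [leqRHS]nE leq_addr.
  by rewrite -[leqLHS]odd_double_half -addn1 addnC leq_add2l; case: odd.
have b2 z : pmf_walk P X (uphalf n) z <= C / (a1 n%:R * a2 n%:R).
  apply: HC => //; last by rewrite [leqRHS]nE leq_addl.
  rewrite -[leqLHS]odd_double_half -addn1 addnC leq_add//; last by case: odd.
  by rewrite leq_double uphalf_half leq_addl.
rewrite [in pmf_walk _ _ _ _]nE; apply: (le_trans (pmf_walkD_le x b1 b2)).
rewrite (_ : C * 64 / _ * _ * _ = C / (a1 n%:R * a2 n%:R) *
  (64 * (n./2)%:R * sg (`|x.1%:~R| / 2) / (`|x.1%:~R| / 2) ^+ 2 +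
   64 * (uphalf n)%:R * sg (`|x.1%:~R| / 2) / (`|x.1%:~R| / 2) ^+ 2)).
  apply: ler_wpM2l; last by apply: lerD; exact: deviation.
  by rewrite divr_ge0 ?(ltW C0)// mulr_ge0// ltW// ?a1_gt0 ?a2_gt0 ?ltr0n.
have -> : n%:R = n./2%:R + (uphalf n)%:R :> R by rewrite -natrD -nE.
by move: (a1 _ * _) (sg _) ((_ / 2) ^+ 2) => A s y; ring.
Qed.

End Small_times.

(** * Tail sums *)

Section Tail_sums.
Context {R : realType}.

(** Locally uniform regular variation of index 1, the critical one: [n / A n] varies slowly, and the
    index alone does not decide whether the [1 / A n] are summable. *)
Definition regular1 (A : R -> R) := forall K e : R, 1 <= K -> 0 < e ->
  exists2 T : R, 0 < T & forall t s, T <= t -> t <= s -> s <= K * t ->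
  (1 - e) * (s / t) <= A s / A t <= (1 + e) * (s / t).

Lemma half_regular_mul (a1 a2 : R -> R) :
  (forall t : R, 0 < t -> 0 < a1 t) -> (forall t : R, 0 < t -> 0 < a2 t) ->
  half_regular a1 -> half_regular a2 -> regular1 (fun t => a1 t * a2 t).
Proof.
(* [f <= 1] makes the lower bounds nonnegative, so that they can be multiplied and the squares
   removed. *)
move=> p1 p2 r1 r2 K e K1 e0; pose f := Num.min e 1.
have f0 : 0 < f by rewrite lt_min e0 ltr01.
have f1 : f <= 1 by rewrite ge_min lexx orbT.
have fe : f <= e by rewrite ge_min lexx.
have [T1 T10 D1] := r1 K f K1 f0; have [T2 T20 D2] := r2 K f K1 f0.
exists (Num.max T1 T2) => [|t s]; first by rewrite lt_max T10.
rewrite ge_max => /andP[t1 t2] ts sK.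
have t0 : 0 < t by apply: lt_le_trans t1.
have s0 : 0 < s by apply: lt_le_trans ts.
have /andP[l1 u1] := D1 t s t1 ts sK; have /andP[l2 u2] := D2 t s t2 ts sK.
have st0 : 0 < s / t by rewrite divr_gt0.
have q0 : 0 <= a1 s * a2 s / (a1 t * a2 t).
  by rewrite divr_ge0// mulr_ge0// ltW// ?p1 ?p2.
have E : (a1 s / a1 t) ^+ 2 * (a2 s / a2 t) ^+ 2 = (a1 s * a2 s / (a1 t * a2 t)) ^+ 2.
  by field; rewrite !gt_eqF ?p1 ?p2.
have hl : 0 <= (1 - f) * (s / t) by rewrite mulr_ge0 ?subr_ge0// ltW.
have hu : 0 <= (1 + f) * (s / t) by rewrite mulr_ge0 ?addr_ge0// ltW.
apply/andP; split.
  apply: (@le_trans _ _ ((1 - f) * (s / t))); first by rewrite ler_pM2r// lerD2l lerN2.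
  by rewrite -ler_sqr ?nnegrE// -E expr2 ler_pM.
apply: (@le_trans _ _ ((1 + f) * (s / t))); last by rewrite ler_pM2r// lerD2l.
by rewrite -ler_sqr ?nnegrE// -E [leRHS]expr2 ler_pM// sqr_ge0.
Qed.

Variable A : R -> R.
Hypothesis A_gt0 : forall t : R, 0 < t -> 0 < A t.
Hypothesis A_reg : regular1 A.
Local Notation c n := ((A n%:R)^-1).

Lemma inv_A_gt0 n : (0 < n)%N -> 0 < c n.
Proof. by move=> n0; rewrite invr_gt0 A_gt0// ltr0n. Qed.

Lemma inv_A_ratio (K : R) : 1 <= K -> exists2 n0 : nat, (0 < n0)%N &
  forall m n, (n0 <= m)%N -> (m <= n)%N -> n%:R <= K * m%:R ->
  m%:R * c m <= 3 / 2 * (n%:R * c n) /\ n%:R * c n <= 2 * (m%:R * c m).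
Proof.
move=> K1; have h : 0 < 2^-1 :> R by rewrite invr_gt0.
have [T T0 TP] := A_reg K1 h; exists (Num.truncn T).+1 => // m n Tm mn nK.
have m0 : (0 < m)%N by apply: leq_trans Tm.
have n0 : (0 < n)%N by apply: leq_trans mn.
have rm : 0 < m%:R :> R by rewrite ltr0n.
have rn : 0 < n%:R :> R by rewrite ltr0n.
have Am := A_gt0 rm; have An := A_gt0 rn.
have Tm' : T <= m%:R by rewrite ltW// (lt_le_trans (truncnS_gt _))// ler_nat.
have mn' : m%:R <= n%:R :> R by rewrite ler_nat.
have /andP[l u] := TP _ _ Tm' mn' nK.
have E1 : m%:R * c m = A n%:R / A m%:R * (m%:R / A n%:R) by field; rewrite !gt_eqF.
have E2 : n%:R * c n = n%:R / m%:R * (m%:R / A n%:R) by field; rewrite !gt_eqF.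
have q0 : 0 < m%:R / A n%:R by rewrite divr_gt0.
rewrite E1 E2; split.
  by rewrite mulrA ler_pM2r//; apply: (le_trans u); rewrite ler_pM2r ?divr_gt0//; lra.
by rewrite (mulrA 2) ler_pM2r//; have := divr_gt0 rn rm; lra.
Qed.

(** The direct half of Karamata's theorem for the slowly varying [n * c n], by halving [M]: the
    lower half contributes at most [3 / 4] of the claimed bound, the upper half at most [3 / 2] in
    place of [C], and [C >= 8] absorbs both. [C0] covers the finitely many [M] below the
    threshold. *)
Lemma sum_nat_inv_A : exists2 C : R, 0 < C & forall M, (0 < M)%N ->
  \sum_(1 <= n < M.+1) n%:R * c n <= C * M%:R * (M%:R * c M).
Proof.
have K1 : 1 <= 3 :> R by lra.
have [n0 n0_gt0 HR] := inv_A_ratio K1.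
pose f (n : nat) : R := (\sum_(1 <= i < n.+1) i%:R * c i) / (n%:R * (n%:R * c n)).
have [C0 C00 HC0] := finite_upper_bound f n0.*2.+1.
exists (Num.max C0 8) => [|M]; first by rewrite lt_max C00.
set C := Num.max C0 8; have C8 : 8 <= C by rewrite le_max lexx orbT.
have Cgt0 : 0 < C by apply: lt_le_trans C8.
elim/ltn_ind: M => M IH M0.
have rM : 0 < M%:R :> R by rewrite ltr0n.
have cM := inv_A_gt0 M0.
have [Ms|Ml] := ltnP M n0.*2.+1.
  rewrite -mulrA -ler_pdivrMr ?mulr_gt0// (le_trans (HC0 _ Ms))//.
  by rewrite le_max lexx.
set h := M./2; have hM : M = (odd M + h.*2)%N by rewrite odd_double_half.
have n0h : (n0 <= h)%N by rewrite -leq_double -ltnS (leq_trans Ml)// hM -add1n leq_add2r; case: odd.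
have h0 : (0 < h)%N by apply: leq_trans n0h.
have h2M : (h.*2 <= M)%N by rewrite [leqRHS]hM leq_addl.
have hM' : (h < M)%N.
  by apply: leq_trans h2M; rewrite -addnn -addn1 leq_add2l.
have M3h : M%:R <= 3 * h%:R :> R.
  rewrite -natrM ler_nat hM mulSn mul2n leq_add2r; case: odd => //=.
rewrite (big_cat_nat (n := h.+1))//=; last by rewrite ltnS ltnW.
have S2 : \sum_(h.+1 <= i < M.+1) i%:R * c i <= 3 / 2 * (M%:R * c M) * (M.+1 - h.+1)%:R.
  rewrite mulr_natr -sumr_const_nat; apply: ler_sum_nat => i /andP[hi iM].
  apply: (HR i M _ _ _).1 => //; first exact: leq_trans (ltnW hi).
  by apply: (le_trans M3h); rewrite ler_pM2l// ler_nat ltnW.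
have [S1 _] := HR h M n0h (ltnW hM') M3h.
have I := IH h hM' h0.
apply: (le_trans (lerD I S2)).
have Mh : (M.+1 - h.+1)%:R <= M%:R :> R by rewrite ler_nat subSS leq_subr.
have hr : h%:R <= 2^-1 * M%:R :> R.
  by rewrite ler_pdivlMl// -natrM ler_nat mul2n.
have u0 : 0 < h%:R * c h by rewrite mulr_gt0 ?ltr0n ?inv_A_gt0.
move: (h%:R * c h) (M%:R * c M) (mulr_gt0 rM cM) u0 S1 => u v v0 u0 S1.
have J1 : C * h%:R * u <= C * (2^-1 * M%:R) * (3 / 2 * v).
  by apply: ler_pM; rewrite ?ler_pM2l ?mulr_ge0 ?(ltW u0) ?(ltW Cgt0).
have J2 : 3 / 2 * v * (M.+1 - h.+1)%:R <= 3 / 2 * v * M%:R by rewrite ler_pM2l// mulr_gt0.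
apply: (le_trans (lerD J1 J2)).
have J3 : 8 * (M%:R * v) <= C * (M%:R * v) by rewrite ler_pM2r// mulr_gt0.
have := mulr_gt0 rM v0.
rewrite (_ : C * (2^-1 * M%:R) * (3 / 2 * v) = 3 / 4 * (C * (M%:R * v))); last by field.
rewrite (_ : 3 / 2 * v * M%:R = 3 / 2 * (M%:R * v)); last by ring.
rewrite -(mulrA C); move: (C * (M%:R * v)) (M%:R * v) J3 => p q; lra.
Qed.

(* Each of the [J] dyadic blocks of [[M, 2^J M)] contributes at least a
   quarter of [M * c M]. *)
Lemma dyadic_sum_lower J : exists2 n0 : nat, (0 < n0)%N & forall M, (n0 <= M)%N ->
  J%:R / 4 * (M%:R * c M) <= \sum_(M <= n < 2 ^ J * M) c n.
Proof.
have K1 : 1 <= 2 ^+ J :> R by rewrite exprn_ege1// ler1n.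
have [n0 n0_gt0 HR] := inv_A_ratio K1; exists n0 => // M n0M.
have M0 : (0 < M)%N by apply: leq_trans n0M.
have rM : 0 < M%:R :> R by rewrite ltr0n.
have v0 : 0 < M%:R * c M by rewrite mulr_gt0 ?inv_A_gt0.
suff : forall j, (j <= J)%N -> j%:R / 4 * (M%:R * c M) <= \sum_(M <= n < 2 ^ j * M) c n by apply.
elim=> [|j IH] jJ; first by rewrite !mul0r expn0 mul1n big_geq.
have p1 : (M <= 2 ^ j * M)%N by rewrite leq_pmull// expn_gt0.
rewrite (big_cat_nat p1) /=; last by rewrite leq_pmul2r// leq_exp2l.
have -> : j.+1%:R / 4 = j%:R / 4 + 4^-1 :> R by rewrite -addn1 natrD mulrDl mul1r.
rewrite mulrDl; apply: lerD; first exact: IH (ltnW jJ).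
have q0 : 0 < (2 ^ j * M)%:R :> R by rewrite ltr0n muln_gt0 expn_gt0.
have sz : (2 ^ j.+1 * M - 2 ^ j * M = 2 ^ j * M)%N.
  by rewrite expnS -mulnA mul2n -addnn addnK.
apply: (@le_trans _ _ (\sum_(2 ^ j * M <= n < 2 ^ j.+1 * M) M%:R * c M / (3 * (2 ^ j * M)%:R))).
  rewrite sumr_const_nat sz -[leRHS]mulr_natr.
  rewrite (_ : _ / _ * _ = M%:R * c M / 3); last first.
    by move: q0; move: (_ * _)%:R (M%:R * _) => q v q0; field; rewrite gt_eqF.
  by move: v0; move: (M%:R * _) => v; lra.
apply: ler_sum_nat => n /andP[n_ge n_lt].
have nn0 : 0 < n%:R :> R by rewrite ltr0n (leq_trans _ n_ge)// muln_gt0 expn_gt0.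
have [|h _] := HR M n n0M (leq_trans p1 n_ge).
  by rewrite -natrX -natrM ler_nat ltnW// (leq_trans n_lt)// leq_pmul2r// leq_exp2l.
rewrite ler_pdivrMr ?mulr_gt0//; apply: (le_trans h).
have n_le : n%:R <= 2 * (2 ^ j * M)%:R :> R by rewrite -natrM ler_nat mulnA -expnS ltnW.
have cn : 0 < c n by rewrite invr_gt0 A_gt0.
rewrite (_ : 3 / 2 * (n%:R / _) = c n * (3 / 2 * n%:R)) ?ler_pM2l//; last by ring.
by move: n%:R (_ * _)%:R n_le => x y; lra.
Qed.

End Tail_sums.

Section Series_comparison.
Context {R : realType}.
Implicit Types u v : nat -> \bar R.

Lemma lee_eseries_from u v N : (forall n, (N <= n)%N -> 0 <= u n)%E ->
  (forall n, (N <= n)%N -> u n <= v n)%E ->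
  (\sum_(N <= n <oo) u n <= \sum_(N <= n <oo) v n)%E.
Proof.
by move=> u0 uv; rewrite ereal_series [leRHS]ereal_series; apply: lee_nneseries => // n _ /u0.
Qed.

Lemma eq_eseries_from u v N : (forall n, (N <= n)%N -> u n = v n)%E ->
  (\sum_(N <= n <oo) u n = \sum_(N <= n <oo) v n)%E.
Proof. by move=> uv; rewrite ereal_series [RHS]ereal_series; apply: eq_eseriesr. Qed.

End Series_comparison.

Section Truncation.
Context {R : realType}.

Lemma truncnS_le_double (x : R) : 1 <= x -> (Num.truncn x).+1%:R <= 2 * x.
Proof.
move=> x1; have x0 : 0 <= x by apply: le_trans x1.
by have /andP[+ _] := truncn_itv x0; rewrite -natr1; lra.
Qed.

End Truncation.

Section Tail_sum_variation.
Context {R : realType}.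
Variables a1 a2 : R -> R.
Hypothesis a1_gt0 : forall t : R, 0 < t -> 0 < a1 t.
Hypothesis a2_gt0 : forall t : R, 0 < t -> 0 < a2 t.
Hypothesis A_reg : regular1 (fun t => a1 t * a2 t).
Hypothesis summable : (\sum_(1 <= n <oo) ((a1 n%:R * a2 n%:R)^-1)%:E < +oo)%E.

Local Notation c n := ((a1 n%:R * a2 n%:R)^-1).
Local Notation S := (tail_sum a1 a2).

Let A_gt0 (t : R) : 0 < t -> 0 < a1 t * a2 t.
Proof. by move=> t0; rewrite mulr_gt0 ?a1_gt0 ?a2_gt0. Qed.

Let c_gt0 n : (0 < n)%N -> 0 < c n.
Proof. by move=> n0; rewrite invr_gt0 A_gt0// ltr0n. Qed.

Lemma tail_sumE t : (S t)%:E = (\sum_(1 <= n <oo) (if t <= n%:R then c n else 0)%:E)%E.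
Proof.
have -> : S t = fine (\sum_(1 <= n <oo) (if t <= n%:R then c n else 0)%:E)%E.
  by rewrite /tail_sum eseries_mkcond; congr fine; apply: eq_eseriesr => n _; case: ifP.
rewrite fineK// ge0_fin_numE; last first.
  by apply: nneseries_ge0 => n n1 _; case: ifP => // _; rewrite lee_fin ltW ?c_gt0.
apply: le_lt_trans summable; apply: lee_eseries_from => n n1.
  by case: ifP => // _; rewrite lee_fin ltW ?c_gt0.
by case: ifP => // _; rewrite lee_fin ltW ?c_gt0.
Qed.

Lemma tail_sum_nat M : (0 < M)%N -> (S M%:R)%:E = (\sum_(M <= n <oo) (c n)%:E)%E.
Proof.
move=> M0; rewrite tail_sumE.
rewrite (nneseries_split 1 M.-1) => [|n n1]; last by case: ifP => // _; rewrite lee_fin ltW ?c_gt0.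
rewrite add1n prednK// big_nat_cond big1 ?add0e => [|n]; last first.
  by rewrite andbT => /andP[_ nM]; rewrite ler_nat leqNgt nM.
by apply: eq_eseries_from => n Mn; rewrite ler_nat Mn.
Qed.

Lemma tail_sum_split t M : (0 < M)%N -> t <= M%:R ->
  S t = \sum_(1 <= n < M | t <= n%:R) c n + S M%:R.
Proof.
move=> M0 tM; apply: EFin_inj; rewrite EFinD tail_sum_nat// tail_sumE.
rewrite (nneseries_split 1 M.-1) => [|n n1]; last by case: ifP => // _; rewrite lee_fin ltW ?c_gt0.
rewrite add1n prednK//; congr (_ + _)%E; first by rewrite sumEFin [in RHS]big_mkcond.
apply: eq_eseries_from => n Mn; rewrite ifT// (le_trans tM)// ler_nat//.
Qed.

Lemma tail_sum_nonincreasing t t' : t <= t' -> S t' <= S t.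
Proof.
move=> tt; rewrite -lee_fin !tail_sumE; apply: lee_eseries_from => n n1.
  by case: ifP => // _; rewrite lee_fin ltW ?c_gt0.
rewrite lee_fin; case: ifP => [h|_]; first by rewrite (le_trans tt h).
by case: ifP => // _; rewrite ltW ?c_gt0.
Qed.

Lemma tail_sum_ge0 t : 0 <= S t.
Proof.
rewrite -lee_fin tail_sumE; apply: nneseries_ge0 => n n1 _.
by case: ifP => // _; rewrite lee_fin ltW ?c_gt0.
Qed.

Lemma partial_le_tail_sum t M : \sum_(1 <= n < M | t <= n%:R) c n <= S t.
Proof.
rewrite -lee_fin tail_sumE -sumEFin [leLHS]big_mkcond.
apply: le_trans (@nneseries_lim_ge _ _ _ 1 M _) => [|n n1 _].
  by rewrite le_eqVlt; apply/orP; left; apply/eqP/eq_bigr => n _; case: ifP.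
by case: ifP => // _; rewrite lee_fin ltW ?c_gt0.
Qed.

Lemma tail_sum_gt0 t : 0 < S t.
Proof.
pose n := (Num.truncn t).+1; apply: (@lt_le_trans _ _ (c n)); first exact: c_gt0.
apply: le_trans (partial_le_tail_sum t n.+1).
rewrite big_mkcond big_nat_recr//= ifT; last by rewrite ltW// truncnS_gt.
rewrite lerDr big_nat_cond sumr_ge0// => i /andP[/andP[i0 _] _].
by case: ifP => // _; rewrite ltW ?c_gt0.
Qed.

Lemma tail_sum_vanishes : S t @[t --> +oo] --> (0 : R).
Proof.
apply/cvg_pinftyP => e e0.
have fin : (\sum_(0 <= n <oo | (0 < n)%N) (c n)%:E < +oo)%E by rewrite -ereal_series.
have c0 n : (0 < n)%N -> (0 <= (c n)%:E)%E by move=> n0; rewrite lee_fin ltW ?c_gt0.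
have SN : S n%:R @[n --> \oo] --> (0 : R).
  apply: (@fine_cvg _ _ _ _ (fun n => (S n%:R)%:E)).
  apply: cvg_trans (nneseries_tail_cvg fin c0); apply: near_eq_cvg.
  exists 1%N => // N /= N1; rewrite tail_sum_nat// eseries_cond [RHS]eseries_cond.
  by apply: eq_eseriesl => n; case: (leqP N n) => Nn; rewrite ?andbF ?(leq_trans N1 Nn).
have [N _ NP] := (cvgrPdist_le _ _).1 SN e e0.
exists N.+1%:R => // t Nt; have := NP N (leqnn N).
rewrite /= sub0r normrN subr0 !ger0_norm ?tail_sum_ge0//; apply: le_trans.
by apply: tail_sum_nonincreasing; rewrite (le_trans _ Nt)// ler_nat.
Qed.

(** Each dyadic block contributes at least a quarter of [M * c M], so more than [4 / e] blocks are
    taken. *)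
Lemma peak_le_tail_sum (e : R) : 0 < e -> exists2 n0 : nat, (0 < n0)%N &
  forall M, (n0 <= M)%N -> M%:R * c M <= e * S M%:R.
Proof.
move=> e0; have [n0 n00 HJ] := dyadic_sum_lower A_gt0 A_reg (Num.truncn (4 / e)).+1.
exists n0 => // M n0M; have M0 : (0 < M)%N by apply: leq_trans n0M.
rewrite -ler_pdivrMl//; set J := (Num.truncn (4 / e)).+1 in HJ.
have := HJ M n0M; set v := M%:R * _ => hJ.
have v0 : 0 < v by rewrite mulr_gt0 ?ltr0n ?c_gt0.
apply: (@le_trans _ _ (J%:R / 4 * v)).
  by rewrite ler_pM2r// ler_pdivlMr// mulrC ltW// truncnS_gt.
apply: (le_trans hJ); apply: le_trans (partial_le_tail_sum M%:R (2 ^ J * M)).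
rewrite [leRHS](big_cat_nat (n := M))//=; last by rewrite leq_pmull// expn_gt0.
apply: ler_wpDl.
  by rewrite big_nat_cond sumr_ge0// => n /andP[/andP[n1 _] _]; rewrite ltW ?c_gt0.
rewrite [leRHS]big_mkcond; apply: ler_sum_nat => n /andP[Mn nJ].
by rewrite ler_nat Mn.
Qed.

(** [t * c n <= n * c n] for [n >= t], so [S t - S M] is at most the sum of [sum_nat_inv_A] divided
    by [t], hence a constant times [M * c M] because [M <= 2 * K * t]; and [M * c M] is negligible
    before [S M]. *)
Lemma tail_sum_gap (K e : R) : 1 <= K -> 0 < e -> exists2 T : R, 1 <= T & forall t M,
  T <= t -> K * t <= M%:R -> M%:R <= 2 * K * t ->
  M%:R * c M <= e * S M%:R /\ S t - S M%:R <= e * S M%:R.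
Proof.
move=> K1 e0; have [C C0 HC] := sum_nat_inv_A A_gt0 A_reg.
pose e' := Num.min e (e / (C * (2 * K))).
have K0 : 0 < K by apply: lt_le_trans K1.
have CK0 : 0 < C * (2 * K) by rewrite !mulr_gt0.
have e'0 : 0 < e' by rewrite lt_min e0 divr_gt0.
have [n0 n00 HP] := peak_le_tail_sum e'0.
exists n0%:R => [|t M n0t KM M2K]; first by rewrite ler1n.
have t0 : 0 < t by apply: lt_le_trans n0t; rewrite ltr0n.
have tM : t <= M%:R by apply: le_trans KM; rewrite ler_peMl// ltW.
have M0 : (0 < M)%N by rewrite -(ltr0n R) (lt_le_trans t0).
have n0M : (n0 <= M)%N by rewrite -(ler_nat R) (le_trans n0t).
have SM := tail_sum_gt0 M%:R.
have pM := HP M n0M; split.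
  by apply: (le_trans pM); rewrite ler_pM2r// ge_min lexx.
rewrite (tail_sum_split M0 tM) addrK.
rewrite -(ler_pM2l t0) mulr_sumr.
apply: (@le_trans _ _ (\sum_(1 <= n < M.+1) n%:R * c n)).
  rewrite [leRHS]big_nat_recr//=; apply: ler_wpDr.
    by rewrite mulr_ge0// ltW// c_gt0.
  rewrite big_mkcond; apply: ler_sum_nat => n /andP[n1 _].
  case: ifP => [tn|_]; first by rewrite ler_pM2r ?c_gt0.
  by rewrite mulr_ge0// ltW// c_gt0.
apply: (le_trans (HC M M0)).
apply: (@le_trans _ _ (C * (2 * K * t) * (e' * S M%:R))).
  apply: ler_pM => //; rewrite ?mulr_ge0 ?(ltW C0) ?ler_pM2l//.
  by rewrite ltW ?c_gt0.
rewrite (_ : C * _ * _ = t * (C * (2 * K) * e' * S M%:R)); last by ring.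
rewrite ler_pM2l// ler_pM2r// mulrC -ler_pdivlMr//.
by rewrite ge_min lexx orbT.
Qed.

Lemma tail_sum_slow (K e : R) : 1 <= K -> 0 < e -> exists2 T : R, 0 < T & forall t,
  T <= t -> S t <= (1 + e) * S (K * t).
Proof.
move=> K1 e0; have [T T1 HT] := tail_sum_gap K1 e0.
exists T => [|t Tt]; first by apply: lt_le_trans T1.
have t1 : 1 <= t by apply: le_trans Tt.
have K0 : 0 < K by apply: lt_le_trans K1.
have t0 : 0 < t by apply: lt_le_trans t1.
have Kt : 1 <= K * t by rewrite mulr_ege1.
have kM : K * t <= (Num.truncn (K * t)).+1%:R by rewrite ltW// truncnS_gt.
have [|_ h] := HT t (Num.truncn (K * t)).+1 Tt kM.
  by rewrite -mulrA truncnS_le_double.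
have := tail_sum_nonincreasing kM.
move: (S _.+1%:R) (S (K * t)) h => p q h pq.
have : e * p <= e * q by rewrite ler_pM2l.
by lra.
Qed.

Lemma slowly_varying_tail_sum : slowly_varying S.
Proof.
split.
  exists 0; split => [|x _]; last exact: tail_sum_gt0.
  by apply: nonincreasing_measurable => // x y; exact: tail_sum_nonincreasing.
move=> lam lam0; apply/cvg_pinftyP => e e0.
have [l1|l1] := lerP 1 lam.
  have [T T0 HT] := tail_sum_slow l1 e0; exists T => // x Tx.
  have x0 : 0 < x by apply: lt_le_trans Tx.
  have xl : x <= lam * x by rewrite ler_peMl// ltW.
  have Sx := tail_sum_gt0 x; have h := HT x Tx; have h' := tail_sum_nonincreasing xl.
  rewrite ler_distl ler_pdivlMr// ler_pdivrMr//.
  have : e * S (lam * x) <= e * S x by rewrite ler_pM2l.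
  have := mulr_gt0 e0 Sx; move: (S _) (S (lam * x)) h h' => p q.
  by move=> *; apply/andP; split; lra.
(* For [lam < 1] the estimate is applied at [lam * x] with the factor [lam^-1]. *)
have K1 : 1 <= lam^-1 by rewrite invf_ge1// ltW.
have [T T0 HT] := tail_sum_slow K1 e0.
exists (T / lam) => [|x]; first by rewrite divr_gt0.
rewrite ler_pdivrMr// mulrC => Tx; have := HT _ Tx; rewrite mulKf ?gt_eqF// => h.
have x0 : 0 < x by rewrite -(pmulr_rgt0 _ lam0) (lt_le_trans T0).
have xl : lam * x <= x by rewrite ger_pMl// ltW.
have Sx := tail_sum_gt0 x; have h' := tail_sum_nonincreasing xl.
rewrite ler_distl ler_pdivlMr// ler_pdivrMr//.
have := mulr_gt0 e0 Sx; move: (S x) (S (lam * x)) h h' => p q.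
by move=> *; apply/andP; split; lra.
Qed.

End Tail_sum_variation.

(** * The Green function *)

Section Green_arithmetic.
Context {R : realFieldType}.

(** [F] is the Green function, [s] its part from times before [M], [SN] and [SM] are the tail sums
    from [N] and [M]. Three errors of at most [eps / 4] each are added: local limit theorem, short
    times, gap between the tail sums. *)
Lemma green_arith (g0 e1 eps F s SN SM : R) : 0 <= g0 -> 0 <= SM -> SM <= SN -> e1 <= eps / 4 ->
  (g0 - e1) * SM <= F - s -> F - s <= (g0 + e1) * SM -> 0 <= s -> s <= eps / 4 * SM ->
  g0 * (SN - SM) <= eps / 4 * SM -> 0 <= eps -> `|F - g0 * SN| <= eps * SN.
Proof.
move=> g00 SM0 SMN e1e lo hi s0 s1 gap eps0.
have h1 : e1 * SM <= eps / 4 * SM by rewrite ler_wpM2r.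
have h2 : eps / 4 * SM <= eps / 4 * SN by rewrite ler_wpM2l// divr_ge0.
have h3 : g0 * SM <= g0 * SN by rewrite ler_wpM2l.
have h4 : 0 <= eps / 4 * SM by rewrite mulr_ge0// divr_ge0.
have -> : eps * SN = 4 * (eps / 4 * SN) by field.
move: lo hi gap h1 h2 h3 h4 s1; rewrite mulrBl mulrDl mulrBr.
move: (eps / 4 * SN) (eps / 4 * SM) (e1 * SM) (g0 * SM) (g0 * SN) => u v w y z.
by rewrite ler_distl => *; apply/andP; split; lra.
Qed.

End Green_arithmetic.

Section Green_function.
Context {R : realType} {d : measure_display} {Omega : measurableType d}.
Variable P : probability Omega R.
Variable X : nat -> Omega -> int * int.
Hypothesis Xiid : iid_steps P X.
Variables (a1 a2 : R -> R) (g0 : R).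
Hypothesis g0_gt0 : 0 < g0.
Hypothesis a1_gt0 : forall t : R, 0 < t -> 0 < a1 t.
Hypothesis a2_gt0 : forall t : R, 0 < t -> 0 < a2 t.
Hypothesis A_reg : regular1 (fun t => a1 t * a2 t).
Hypothesis summable : (\sum_(1 <= n <oo) ((a1 n%:R * a2 n%:R)^-1)%:E < +oo)%E.
Local Notation c n := ((a1 n%:R * a2 n%:R)^-1).
Local Notation S := (tail_sum a1 a2).
Local Notation p n x := (pmf_walk P X n x).

Variables (sg : R -> R) (y0 : R).
Hypothesis sg_mono : forall x y, x <= y -> sg x <= sg y.
Hypothesis sg_ge0 : forall x, 0 <= sg x.
Hypothesis sg_scale : exists2 T : R, 0 < T & forall t, T <= t ->
  t * (sg (a1 t) / a1 t ^+ 2) <= 2.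
Hypothesis a1_oo : forall B : R, exists2 T : R, 0 < T & forall t, T <= t -> B <= a1 t.
Hypothesis small_times : exists2 C : R, 0 < C & forall n x, (0 < n)%N ->
  y0 <= `|x.1%:~R| / 2 -> p n x <=
    C / (a1 n%:R * a2 n%:R) * n%:R * (sg (`|x.1%:~R| / 2) / (`|x.1%:~R| / 2) ^+ 2).

Let A_gt0 (t : R) : 0 < t -> 0 < a1 t * a2 t.
Proof. by move=> t0; rewrite mulr_gt0 ?a1_gt0 ?a2_gt0. Qed.

Lemma small_time_sum : exists2 C : R, 0 < C & exists2 T : R, 0 < T & forall N x M,
  T <= N -> a1 N <= 2 * `|x.1%:~R| -> `|x.1%:~R| <= 2 * a1 N -> (0 < M)%N ->
  \sum_(1 <= n < M.+1) p n x <= C * (M%:R / N) * (M%:R * c M).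
Proof.
have [C C0 HC] := small_times; have [C' C'0 HS] := sum_nat_inv_A A_gt0 A_reg.
have [T1 T10 HT1] := sg_scale; have [T2 T20 HT2] := a1_oo (4 * y0).
exists (32 * C * C'); first by rewrite !mulr_gt0.
exists (Num.max T1 T2) => [|N x M]; first by rewrite lt_max T10.
rewrite ge_max => /andP[NT1 NT2] lo hi M0.
have N0 : 0 < N by apply: lt_le_trans NT1.
have h1 := HT1 N NT1; have h2 := HT2 N NT2; have aN := a1_gt0 N0.
have HCx := fun n => HC n x; set y := `|x.1%:~R| / 2 in HCx.
have y_ge : a1 N / 4 <= y by rewrite /y; lra.
have y_le : y <= a1 N by rewrite /y; lra.
have y_gt0 : 0 < y by apply: lt_le_trans y_ge; rewrite divr_gt0.
(* [y] lies between [a1 N / 4] and [a1 N]: passing to [a1 N] costs 16 through the square, and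
   [sg (a1 N) / a1 N ^+ 2] is at most [2 / N]. *)
have rate : sg y / y ^+ 2 <= 32 / N.
  rewrite ler_pdivlMr// mulrC.
  apply: (@le_trans _ _ (16 * (N * (sg (a1 N) / a1 N ^+ 2)))); last by lra.
  rewrite (mulrCA 16) ler_pM2l//.
  rewrite (_ : 16 * _ = sg (a1 N) / (a1 N / 4) ^+ 2); last by field; rewrite gt_eqF.
  apply: ler_pM; rewrite ?sg_ge0 ?invr_ge0 ?sqr_ge0 ?sg_mono//.
  have q0 : 0 < a1 N / 4 by rewrite divr_gt0.
  by rewrite lef_pV2 ?posrE ?exprn_gt0// lerXn2r ?nnegrE// ltW.
apply: (@le_trans _ _ (\sum_(1 <= n < M.+1) C * (32 / N) * (n%:R * c n))).
  apply: ler_sum_nat => n /andP[n0 _].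
  have y0y : y0 <= y by apply: le_trans y_ge; lra.
  apply: (le_trans (HCx n n0 y0y)).
  rewrite (_ : C * (32 / N) * _ = C / (a1 n%:R * a2 n%:R) * n%:R * (32 / N)); last by ring.
  by rewrite ler_wpM2l// mulr_ge0// divr_ge0 ?(ltW C0)// ltW// A_gt0// ltr0n.
rewrite -mulr_sumr; have := HS M M0.
move: (\sum_(_ <= _ < _) _) (c M) => s cM h.
rewrite (_ : 32 * C * C' * _ * _ = C * (32 / N) * (C' * M%:R * (M%:R * cM))); last by ring.
by rewrite ler_wpM2l// mulr_ge0 ?divr_ge0// ltW.
Qed.

Hypothesis a1_growth : forall B : R, 1 <= B -> exists2 T : R, 0 < T & forall t s, T <= t ->
  16 * B ^+ 2 * t <= s -> B * a1 t <= a1 s.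
Hypothesis a2_growth : forall B : R, 1 <= B -> exists2 T : R, 0 < T & forall t s, T <= t ->
  16 * B ^+ 2 * t <= s -> B * a2 t <= a2 s.
Hypothesis llt : forall eps : R, 0 < eps -> exists2 dl : R, 0 < dl &
  exists n0 : nat, forall n x, (n0 <= n)%N ->
    `|x.1%:~R| <= dl * a1 n%:R -> `|x.2%:~R| <= dl * a2 n%:R ->
    `|p n x - g0 / (a1 n%:R * a2 n%:R)| <= eps / (a1 n%:R * a2 n%:R).

Lemma green_split x M : (0 < M)%N -> green P X x =
  ((\sum_(1 <= n < M) p n x)%:E + \sum_(M <= n <oo) (p n x)%:E)%E.
Proof.
move=> M0; rewrite /green.
under eq_eseriesr do rewrite pmf_walkE//.
rewrite (nneseries_split 1 M.-1) => [|n _]; last by rewrite lee_fin pmf_walk_ge0.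
by rewrite add1n prednK// sumEFin.
Qed.

Lemma green_between x M (l u : R) : (0 < M)%N -> 0 <= l ->
  (forall n, (M <= n)%N -> l * c n <= p n x <= u * c n) ->
  l * S M%:R <= fine (green P X x) - \sum_(1 <= n < M) p n x <= u * S M%:R.
Proof.
move=> M0 l0 H.
have cS v : (\sum_(M <= n <oo) (v * c n)%:E = (v * S M%:R)%:E)%E.
  rewrite EFinM tail_sum_nat// ereal_series [in RHS]ereal_series -nneseriesZl// => n Mn.
  by rewrite lee_fin ltW// invr_gt0 A_gt0// ltr0n (leq_trans M0).
have cn n : (M <= n)%N -> 0 <= c n.
  by move=> Mn; rewrite ltW// invr_gt0 A_gt0// ltr0n (leq_trans M0).
have lo : ((l * S M%:R)%:E <= \sum_(M <= n <oo) (p n x)%:E)%E.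
  rewrite -cS; apply: lee_eseries_from => n Mn; rewrite lee_fin ?mulr_ge0 ?cn//.
  by have /andP[] := H n Mn.
have hi : (\sum_(M <= n <oo) (p n x)%:E <= (u * S M%:R)%:E)%E.
  rewrite -cS; apply: lee_eseries_from => n Mn; rewrite lee_fin ?pmf_walk_ge0//.
  by have /andP[] := H n Mn.
rewrite (green_split x M0).
have fin : (\sum_(M <= n <oo) (p n x)%:E)%E \is a fin_num.
  by rewrite fin_numElt (lt_le_trans _ lo) ?ltNyr//= (le_lt_trans hi) ?ltry.
by rewrite fineD// addrC addKr -!lee_fin fineK// lo hi.
Qed.

Lemma green_asymp (B eps : R) : 1 <= B -> 0 < eps ->
  exists2 T : R, 0 < T & forall N x, T <= N ->
    a1 N <= 2 * `|x.1%:~R| -> `|x.1%:~R| <= 2 * a1 N -> `|x.2%:~R| <= B * a2 N ->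
    `|fine (green P X x) - g0 * S N| <= eps * S N.
Proof.
move=> B1 eps0.
pose e1 := Num.min (eps / 4) g0.
have e10 : 0 < e1 by rewrite lt_min divr_gt0.
have e1e : e1 <= eps / 4 by rewrite ge_min lexx.
have e1g : e1 <= g0 by rewrite ge_min lexx orbT.
have [dl dl0 [n0 Hllt]] := llt e10.
(* From time [16 * b ^+ 2 * N] on, both scales are at least [b] times their values at [N]. The
   coordinates of [x], at most [2 * a1 N] and [B * a2 N], are then within the fraction [dl] of the
   scales that [llt] requires. *)
pose b := Num.max 1 (Num.max (2 / dl) (B / dl)).
have b1 : 1 <= b by rewrite le_max lexx.
have b2 : 2 / dl <= b by rewrite !le_max lexx orbT.
have b3 : B / dl <= b by rewrite !le_max lexx !orbT.
pose K := 16 * b ^+ 2.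
have K1 : 1 <= K.
  have : 1 <= b ^+ 2 by rewrite exprn_ege1.
  by rewrite /K; lra.
have K0 : 0 < K by apply: lt_le_trans K1.
have [Ta Ta0 Ha] := a1_growth b1; have [Tb Tb0 Hb] := a2_growth b1.
have [C C0 [Tc Tc0 Hc]] := small_time_sum.
(* The first bound is for the times before [M], whose sum is at most [C * (2 * K) * (M * c M)], the
   second for [g0 * (S N - S M)]. *)
pose e2 := Num.min (eps / (4 * (C * (2 * K)))) (eps / (4 * g0)).
have CK0 : 0 < C * (2 * K) by rewrite mulr_gt0// mulr_gt0.
have e20 : 0 < e2 by rewrite lt_min !divr_gt0// mulr_gt0.
have e2a : e2 * (C * (2 * K)) <= eps / 4.
  by rewrite -ler_pdivlMr// -[leRHS]mulrA -invfM ge_min lexx.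
have e2b : e2 * g0 <= eps / 4.
  by rewrite -ler_pdivlMr// -[leRHS]mulrA -invfM ge_min lexx orbT.
have [Td Td1 Hd] := tail_sum_gap a1_gt0 a2_gt0 A_reg summable K1 e20.
exists (Num.max 1 (Num.max n0%:R (Num.max Ta (Num.max Tb (Num.max Tc Td))))).
  by rewrite lt_max ltr01.
move=> N x; rewrite !ge_max => /and4P[N1 Nn0 NTa /and3P[NTb NTc NTd]] lo hi hi2.
have N0 : 0 < N by apply: lt_le_trans N1.
have KN1 : 1 <= K * N by rewrite mulr_ege1.
pose M := (Num.truncn (K * N)).+1.
have M0 : (0 < M)%N by [].
have KM : K * N <= M%:R by rewrite ltW// truncnS_gt.
have MK : M%:R <= 2 * K * N by rewrite -mulrA truncnS_le_double.
have NM : N <= M%:R by apply: le_trans KM; rewrite ler_peMl// ltW.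
have [peak gap] := Hd N M NTd KM MK.
have bounds n : (M <= n)%N -> (g0 - e1) * c n <= p n x <= (g0 + e1) * c n.
  move=> Mn; have Mn' : M%:R <= n%:R :> R by rewrite ler_nat.
  have nN := le_trans KM Mn'.
  have n0n : (n0 <= n)%N by rewrite -(ler_nat R) (le_trans Nn0)// (le_trans NM).
  have aN1 := a1_gt0 N0; have aN2 := a2_gt0 N0.
  have x1 : `|x.1%:~R| <= dl * a1 n%:R.
    apply: (le_trans hi); rewrite -ler_pdivrMl// mulrA (mulrC _ 2).
    by apply: le_trans (Ha N n%:R NTa nN); rewrite ler_pM2r.
  have x2 : `|x.2%:~R| <= dl * a2 n%:R.
    apply: (le_trans hi2); rewrite -ler_pdivrMl// mulrA (mulrC _ B).
    by apply: le_trans (Hb N n%:R NTb nN); rewrite ler_pM2r.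
  by have := Hllt n x n0n x1 x2; rewrite ler_distl mulrBl mulrDl.
have l0 : 0 <= g0 - e1 by rewrite subr_ge0.
have /andP[lo' hi'] := green_between M0 l0 bounds.
have small : \sum_(1 <= n < M) p n x <= e2 * (C * (2 * K)) * S M%:R.
  apply: (@le_trans _ _ (\sum_(1 <= n < M.+1) p n x)).
    by rewrite [leRHS]big_nat_recr//= lerDl pmf_walk_ge0.
  apply: (le_trans (Hc N x M NTc lo hi M0)).
  rewrite (_ : e2 * _ * _ = C * (2 * K) * (e2 * S M%:R)); last by ring.
  have cM : 0 <= c M by rewrite ltW// invr_gt0 A_gt0// ltr0n.
  apply: ler_pM => //; first by rewrite mulr_ge0 ?divr_ge0 ?(ltW C0) ?(ltW N0).
    exact: mulr_ge0.
  by rewrite ler_pM2l// ler_pdivrMr.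
have small0 : 0 <= \sum_(1 <= n < M) p n x by rewrite sumr_ge0// => n _; exact: pmf_walk_ge0.
have SNM := tail_sum_nonincreasing a1_gt0 a2_gt0 summable NM.
have SM := tail_sum_gt0 a1_gt0 a2_gt0 summable M%:R.
apply: (green_arith (ltW g0_gt0) (ltW SM) SNM e1e lo' hi' small0 _ _ (ltW eps0)).
  by apply: (le_trans small); rewrite ler_pM2r.
apply: (@le_trans _ _ (g0 * (e2 * S M%:R))); first by rewrite ler_pM2l.
by rewrite mulrA ler_pM2r// mulrC.
Qed.

End Green_function.

(** * Equivalence of the two ratio conditions *)

Section Index_comparison.
Context {R : realType}.
Implicit Types (a : R -> R) (n : nat -> R) (x : nat -> int * int).

Lemma scale_index_near a n : scale_index a n -> forall T : R, exists J : nat,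
  forall j, (J <= j)%N -> [/\ T <= n j, a (n j) <= 2 * j%:R & j%:R <= 2 * a (n j)].
Proof.
move=> [_ noo na] T.
have h : 0 < 2^-1 :> R by rewrite invr_gt0.
have [J1 _ H1] := (cvgrPdist_le _ _).1 na _ h.
have [J2 _ H2] := (cvgryPge _).1 noo T.
exists (maxn 1 (maxn J1 J2)) => j; rewrite !geq_max => /and3P[j0 j1 j2].
have := H1 j j1; rewrite /= ler_distlC => /andP[].
have jj : 0 < j%:R :> R by rewrite ltr0n.
rewrite ler_pdivlMr// ler_pdivrMr// => l u; split; first exact: H2.
  by lra.
by lra.
Qed.

Definition tends_oo (f : nat -> nat) := forall B : nat, \forall k \near \oo, (B <= f k)%N.

Lemma bounded_away_near (r : nat -> R) : bounded_away_0oo r ->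
  exists c C : R, [/\ 0 < c, 1 <= C & \forall k \near \oo, c <= r k <= C].
Proof.
move=> [c [C [c0 H]]]; exists c, (Num.max 1 C); split => //; first by rewrite le_max lexx.
by apply: filterS H => k /andP[-> h]/=; rewrite le_max h orbT.
Qed.

Lemma bounded_away_trans (r : nat -> R) (c C : R) : 0 < c ->
  (\forall k \near \oo, c <= r k <= C) -> bounded_away_0oo r.
Proof. by move=> c0 H; exists c, C. Qed.

Variables (a1 a2 : R -> R) (n1 n2 : nat -> R).
Hypothesis a2_gt0 : forall t : R, 0 < t -> 0 < a2 t.
Hypothesis a2_oo : forall B : R, exists2 T : R, 0 < T & forall t, T <= t -> B <= a2 t.
Hypothesis a2_growth : forall B : R, 1 <= B -> exists2 T : R, 0 < T & forall t s, T <= t ->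
  16 * B ^+ 2 * t <= s -> B * a2 t <= a2 s.
Hypothesis a2_regular : half_regular a2.
Hypothesis n1P : forall T : R, exists J : nat,
  forall j, (J <= j)%N -> [/\ T <= n1 j, a1 (n1 j) <= 2 * j%:R & j%:R <= 2 * a1 (n1 j)].
Hypothesis n2P : forall T : R, exists J : nat,
  forall j, (J <= j)%N -> [/\ T <= n2 j, a2 (n2 j) <= 2 * j%:R & j%:R <= 2 * a2 (n2 j)].
Variables x1 x2 : nat -> nat.
Hypothesis x_oo : tends_oo (fun k => x1 k + x2 k)%N.
Let ratio k := (x2 k)%:R / a2 (n1 (x1 k)).
Let iratio k := n1 (x1 k) / n2 (x2 k).

(** If [x1] stayed below [B], the scale [a2 (n1 (x1 k))] would take finitely many values and the
    upper bound on the ratio would bound [x2] too, against [x_oo]. The lower bound on the ratio then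
    makes [x2] follow [x1] to infinity. *)
Lemma coordinates_oo_of_ratio : bounded_away_0oo ratio -> tends_oo x1 /\ tends_oo x2.
Proof.
move=> /bounded_away_near[c [C [c0 C1 H]]].
have C0 : 0 < C by apply: lt_le_trans C1.
have t1 : tends_oo x1.
  move=> B; have [M M0 HM] := finite_upper_bound (fun j => a2 (n1 j)) B.
  apply: filterS2 H (x_oo (B + (Num.truncn (C * M)).+1)) => k /andP[lo hi] hk.
  rewrite leqNgt; apply/negP => kB; have r0 : 0 < ratio k by apply: lt_le_trans lo.
  (* [n1 0] is arbitrary, so the sign is read off the positive ratio. *)
  have a0 : 0 < a2 (n1 (x1 k)).
    rewrite ltNge; apply/negP => an; move: r0; rewrite ltNge; apply/negP/negPn.
    by rewrite /ratio mulr_ge0_le0// invr_le0.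
  move: hi; rewrite ler_pdivrMr// => hi.
  have : (x2 k)%:R <= C * M by apply: (le_trans hi); rewrite ler_pM2l// HM.
  apply/negP; rewrite -ltNge (lt_le_trans (truncnS_gt _))// ler_nat.
  by rewrite -(leq_add2l B) (leq_trans hk)// leq_add2r ltnW.
split => // B.
have [T T0 HT] := a2_oo (B%:R / c); have [J HJ] := n1P T.
apply: filterS2 H (t1 J) => k /andP[lo _] Jk.
have [Tn _ _] := HJ _ Jk; have a0 : 0 < a2 (n1 (x1 k)) by rewrite a2_gt0// (lt_le_trans T0).
move: lo; rewrite ler_pdivlMr// -(ler_nat R); apply: le_trans.
by rewrite mulrC -ler_pdivrMr// HT.
Qed.

Lemma coordinates_oo_of_iratio : bounded_away_0oo iratio -> tends_oo x1 /\ tends_oo x2.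
Proof.
move=> /bounded_away_near[c [C [c0 C1 H]]].
have C0 : 0 < C by apply: lt_le_trans C1.
split => B.
  have [M M0 HM] := finite_upper_bound n1 B; have [J HJ] := n2P (M / c + 1).
  apply: filterS2 H (x_oo (B + J)) => k /andP[lo hi] hk.
  rewrite leqNgt; apply/negP => kB.
  have Jk : (J <= x2 k)%N by rewrite -(leq_add2l B) (leq_trans hk)// leq_add2r ltnW.
  have [Tn _ _] := HJ _ Jk.
  have Mc : 0 < M / c by rewrite divr_gt0.
  have n20 : 0 < n2 (x2 k) by lra.
  move: lo; rewrite ler_pdivlMr// => lo.
  have : c * n2 (x2 k) <= M by apply: (le_trans lo); exact: HM.
  by rewrite -ler_pdivlMl// mulrC; lra.
have [M M0 HM] := finite_upper_bound n2 B; have [J HJ] := n1P (C * M + 1).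
apply: filterS2 H (x_oo (J + B)) => k /andP[lo hi] hk.
rewrite leqNgt; apply/negP => kB.
have Jk : (J <= x1 k)%N by rewrite -(leq_add2r B) (leq_trans hk)// leq_add2l ltnW.
have [Tn _ _] := HJ _ Jk.
have CM : 0 < C * M by rewrite mulr_gt0.
have n10 : 0 < n1 (x1 k) by lra.
have r0 : 0 < iratio k by apply: lt_le_trans lo.
have n20 : 0 < n2 (x2 k) by move: r0; rewrite /iratio pmulr_rgt0// invr_gt0.
move: hi; rewrite ler_pdivrMr// => hi.
have : n1 (x1 k) <= C * M by apply: (le_trans hi); rewrite ler_pM2l// HM.
by lra.
Qed.

(** Both conditions compare [a2] at [n1 (x1 k)] and at [n2 (x2 k)], the latter being within a factor
    2 of [x2 k]. Comparable values force comparable times by [a2_growth], with [B1] and [B2] just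
    above the ratios of values that can occur; the converse is regular variation. *)
Lemma ratio_bounded_away : bounded_away_0oo ratio <-> bounded_away_0oo iratio.
Proof.
split => H0.
  have [t1 t2] := coordinates_oo_of_ratio H0.
  have [c [C [c0 C1 H]]] := bounded_away_near H0.
  have C0 : 0 < C by apply: lt_le_trans C1.
  pose B1 := 2 * C + 1; pose B2 := 2 / c + 1.
  have B11 : 1 <= B1 by rewrite lerDr mulr_ge0// ltW.
  have B21 : 1 <= B2 by rewrite lerDr divr_ge0// ltW.
  have [T1 T10 G1] := a2_growth B11; have [T2 T20 G2] := a2_growth B21.
  have [J1 HJ1] := n1P T1; have [J2 HJ2] := n2P T2.
  have K1 : 0 < 16 * B1 ^+ 2 by rewrite mulr_gt0// exprn_gt0// (lt_le_trans _ B11).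
  have K2 : 0 < 16 * B2 ^+ 2 by rewrite mulr_gt0// exprn_gt0// (lt_le_trans _ B21).
  apply: (@bounded_away_trans _ (16 * B1 ^+ 2)^-1 (16 * B2 ^+ 2)); first by rewrite invr_gt0.
  apply: filterS2 H (filterI (t1 J1) (t2 J2)) => k /andP[lo hi] [k1 k2].
  have [n1T _ _] := HJ1 _ k1; have [n2T m1 m2] := HJ2 _ k2.
  rewrite /iratio; set N1 := n1 _ in n1T lo hi *; set N2 := n2 _ in n2T m1 m2 *.
  have N10 : 0 < N1 by apply: lt_le_trans n1T.
  have N20 : 0 < N2 by apply: lt_le_trans n2T.
  have A1 := a2_gt0 N10; have A2 := a2_gt0 N20.
  move: lo hi; rewrite /ratio -/N1 ler_pdivlMr// ler_pdivrMr// => lo hi.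
  apply/andP; split.
    rewrite ler_pdivlMr// -ler_pdivlMl ?invr_gt0// invrK.
    rewrite leNgt; apply/negP => /ltW /(G1 _ _ n1T).
    by rewrite /B1; move: (a2 N1) (a2 N2) A1 A2 m1 m2 lo hi => u v *; nra.
  rewrite ler_pdivrMr// leNgt; apply/negP => /ltW /(G2 _ _ n2T).
  have : a2 N1 <= 2 / c * a2 N2 by rewrite mulrAC ler_pdivlMr// mulrC; lra.
  by rewrite /B2 [X in _ -> X <= _ -> _]mulrDl mul1r; move: (2 / c * _) => u; lra.
have [t1 t2] := coordinates_oo_of_iratio H0.
have [c [C [c0 C1 H]]] := bounded_away_near H0.
have C0 : 0 < C by apply: lt_le_trans C1.
pose K := Num.max C c^-1.
have K1 : 1 <= K by rewrite le_max C1.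
have KC : C <= K by rewrite le_max lexx.
have Kc : c^-1 <= K by rewrite le_max lexx orbT.
have K0 : 0 < K by apply: lt_le_trans K1.
have [T T0 HT] := half_regular_le a2_regular a2_gt0 K1.
have cmp (t s : R) : T <= t -> T <= s -> s <= K * t -> t <= K * s -> a2 s <= 2 * K * a2 t.
  move=> Tt Ts sK tK; have [ts|st] := lerP t s; first by have [] := HT t s Tt ts sK.
  have [_ h] := HT s t Ts (ltW st) tK; apply: (le_trans h).
  by rewrite ler_pM2r ?a2_gt0 ?(lt_le_trans T0 Tt)// ler_peMr.
have [J1 HJ1] := n1P T; have [J2 HJ2] := n2P T.
apply: (@bounded_away_trans _ (4 * K)^-1 (4 * K)); first by rewrite invr_gt0 mulr_gt0.
apply: filterS2 H (filterI (t1 J1) (t2 J2)) => k /andP[lo hi] [k1 k2].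
have [n1T _ _] := HJ1 _ k1; have [n2T m1 m2] := HJ2 _ k2.
move: lo hi; rewrite /iratio /ratio; set N1 := n1 _ in n1T *; set N2 := n2 _ in n2T m1 m2 *.
have N10 : 0 < N1 by apply: lt_le_trans n1T.
have N20 : 0 < N2 by apply: lt_le_trans n2T.
have A1 := a2_gt0 N10; have A2 := a2_gt0 N20.
rewrite ler_pdivlMr// ler_pdivrMr// => lo hi.
have h1 : N1 <= K * N2 by apply: (le_trans hi); rewrite ler_pM2r.
have h2 : N2 <= K * N1.
  by apply: (@le_trans _ _ (c^-1 * N1)); rewrite ?ler_pM2r// mulrC ler_pdivlMr// mulrC.
have q1 := cmp _ _ n1T n2T h2 h1; have q2 := cmp _ _ n2T n1T h1 h2.
apply/andP; split; last by rewrite ler_pdivrMr//; lra.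
rewrite ler_pdivlMr// ler_pdivrMl ?mulr_gt0//.
have : K * a2 N2 <= K * (2 * (x2 k)%:R) by rewrite ler_pM2l.
by lra.
Qed.

End Index_comparison.

Section Scaling_function.
Context {R : realType} {d : measure_display} {Omega : measurableType d}.
Variable P : probability Omega R.

Lemma scaling_function_regular (V : Omega -> int) (a : R -> R) :
  discrete_rv V -> scaling_function P (fun w => (V w)%:~R) a ->
  [/\ half_regular a,
      forall B : R, exists2 T : R, 0 < T & forall t, T <= t -> B <= a t
    & forall B : R, 1 <= B -> exists2 T : R, 0 < T & forall t s, T <= t ->
        16 * B ^+ 2 * t <= s -> B * a t <= a s].
Proof.
move=> mV [sv a0 sc].
have mono := truncated_second_moment_mono P mV.
have jump := truncated_second_moment_jump P mV.
split.
- exact: a_ratio mono jump sv a0 sc.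
- exact: a_unbounded jump a0 sc.
- exact: a_growth mono jump sv a0 sc.
Qed.

End Scaling_function.

Theorem theorem3p2 (R : realType) (d : measure_display)
    (Omega : measurableType d) (P : probability Omega R)
    (X : nat -> Omega -> int * int)
    (mu1 mu2 : R) (a1 a2 : R -> R) (g : R * R -> R)
    (phi1 phi2 : R -> R) (gamma1 gamma2 l : R) (n1 n2 : nat -> R)
    (Xiid : iid_steps P X)
    (Xaper : aperiodic P X)
    (mu1E : ('E_P[coord1 X 0%N])%E = mu1%:E)
    (mu2E : ('E_P[coord2 X 0%N])%E = mu2%:E)
    (a1_scale : scaling_function P (coord1 X 0%N) a1)
    (a2_scale : scaling_function P (coord2 X 0%N) a2)
    (g_normal : nondegenerate_normal_density g)
    (X_attracted : cvg_in_law_to_density P (rescaled_walk X mu1 mu2 a1 a2) g)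
    (tail1 : tail_domination P (coord1 X 0%N) phi1 gamma1)
    (tail2 : tail_domination P (coord2 X 0%N) phi2 gamma2)
    (a1_le_a2 : forall n : nat, (0 < n)%N -> a1 n%:R <= a2 n%:R)
    (a1_over_a2 : a1 n%:R / a2 n%:R @[n --> \oo] --> l)
    (l01 : l = 0 \/ l = 1)
    (n1_index : scale_index a1 n1)
    (n2_index : scale_index a2 n2)
    (mu1_0 : mu1 = 0) (mu2_0 : mu2 = 0)
    (summable :
      (\sum_(1 <= n <oo) ((a1 n%:R * a2 n%:R)^-1)%:E < +oo)%E) :
  (forall x : nat -> int * int,
     norm1 (x k) @[k --> \oo] --> \oo ->
     let N1 k := n1 `|(x k).1|%N in
     let N2 k := n2 `|(x k).2|%N in
     let ratio k := `|(x k).2|%:~R / a2 (N1 k) in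
     (bounded_away_0oo ratio <-> bounded_away_0oo (fun k => N1 k / N2 k)) /\
     (bounded_away_0oo ratio ->
      asymp_equiv \oo (fun k => fine (green P X (x k)))
        (fun k => g (0, 0) * tail_sum a1 a2 (N1 k)))) /\
  slowly_varying (tail_sum a1 a2) /\
  tail_sum a1 a2 t @[t --> +oo] --> (0 : R).
Proof.
subst mu1 mu2.
have [m [s11 [s12 [s22 [_ D0 gE]]]]] := g_normal.
have mV1 : discrete_rv (fun w => (X 0%N w).1).
  exact: (discrete_rv_comp fst (discrete_step Xiid 0)).
have mV2 : discrete_rv (fun w => (X 0%N w).2).
  exact: (discrete_rv_comp snd (discrete_step Xiid 0)).
have g_gt0 z : 0 < g z by rewrite gE; exact: normal_pdf2_gt0.
have g_ge0 z : 0 <= g z := ltW (g_gt0 z).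
have g_meas : measurable_fun setT g by rewrite gE; exact: measurable_normal_pdf2.
have g_near0 (e : R) : 0 < e ->
    exists2 dl : R, 0 < dl & forall z, box (0, 0) dl z -> `|g z - g (0, 0)| <= e.
  by rewrite gE; exact: normal_pdf2_near0.
have [b b0 gb] : exists2 b : R, 0 < b & forall z, box (0, 0) 2 z -> b <= g z.
  by rewrite gE; exact: normal_pdf2_box.
have [r1 oo1 growth1] := scaling_function_regular mV1 a1_scale.
have [r2 oo2 growth2] := scaling_function_regular mV2 a2_scale.
have [sv1 a1_gt0 sc1] := a1_scale; have [_ a2_gt0 _] := a2_scale.
have A_reg := half_regular_mul a1_gt0 a2_gt0 r1 r2.
split; last first.
  split; first exact: slowly_varying_tail_sum.
  exact: tail_sum_vanishes.
move=> x x_oo N1 N2 ratio.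
have ratioE : ratio = fun k => (`|(x k).2|%N)%:R / a2 (n1 `|(x k).1|%N).
  by apply/funext => k; rewrite natr_absz.
have sum_oo : tends_oo (fun k => `|(x k).1| + `|(x k).2|)%N.
  by move=> B; exact: (x_oo _ (nbhs_infty_ge B)).
have n1P := scale_index_near n1_index; have n2P := scale_index_near n2_index.
split; first by rewrite ratioE; exact: (ratio_bounded_away a2_gt0 oo2 growth2 r2 n1P n2P sum_oo).
move=> bounded; have [c [C [c0 C1 bd]]] := bounded_away_near bounded.
rewrite ratioE in bounded bd.
have [x1_oo _] := coordinates_oo_of_ratio a2_gt0 oo2 n1P sum_oo bounded.
have [K K0 [n0 LB]] := local_bounds Xiid Xaper a1_gt0 a2_gt0 r1 r2
  (chf_annulus Xiid X_attracted g_ge0 g_meas a1_gt0 a2_gt0 b0 gb).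
have sup_bound : exists2 C : R, 0 < C & exists n0 : nat, forall n, (n0 <= n)%N ->
    forall z, pmf_walk P X n z <= C / (a1 n%:R * a2 n%:R).
  by exists K => //; exists n0 => n /LB[].
have lipschitz : exists2 C : R, 0 < C & exists n0 : nat, forall n, (n0 <= n)%N ->
    forall y z, `|pmf_walk P X n y - pmf_walk P X n z| <= C / (a1 n%:R * a2 n%:R) *
      (`|(y - z).1%:~R| / a1 n%:R + `|(y - z).2%:~R| / a2 n%:R).
  by exists K => //; exists n0 => n /LB[].
have nat_oo (a : R -> R) : (forall B : R, exists2 T : R, 0 < T & forall t, T <= t -> B <= a t) ->
    forall B : R, exists n0 : nat, forall n, (n0 <= n)%N -> B <= a n%:R.
  move=> oo B; have [T _ HT] := oo B; exists (Num.truncn T).+1 => n Tn.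
  by apply: HT; rewrite ltW// (lt_le_trans (truncnS_gt _))// ler_nat.
have llt := llt_origin Xiid X_attracted g_ge0 g_meas g_near0 (g_gt0 _) a1_gt0 a2_gt0
  (nat_oo a1 oo1) (nat_oo a2 oo2) lipschitz.
have [y0 y00 doubling] := sg_doubling sv1.
have small := small_time_bound Xiid a1_gt0 a2_gt0 r1 r2 sup_bound
  (deviation_bound Xiid mu1E y00 doubling).
have sg_scale : exists2 T : R, 0 < T & forall t, T <= t ->
    t * (truncated_second_moment P (coord1 X 0%N) (a1 t) / a1 t ^+ 2) <= 2.
  have [T T0 HT] := h_asymp sc1 ltr01; exists T => // t /HT.
  by rewrite ler_distl => /andP[_]; rewrite -natr1.
have S_gt0 := tail_sum_gt0 a1_gt0 a2_gt0 summable.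
apply/cvgrPdist_le => eps eps0.
have e0 : 0 < eps * g (0, 0) by rewrite mulr_gt0.
have [T T0 HT] := green_asymp Xiid (g_gt0 _) a1_gt0 a2_gt0 A_reg summable
  (truncated_second_moment_mono P mV1) (truncated_second_moment_ge0 P _)
  sg_scale oo1 small growth1 growth2 llt C1 e0.
have [J HJ] := n1P T.
(* The threshold [T] of [green_asymp] is uniform in the point: [x1] tending to infinity carries
   [N1 k] past it, and the upper bound on the ratio supplies the condition on the second coordinate
   with [B = C]. *)
apply: filterS2 bd (x1_oo J) => k /andP[_ hi] /HJ[TN lo up].
have gS : 0 < g (0, 0) * tail_sum a1 a2 (N1 k) by rewrite mulr_gt0.
have NX (z : int) : `|z%:~R| = (`|z|%N)%:R :> R by rewrite natr_absz intr_norm.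
have N10 : 0 < N1 k by apply: lt_le_trans TN.
rewrite /= -[X in X - _](divff (lt0r_neq0 gS)) -mulrBl normrM normfV (gtr0_norm gS).
rewrite ler_pdivrMr// distrC mulrA; apply: HT; rewrite ?NX//.
by move: hi; rewrite ler_pdivrMr// a2_gt0.
Qed.
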